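(* For any recursively inseparable pair $\langle A,B\rangle$, there is an r.e. theory $U_{\langle A,B\rangle}$ such that $\mathsf{G1}$ holds for $U_{\langle A,B\rangle}$ and $U_{\langle A,B\rangle}\lhd\mathbf R$ (namely the theory $U_{\langle A,B\rangle}$ described below).
   Context: A recursively inseparable pair is a pair $\langle A,B\rangle$ of disjoint r.e. subsets of $\mathbb N$ with no recursive $X\subseteq\mathbb N$ such that $A\subseteq X$ and $X\cap B=\emptyset$. $U_{\langle A,B\rangle}$ is the theory in language $\{\mathbf 0,\mathbf S,\mathbf P\}$ ($\mathbf P$ unary relation, $\overline n=\mathbf S^n\mathbf 0$) with axioms $\overline m\neq\overline n$ ($m\neq n$), $\mathbf P(\overline n)$ ($n\in A$), $\neg\mathbf P(\overline n)$ ($n\in B$). $\mathbf R$ is Robinson's theory in language $\{\mathbf 0,\mathbf S,+,\cdot,\le\}$ ($\le$ primitive) with schemes $\overline m+\overline n=\overline{m+n}$; $\overline m\cdot\overline n=\overline{m\cdot n}$; $\overline m\neq\overline n$ for $m\neq n$; $\forall x(x\le\overline n\to x=\overline 0\vee\dots\vee x=\overline n)$; $\forall x(x\le\overline n\vee\overline n\le x)$. ''$\mathsf{G1}$ holds for $T$'': for every recursively axiomatizable consistent theory $S$, if $T$ is interpretable in $S$ then $S$ is incomplete. $S\lhd T$: $S$ is interpretable in $T$ but $T$ is not interpretable in $S$ (relative interpretations). *)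

(* Defs.v *)
From Stdlib Require Import List Arith.
From Stdlib Require Vector.
Import ListNotations.
Set Implicit Arguments.

Inductive prf : Type :=
| PZero : prf
| PSucc : prf
| PProj : nat -> prf
| PComp : prf -> list prf -> prf
| PPrim : prf -> prf -> prf
| PMu   : prf -> prf.

Inductive peval : prf -> list nat -> nat -> Prop :=
| ev_zero args : peval PZero args 0
| ev_succ x args : peval PSucc (x :: args) (S x)
| ev_proj i args : peval (PProj i) args (nth i args 0)
| ev_comp f gs args ys y :
    Forall2 (fun g v => peval g args v) gs ys ->
    peval f ys y -> peval (PComp f gs) args y
| ev_prim0 f g args y : peval f args y -> peval (PPrim f g) (0 :: args) y
| ev_primS f g n args r y :
    peval (PPrim f g) (n :: args) r ->
    peval g (n :: r :: args) y -> peval (PPrim f g) (S n :: args) y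
| ev_mu f args n :
    peval f (n :: args) 0 ->
    (forall m, m < n -> exists k, peval f (m :: args) (S k)) ->
    peval (PMu f) args n.

Definition recursive_set (X : nat -> Prop) : Prop :=
  exists c : prf, forall n,
    (X n -> peval c [n] 1) /\ (~ X n -> peval c [n] 0).

Definition re_set (X : nat -> Prop) : Prop :=
  exists c : prf, forall n, X n <-> exists v, peval c [n] v.

Definition rec_inseparable (A B : nat -> Prop) : Prop :=
  re_set A /\ re_set B /\ (forall n, A n -> B n -> False) /\
  ~ (exists X, recursive_set X /\ (forall n, A n -> X n) /\
                (forall n, X n -> B n -> False)).

Definition cpair (x y : nat) : nat := (x + y) * (x + y + 1) / 2 + y.

Record lang : Type := {
  funcs : Type;
  rels  : Type;
  ar_f  : funcs -> nat;
  ar_r  : rels -> nat }.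

Section Syntax.
Variable L : lang.

Inductive term : Type :=
| var  : nat -> term
| func : forall f : funcs L, Vector.t term (ar_f L f) -> term.

Inductive form : Type :=
| fal  : form
| atom : forall r : rels L, Vector.t term (ar_r L r) -> form
| equ  : term -> term -> form
| imp  : form -> form -> form
| conj : form -> form -> form
| disj : form -> form -> form
| all  : form -> form
| ex   : form -> form.

Definition neg (p : form) : form := imp p fal.
Definition ttrue : form := imp fal fal.

Fixpoint tsubst (s : nat -> term) (t : term) : term :=
  match t with
  | var n => s n
  | func f v => func f (Vector.map (tsubst s) v)
  end.

Definition up (s : nat -> term) : nat -> term :=
  fun n => match n with
           | 0 => var 0
           | S m => tsubst (fun k => var (S k)) (s m)
           end.

Fixpoint fsubst (s : nat -> term) (p : form) : form :=
  match p with
  | fal => fal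
  | atom r v => atom r (Vector.map (tsubst s) v)
  | equ a b => equ (tsubst s a) (tsubst s b)
  | imp a b => imp (fsubst s a) (fsubst s b)
  | conj a b => conj (fsubst s a) (fsubst s b)
  | disj a b => disj (fsubst s a) (fsubst s b)
  | all a => all (fsubst (up s) a)
  | ex a => ex (fsubst (up s) a)
  end.

Definition shift (p : form) : form := fsubst (fun k => var (S k)) p.

Definition inst (t : term) (p : form) : form :=
  fsubst (fun n => match n with 0 => t | S m => var m end) p.

Fixpoint tbound (n : nat) (t : term) : Prop :=
  match t with
  | var m => m < n
  | func f v =>
      (fix go k (w : Vector.t term k) : Prop :=
         match w with
         | Vector.nil _ => True
         | Vector.cons _ a _ w' => tbound n a /\ go _ w'
         end) _ v
  end.

Definition vbound (n : nat) k (w : Vector.t term k) : Prop :=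
  Vector.Forall (tbound n) w.

Fixpoint fbound (n : nat) (p : form) : Prop :=
  match p with
  | fal => True
  | atom r v => vbound n v
  | equ a b => tbound n a /\ tbound n b
  | imp a b | conj a b | disj a b => fbound n a /\ fbound n b
  | all a | ex a => fbound (S n) a
  end.

Definition sentence (p : form) : Prop := fbound 0 p.

Inductive prv : list form -> form -> Prop :=
| Ctx G p : In p G -> prv G p
| ImpI G p q : prv (p :: G) q -> prv G (imp p q)
| ImpE G p q : prv G (imp p q) -> prv G p -> prv G q
| AndI G p q : prv G p -> prv G q -> prv G (conj p q)
| AndE1 G p q : prv G (conj p q) -> prv G p
| AndE2 G p q : prv G (conj p q) -> prv G q
| OrI1 G p q : prv G p -> prv G (disj p q)
| OrI2 G p q : prv G q -> prv G (disj p q)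
| OrE G p q r : prv G (disj p q) -> prv (p :: G) r -> prv (q :: G) r -> prv G r
| AllI G p : prv (map shift G) p -> prv G (all p)
| AllE G p t : prv G (all p) -> prv G (inst t p)
| ExI G p t : prv G (inst t p) -> prv G (ex p)
| ExE G p q : prv G (ex p) -> prv (p :: map shift G) (shift q) -> prv G q
| Explosion G p : prv G fal -> prv G p
| RAA G p : prv (neg p :: G) fal -> prv G p
| EqRefl G t : prv G (equ t t)
| EqLeib G p s t : prv G (equ s t) -> prv G (inst s p) -> prv G (inst t p).

Definition theory : Type := form -> Prop.

Definition tprv (T : theory) (p : form) : Prop :=
  exists G, (forall q, In q G -> T q) /\ prv G p.

Definition consistent (T : theory) : Prop := ~ tprv T fal.

Definition complete (T : theory) : Prop :=
  forall p, sentence p -> tprv T p \/ tprv T (neg p).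

Definition axioms_are_sentences (T : theory) : Prop :=
  forall p, T p -> sentence p.

Section Coding.
Variable ef : funcs L -> nat.
Variable er : rels L -> nat.

Fixpoint code_term (t : term) : nat :=
  match t with
  | var n => cpair 0 n
  | func f v =>
      cpair 1 (cpair (ef f)
        ((fix go k (w : Vector.t term k) : nat :=
            match w with
            | Vector.nil _ => 0
            | Vector.cons _ a _ w' => S (cpair (code_term a) (go _ w'))
            end) _ v))
  end.

Fixpoint code_vec k (w : Vector.t term k) : nat :=
  match w with
  | Vector.nil _ => 0
  | Vector.cons _ a _ w' => S (cpair (code_term a) (code_vec w'))
  end.

Fixpoint code_form (p : form) : nat :=
  match p with
  | fal => cpair 0 0
  | atom r v => cpair 1 (cpair (er r) (code_vec v))
  | equ a b => cpair 2 (cpair (code_term a) (code_term b))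
  | imp a b => cpair 3 (cpair (code_form a) (code_form b))
  | conj a b => cpair 4 (cpair (code_form a) (code_form b))
  | disj a b => cpair 5 (cpair (code_form a) (code_form b))
  | all a => cpair 6 (code_form a)
  | ex a => cpair 7 (code_form a)
  end.
End Coding.

Definition rec_presentation (ef : funcs L -> nat) (er : rels L -> nat) : Prop :=
  (forall f g, ef f = ef g -> f = g) /\ (forall r s, er r = er s -> r = s) /\
  recursive_set (fun n => exists f, n = cpair (ef f) (ar_f L f)) /\
  recursive_set (fun n => exists r, n = cpair (er r) (ar_r L r)).

Definition rec_axiomatizable (S : theory) : Prop :=
  axioms_are_sentences S /\
  exists ef er, rec_presentation ef er /\
  exists Ax : theory, axioms_are_sentences Ax /\
    recursive_set (fun n => exists p, Ax p /\ n = code_form ef er p) /\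
    (forall p, tprv S p <-> tprv Ax p).

Definition re_theory (T : theory) : Prop :=
  axioms_are_sentences T /\
  exists ef er, rec_presentation ef er /\
    re_set (fun n => exists p, T p /\ n = code_form ef er p).

End Syntax.

Arguments var {L}.
Arguments fal {L}.

Definition exs (L : lang) (k : nat) (p : form L) : form L := Nat.iter k (@ex L) p.

Section Interp.
Variables L1 L2 : lang.

(* A translation: a domain formula (free var 0), for each n-ary relation
   symbol a formula with free vars among 0..n-1, and for each n-ary function
   symbol a formula (its graph) with free vars 0..n-1 (arguments) and
   n (value). *)
Record interp : Type := {
  idom : form L2;
  irel : forall r : rels L1, form L2;
  ifun : forall f : funcs L1, form L2 }.

Definition interp_wf (I : interp) : Prop :=
  fbound 1 (idom I) /\
  (forall r, fbound (ar_r L1 r) (irel I r)) /\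
  (forall f, fbound (S (ar_f L1 f)) (ifun I f)).

Variable I : interp.

Definition dom_at (i : nat) : form L2 := fsubst (fun _ => var i) (idom I).

Fixpoint doms (k : nat) : form L2 :=
  match k with
  | 0 => ttrue L2
  | S k' => conj (dom_at k') (doms k')
  end.

(* tr_term off y t : "the value of t equals variable y", where the source
   variable n of t stands for the target variable n + off.  Terms are
   unnested through the graphs of the function symbols, with all
   intermediate values relativized to the domain. *)
Fixpoint tr_term (off y : nat) (t : term L1) {struct t} : form L2 :=
  match t with
  | var n => equ (var (n + off)) (var y)
  | func f v =>
      let k := ar_f L1 f in
      exs k (conj
        ((fix go m (w : Vector.t (term L1) m) (i : nat) {struct w} : form L2 :=
            match w with
            | Vector.nil _ => ttrue L2
            | Vector.cons _ a _ w' => conj (tr_term (off + k) i a) (go _ w' (S i))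
            end) k v 0)
        (conj (doms k)
          (fsubst (fun j => if j <? k then var j else var (y + k)) (ifun I f))))
  end.

Fixpoint tr_args (off : nat) m (w : Vector.t (term L1) m) (i : nat) : form L2 :=
  match w with
  | Vector.nil _ => ttrue L2
  | Vector.cons _ a _ w' => conj (tr_term off i a) (tr_args off w' (S i))
  end.

Fixpoint tr (p : form L1) : form L2 :=
  match p with
  | fal => fal
  | atom r v =>
      let k := ar_r L1 r in
      exs k (conj (tr_args k v 0) (conj (doms k) (irel I r)))
  | equ a b => ex (conj (dom_at 0) (conj (tr_term 1 0 a) (tr_term 1 0 b)))
  | imp a b => imp (tr a) (tr b)
  | conj a b => conj (tr a) (tr b)
  | disj a b => disj (tr a) (tr b)
  | all a => all (imp (dom_at 0) (tr a))
  | ex a => ex (conj (dom_at 0) (tr a))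
  end.
End Interp.

Definition interpretable (L1 L2 : lang) (T : theory L1) (S : theory L2) : Prop :=
  exists I : interp L1 L2, interp_wf I /\
    forall p, sentence p -> tprv T p -> tprv S (tr I p).

Definition strictly_below (L1 L2 : lang) (S : theory L1) (T : theory L2) : Prop :=
  interpretable S T /\ ~ interpretable T S.

Definition G1 (L1 : lang) (T : theory L1) : Prop :=
  forall (L : lang) (S : theory L),
    rec_axiomatizable S -> consistent S -> interpretable T S -> ~ complete S.

Inductive fU : Type := fU_zero | fU_succ.
Definition arU (f : fU) : nat := match f with fU_zero => 0 | fU_succ => 1 end.
Definition LU : lang := {| funcs := fU; rels := unit; ar_f := arU; ar_r := fun _ => 1 |}.

Definition numU (n : nat) : term LU :=
  Nat.iter n (fun t => @func LU fU_succ (Vector.cons _ t 0 (Vector.nil _)))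
             (@func LU fU_zero (Vector.nil _)).

Definition PU (t : term LU) : form LU :=
  @atom LU tt (Vector.cons _ t 0 (Vector.nil _)).

Inductive U_AB (A B : nat -> Prop) : form LU -> Prop :=
| U_neq m n : m <> n -> U_AB A B (neg (equ (numU m) (numU n)))
| U_A n : A n -> U_AB A B (PU (numU n))
| U_B n : B n -> U_AB A B (neg (PU (numU n))).

Inductive fR : Type := fR_zero | fR_succ | fR_plus | fR_times.
Definition arR (f : fR) : nat :=
  match f with fR_zero => 0 | fR_succ => 1 | fR_plus => 2 | fR_times => 2 end.
Definition LR : lang := {| funcs := fR; rels := unit; ar_f := arR; ar_r := fun _ => 2 |}.

Definition numR (n : nat) : term LR :=
  Nat.iter n (fun t => @func LR fR_succ (Vector.cons _ t 0 (Vector.nil _)))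
             (@func LR fR_zero (Vector.nil _)).

Definition plusR (s t : term LR) : term LR :=
  @func LR fR_plus (Vector.cons _ s 1 (Vector.cons _ t 0 (Vector.nil _))).
Definition timesR (s t : term LR) : term LR :=
  @func LR fR_times (Vector.cons _ s 1 (Vector.cons _ t 0 (Vector.nil _))).
Definition leR (s t : term LR) : form LR :=
  @atom LR tt (Vector.cons _ s 1 (Vector.cons _ t 0 (Vector.nil _))).

Fixpoint disj_upto (n : nat) : form LR :=
  match n with
  | 0 => equ (var 0) (numR 0)
  | S m => disj (disj_upto m) (equ (var 0) (numR (S m)))
  end.

Inductive R_ax : form LR -> Prop :=
| R1 m n : R_ax (equ (plusR (numR m) (numR n)) (numR (m + n)))
| R2 m n : R_ax (equ (timesR (numR m) (numR n)) (numR (m * n)))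
| R3 m n : m <> n -> R_ax (neg (equ (numR m) (numR n)))
| R4 n : R_ax (all (imp (leR (var 0) (numR n)) (disj_upto n)))
| R5 n : R_ax (all (disj (leR (var 0) (numR n)) (leR (numR n) (var 0)))).

(* Main.v *)
(** G1: if a consistent complete recursively axiomatizable [T] interpreted [U_AB A B], then
    [{ n | T |- tr (P n) }] and its complement would both be r.e., and this set would be a
    recursive separator of [A] and [B].  Recursive enumerability is handled through Sigma_1
    definability: the least model of a finite Horn program over codes is Sigma_1 (via Goedel's
    beta function), and natural deduction is such a program.

    [U_AB A B] is interpretable in [R_ax]: with Sigma_1 definitions [ex w, alpha w x] of [A] and
    [ex w, beta w x] of [B], interpret [P] by the Rosser formula
    [ex w, alpha w x /\ all v <= w, ~ beta v x].  Derivability in [R_ax] is obtained from truth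
    in all models of [R_ax] by Henkin's completeness theorem.

    [R_ax] is not interpretable in [U_AB A B]: the model [(nat, 0, S, A)] of [U_AB A B] would
    define a binary relation that linearly orders an infinite set.  But in a coloured successor
    structure the truth of a formula [phi(x, y)] at far apart [x], [y] depends only on finitely
    many local colour patterns (a back-and-forth argument), so by the pigeonhole principle
    [phi(a, b)] and [phi(b, a)] agree for two members [a], [b] of any infinite set. *)

Require Import Defs.
From Stdlib Require Import List Arith Lia Factorial Classical ClassicalEpsilon.
From Stdlib Require Import FunctionalExtensionality PropExtensionality.
From Stdlib Require Vector.
Import ListNotations.
Set Implicit Arguments.

(** Writing a proof checker inside [prf] would need course-of-values recursion on codes.
    Definability is therefore a property of predicates on environments with closure lemmas, and
    [prf] is met only in passing to and from [re_set] and [recursive_set]. Formal derivations in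
    [R_ax] are avoided for a similar reason: [tr] unnests every term through existential
    quantifiers. In a model of [R_ax], a translated formula says that the original holds in a
    definable reduct, and soundness there covers all theorems of [U_AB A B] together. Such a model
    may have nonstandard elements, and two axiom schemes control them: what lies below a numeral is
    a numeral, and every element is comparable with every numeral. The second scheme is what refutes
    the Rosser formula on [B] when its witness is nonstandard. In the last part the colouring is
    arbitrary, so some local patterns may occur only finitely often, and a formula can single out
    their positions. Radius alone thus cannot measure what a formula sees; a threshold [D] is
    needed, up to which elements are pinned, and beyond which every pattern that matters recurs. *)

Definition scons (X : Type) (x : X) (r : nat -> X) : nat -> X :=
  fun n => match n with 0 => x | S m => r m end.

(** * Induction on terms, substitution calculus, substitution in derivations *)

Section TermInd.
Variable L : lang.
Variable P : term L -> Prop.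
Hypothesis Hvar : forall n, P (var n).
Hypothesis Hfunc : forall f v, Vector.Forall P v -> P (func f v).

Fixpoint term_nested_ind (t : term L) : P t :=
  match t with
  | var n => Hvar n
  | func f v => Hfunc f
      ((fix go k (w : Vector.t (term L) k) : Vector.Forall P w :=
          match w with
          | Vector.nil _ => @Vector.Forall_nil _ P
          | Vector.cons _ a _ w' => @Vector.Forall_cons _ P _ _ _ (term_nested_ind a) (go _ w')
          end) _ v)
  end.
End TermInd.

Lemma vector_map_ext_Forall (X Y : Type) (f g : X -> Y) k (v : Vector.t X k) :
  Vector.Forall (fun x => f x = g x) v -> Vector.map f v = Vector.map g v.
Proof. induction 1; simpl; congruence. Qed.

Lemma Forall_impl2 (X : Type) (P Q R : X -> Prop) k (v : Vector.t X k) :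
  (forall x, P x -> Q x -> R x) ->
  Vector.Forall P v -> Vector.Forall Q v -> Vector.Forall R v.
Proof.
  intros H. induction v as [|x n v IH]; intros HP HQ; constructor;
    apply Vector.Forall_cons_iff in HP as [HP1 HP2], HQ as [HQ1 HQ2]; auto.
Qed.

Section Substitution.
Variable L : lang.
Implicit Types (s t : nat -> term L) (p : form L).

Lemma tbound_func n f (v : Vector.t (term L) (ar_f L f)) :
  tbound n (func f v) <-> Vector.Forall (tbound n) v.
Proof.
  simpl. generalize (ar_f L f), v. intros k w. induction w as [|a k w IH].
  - split; intros; [constructor|trivial].
  - split.
    + intros [H1 H2]. constructor; [trivial|]. now apply IH.
    + intros H. apply Vector.Forall_cons_iff in H as [H1 H2]. split; [trivial|]. now apply IH.
Qed.

Lemma tsubst_var u : tsubst (@var L) u = u.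
Proof.
  induction u as [n|f v IH] using term_nested_ind; [reflexivity|].
  simpl. f_equal. rewrite <- (Vector.map_id _ _ v) at 2. now apply vector_map_ext_Forall.
Qed.

Lemma tsubst_tsubst s t u :
  tsubst t (tsubst s u) = tsubst (fun n => tsubst t (s n)) u.
Proof.
  induction u as [n|f v IH] using term_nested_ind; [reflexivity|].
  simpl. rewrite Vector.map_map. f_equal. now apply vector_map_ext_Forall.
Qed.

Lemma up_var : up (@var L) = @var L.
Proof. extensionality n. now destruct n. Qed.

Lemma up_comp s t : (fun n => tsubst (up t) (up s n)) = up (fun n => tsubst t (s n)).
Proof.
  extensionality n. destruct n; [reflexivity|].
  simpl. now rewrite !tsubst_tsubst.
Qed.

Lemma fsubst_var p : fsubst (@var L) p = p.
Proof.
  induction p as [|r v|a b|a IHa b IHb|a IHa b IHb|a IHa b IHb|a IHa|a IHa]; simpl;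
    rewrite ?up_var, ?tsubst_var; try congruence.
  f_equal. rewrite <- (Vector.map_id _ _ v) at 2. apply Vector.map_ext. exact tsubst_var.
Qed.

Lemma fsubst_fsubst p : forall s t,
  fsubst t (fsubst s p) = fsubst (fun n => tsubst t (s n)) p.
Proof.
  induction p as [|r v|a b|a IHa b IHb|a IHa b IHb|a IHa b IHb|a IHa|a IHa]; simpl; intros s t;
    rewrite ?IHa, ?IHb, ?up_comp, ?tsubst_tsubst; try reflexivity.
  f_equal. rewrite Vector.map_map. apply Vector.map_ext. intros; apply tsubst_tsubst.
Qed.

Lemma tsubst_bound k s t u :
  (forall n, n < k -> s n = t n) -> tbound k u -> tsubst s u = tsubst t u.
Proof.
  intros H. induction u as [n|f v IH] using term_nested_ind; intros Hb; [now apply H|].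
  rewrite tbound_func in Hb. simpl. f_equal. apply vector_map_ext_Forall.
  eapply Forall_impl2; [|exact IH|exact Hb]. auto.
Qed.

Lemma fsubst_bound p : forall k s t,
  (forall n, n < k -> s n = t n) -> fbound k p -> fsubst s p = fsubst t p.
Proof.
  induction p as [|r v|a b|a IHa b IHb|a IHa b IHb|a IHa b IHb|a IHa|a IHa]; simpl; intros k s t H Hb.
  - reflexivity.
  - f_equal. apply vector_map_ext_Forall.
    eapply Vector.Forall_impl; [|exact Hb]. intros; now apply tsubst_bound with k.
  - destruct Hb. f_equal; now apply tsubst_bound with k.
  - destruct Hb. f_equal; eauto.
  - destruct Hb. f_equal; eauto.
  - destruct Hb. f_equal; eauto.
  - f_equal. apply IHa with (S k); trivial.
    intros [|n] Hn; simpl; [trivial|]. rewrite H; [trivial|lia].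
  - f_equal. apply IHa with (S k); trivial.
    intros [|n] Hn; simpl; [trivial|]. rewrite H; [trivial|lia].
Qed.

Lemma tbound_mono k m (u : term L) : k <= m -> tbound k u -> tbound m u.
Proof.
  intros Hkm. induction u as [n|f v IH] using term_nested_ind; [simpl; lia|].
  rewrite !tbound_func. intros H.
  eapply Forall_impl2; [|exact IH|exact H]. auto.
Qed.

Lemma fbound_mono p : forall k m, k <= m -> fbound k p -> fbound m p.
Proof.
  induction p as [|r v|a b|a IHa b IHb|a IHa b IHb|a IHa b IHb|a IHa|a IHa]; simpl; intros k m Hkm Hb.
  - trivial.
  - eapply Vector.Forall_impl; [|exact Hb]. intros; now apply tbound_mono with k.
  - destruct Hb; split; now apply tbound_mono with k.
  - destruct Hb; split; eauto.
  - destruct Hb; split; eauto.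
  - destruct Hb; split; eauto.
  - apply IHa with (S k); [lia|trivial].
  - apply IHa with (S k); [lia|trivial].
Qed.

Lemma tbound_exists (u : term L) : exists k, tbound k u.
Proof.
  induction u as [n|f v IH] using term_nested_ind; [exists (S n); simpl; lia|].
  enough (exists k, Vector.Forall (tbound k) v) as [k Hk].
  { exists k. now apply tbound_func. }
  revert IH. generalize (ar_f L f), v. intros m w. induction w as [|a m w IHw]; intros IH.
  - exists 0. constructor.
  - apply Vector.Forall_cons_iff in IH as [[k Hk] H2]. destruct (IHw H2) as [k' Hk'].
    exists (k + k'). constructor.
    + apply tbound_mono with k; [lia|trivial].
    + eapply Vector.Forall_impl; [|exact Hk']. intros; apply tbound_mono with k'; [lia|trivial].
Qed.

Lemma fbound_exists p : exists k, fbound k p.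
Proof.
  induction p as [|r v|a b|a [k1 H1] b [k2 H2]|a [k1 H1] b [k2 H2]|a [k1 H1] b [k2 H2]
                 |a [k H]|a [k H]]; simpl;
    try (exists (k1 + k2); split; [apply fbound_mono with k1|apply fbound_mono with k2];
         trivial; lia);
    try (exists k; apply fbound_mono with k; trivial; lia).
  - now exists 0.
  - induction v as [|a m v [k Hk]].
    + exists 0. constructor.
    + destruct (tbound_exists a) as [k' Hk']. exists (k + k'). constructor.
      * apply tbound_mono with k'; [lia|trivial].
      * eapply Vector.Forall_impl; [|exact Hk]. intros; apply tbound_mono with k; [lia|trivial].
  - destruct (tbound_exists a) as [k1 H1], (tbound_exists b) as [k2 H2].
    exists (k1 + k2); split; [apply tbound_mono with k1|apply tbound_mono with k2]; trivial; lia.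
Qed.

Lemma tbound_tsubst k m s u :
  (forall n, n < k -> tbound m (s n)) -> tbound k u -> tbound m (tsubst s u).
Proof.
  intros H. induction u as [n|f v IH] using term_nested_ind; intros Hb; [now apply H|].
  rewrite tbound_func in Hb. simpl tsubst. rewrite tbound_func. apply Vector.Forall_map.
  eapply Forall_impl2; [|exact IH|exact Hb]. auto.
Qed.

Lemma fbound_fsubst p : forall k m s,
  (forall n, n < k -> tbound m (s n)) -> fbound k p -> fbound m (fsubst s p).
Proof.
  induction p as [|r v|a b|a IHa b IHb|a IHa b IHb|a IHa b IHb|a IHa|a IHa]; simpl; intros k m s H Hb.
  - trivial.
  - apply Vector.Forall_map. eapply Vector.Forall_impl; [|exact Hb].
    intros; now apply tbound_tsubst with k.
  - destruct Hb; split; now apply tbound_tsubst with k.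
  - destruct Hb; split; eauto.
  - destruct Hb; split; eauto.
  - destruct Hb; split; eauto.
  - apply IHa with (S k); trivial. intros [|n] Hn; simpl; [lia|].
    apply tbound_tsubst with m; [simpl; lia|]. apply H; lia.
  - apply IHa with (S k); trivial. intros [|n] Hn; simpl; [lia|].
    apply tbound_tsubst with m; [simpl; lia|]. apply H; lia.
Qed.

Lemma inst_scons u p : inst u p = fsubst (scons u (@var L)) p.
Proof. reflexivity. Qed.

Lemma fsubst_inst s u p : fsubst s (inst u p) = inst (tsubst s u) (fsubst (up s) p).
Proof.
  unfold inst. rewrite !fsubst_fsubst. f_equal. extensionality n. destruct n as [|n]; simpl.
  - reflexivity.
  - rewrite tsubst_tsubst. simpl. now rewrite tsubst_var.
Qed.

Lemma fsubst_shift s p : fsubst (up s) (shift p) = shift (fsubst s p).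
Proof. unfold shift. rewrite !fsubst_fsubst. reflexivity. Qed.

Lemma inst_fsubst_up u s p : inst u (fsubst (up s) p) = fsubst (scons u s) p.
Proof.
  unfold inst. rewrite fsubst_fsubst. f_equal. extensionality n. destruct n as [|n]; simpl.
  - reflexivity.
  - rewrite tsubst_tsubst. simpl. now rewrite tsubst_var.
Qed.

Lemma map_shift_fsubst s G :
  map (fsubst (up s)) (map (@shift L) G) = map (@shift L) (map (fsubst s) G).
Proof. rewrite !map_map. apply map_ext. intros; apply fsubst_shift. Qed.

Lemma prv_weaken G p : prv G p -> forall G', incl G G' -> prv G' p.
Proof.
  induction 1; intros G' HG.
  - apply Ctx; auto.
  - apply ImpI. apply IHprv. intros x [->|Hx]; simpl; auto.
  - eapply ImpE; eauto.
  - apply AndI; auto.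
  - eapply AndE1; eauto.
  - eapply AndE2; eauto.
  - apply OrI1; auto.
  - apply OrI2; auto.
  - eapply OrE; [eauto|apply IHprv2|apply IHprv3]; intros x [->|Hx]; simpl; auto.
  - apply AllI. apply IHprv. now apply incl_map.
  - apply AllE; auto.
  - eapply ExI; eauto.
  - eapply ExE; [eauto|]. apply IHprv2. intros x [->|Hx]; simpl; auto.
    right. apply (incl_map _ HG). trivial.
  - apply Explosion; auto.
  - apply RAA. apply IHprv. intros x [->|Hx]; simpl; auto.
  - apply EqRefl.
  - eapply EqLeib; eauto.
Qed.

Lemma prv_subst G p : prv G p -> forall s, prv (map (fsubst s) G) (fsubst s p).
Proof.
  induction 1; intros s0; simpl in *.
  - apply Ctx. now apply in_map.
  - apply ImpI; auto.
  - eapply ImpE; eauto.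
  - apply AndI; auto.
  - eapply AndE1; eauto.
  - eapply AndE2; eauto.
  - apply OrI1; auto.
  - apply OrI2; auto.
  - eapply OrE; eauto.
  - apply AllI. rewrite <- map_shift_fsubst. auto.
  - rewrite fsubst_inst. apply AllE. auto.
  - apply ExI with (tsubst s0 t). rewrite <- fsubst_inst. auto.
  - eapply ExE; [eauto|]. rewrite <- map_shift_fsubst, <- fsubst_shift. auto.
  - apply Explosion; auto.
  - apply RAA; exact (IHprv s0).
  - apply EqRefl.
  - rewrite fsubst_inst. eapply EqLeib; [eauto|]. rewrite <- fsubst_inst. auto.
Qed.

End Substitution.

(** * Structures, satisfaction and soundness *)

Record structure (L : lang) : Type := {
  carrier :> Type;
  fint : forall f : funcs L, Vector.t carrier (ar_f L f) -> carrier;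
  rint : forall r : rels L, Vector.t carrier (ar_r L r) -> Prop }.

Section Semantics.
Variable L : lang.
Variable M : structure L.

Fixpoint eval (rho : nat -> M) (t : term L) : M :=
  match t with
  | var n => rho n
  | func f v => fint M f (Vector.map (eval rho) v)
  end.

Fixpoint sat (rho : nat -> M) (p : form L) : Prop :=
  match p with
  | fal => False
  | atom r v => rint M r (Vector.map (eval rho) v)
  | equ a b => eval rho a = eval rho b
  | imp a b => sat rho a -> sat rho b
  | conj a b => sat rho a /\ sat rho b
  | disj a b => sat rho a \/ sat rho b
  | all a => forall d : M, sat (scons d rho) a
  | ex a => exists d : M, sat (scons d rho) a
  end.

Lemma eval_tsubst rho s t : eval rho (tsubst s t) = eval (fun n => eval rho (s n)) t.
Proof.
  induction t as [n|f v IH] using term_nested_ind; [reflexivity|].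
  simpl. f_equal. rewrite Vector.map_map. now apply vector_map_ext_Forall.
Qed.

Lemma scons_up rho s d :
  (fun n => eval (scons d rho) (up s n)) = scons d (fun n => eval rho (s n)).
Proof.
  extensionality n. destruct n as [|n]; simpl; [reflexivity|]. now rewrite eval_tsubst.
Qed.

Lemma sat_fsubst p : forall rho s, sat rho (fsubst s p) <-> sat (fun n => eval rho (s n)) p.
Proof.
  induction p as [|r v|a b|a IHa b IHb|a IHa b IHb|a IHa b IHb|a IHa|a IHa]; simpl; intros rho s.
  - tauto.
  - rewrite Vector.map_map. erewrite Vector.map_ext; [reflexivity|]. intros; apply eval_tsubst.
  - now rewrite !eval_tsubst.
  - now rewrite IHa, IHb.
  - now rewrite IHa, IHb.
  - now rewrite IHa, IHb.
  - split; intros H d; specialize (H d); rewrite IHa, scons_up in *; trivial.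
  - split; intros [d H]; exists d; rewrite IHa, scons_up in *; trivial.
Qed.

Lemma sat_shift rho d p : sat (scons d rho) (shift p) <-> sat rho p.
Proof. unfold shift. rewrite sat_fsubst. reflexivity. Qed.

Lemma sat_inst rho t p : sat rho (inst t p) <-> sat (scons (eval rho t) rho) p.
Proof.
  rewrite inst_scons, sat_fsubst. replace (fun n => _) with (scons (eval rho t) rho); [tauto|].
  extensionality n. now destruct n.
Qed.

Lemma eval_bound k rho sigma t :
  (forall n, n < k -> rho n = sigma n) -> tbound k t -> eval rho t = eval sigma t.
Proof.
  intros H. induction t as [n|f v IH] using term_nested_ind; intros Hb; [now apply H|].
  rewrite tbound_func in Hb. simpl. f_equal. apply vector_map_ext_Forall.
  eapply Forall_impl2; [|exact IH|exact Hb]. auto.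
Qed.

Lemma sat_bound p : forall k rho sigma,
  (forall n, n < k -> rho n = sigma n) -> fbound k p -> sat rho p <-> sat sigma p.
Proof.
  induction p as [|r v|a b|a IHa b IHb|a IHa b IHb|a IHa b IHb|a IHa|a IHa]; simpl;
    intros k rho sigma H Hb.
  - tauto.
  - erewrite vector_map_ext_Forall; [reflexivity|].
    eapply Vector.Forall_impl; [|exact Hb]. intros; now apply eval_bound with k.
  - destruct Hb as [H1 H2]. now rewrite (eval_bound _ _ a H H1), (eval_bound _ _ b H H2).
  - destruct Hb. rewrite (IHa k rho sigma), (IHb k rho sigma); tauto.
  - destruct Hb. rewrite (IHa k rho sigma), (IHb k rho sigma); tauto.
  - destruct Hb. rewrite (IHa k rho sigma), (IHb k rho sigma); tauto.
  - assert (E : forall d, sat (scons d rho) a <-> sat (scons d sigma) a).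
    { intros d. apply IHa with (S k); trivial. intros [|n] Hn; simpl; [trivial|apply H; lia]. }
    split; intros Hd d; apply E, Hd.
  - assert (E : forall d, sat (scons d rho) a <-> sat (scons d sigma) a).
    { intros d. apply IHa with (S k); trivial. intros [|n] Hn; simpl; [trivial|apply H; lia]. }
    split; intros [d Hd]; exists d; apply E, Hd.
Qed.

Lemma soundness G p : prv G p -> forall rho, (forall q, In q G -> sat rho q) -> sat rho p.
Proof.
  assert (Hsh : forall rho d (G : list (form L)), (forall q, In q G -> sat rho q) ->
            forall q, In q (map (@shift L) G) -> sat (scons d rho) q).
  { intros rho d G' H q Hq. apply in_map_iff in Hq as [q' [<- Hq']]. apply sat_shift. auto. }
  induction 1; intros rho HG; simpl in *.
  - auto.
  - intros Hp. apply IHprv. intros x [<-|Hx]; auto.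
  - apply IHprv1; auto.
  - split; auto.
  - now apply IHprv.
  - now apply IHprv.
  - auto.
  - auto.
  - destruct (IHprv1 rho HG) as [Hp|Hq].
    + apply IHprv2. intros x [<-|Hx]; auto.
    + apply IHprv3. intros x [<-|Hx]; auto.
  - intros d. apply IHprv. now apply Hsh.
  - apply sat_inst. now apply IHprv.
  - exists (eval rho t). apply sat_inst. auto.
  - destruct (IHprv1 rho HG) as [d Hd]. apply (sat_shift rho d). apply IHprv2.
    intros x [<-|Hx]; [trivial|]. now apply (Hsh rho d G HG).
  - now destruct (IHprv rho HG).
  - apply NNPP. intros Hp. apply (IHprv rho). intros x [<-|Hx]; auto.
  - reflexivity.
  - apply sat_inst. rewrite <- (IHprv1 rho HG). apply sat_inst. auto.
Qed.

Lemma tprv_sound (T : theory L) p rho :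
  tprv T p -> (forall q, T q -> sat rho q) -> sat rho p.
Proof. intros [G [HG Hp]] H. apply (soundness Hp). auto. Qed.

End Semantics.

(** Presenting a vector by a function makes every atom or function term a substitution instance of
    the generic one with arguments [var 0], ..., [var (k - 1)]. Congruence facts for vectors then
    follow from facts about substitution. *)
Fixpoint vmk (X : Type) (k : nat) (g : nat -> X) : Vector.t X k :=
  match k with
  | 0 => Vector.nil X
  | S k' => Vector.cons X (g 0) k' (vmk k' (fun n => g (S n)))
  end.

Fixpoint vget (X : Type) (d : X) k (w : Vector.t X k) : nat -> X :=
  match w with
  | Vector.nil _ => fun _ => d
  | Vector.cons _ a _ w' => scons a (vget d w')
  end.

Lemma vmk_vget (X : Type) (d : X) k (w : Vector.t X k) : vmk k (vget d w) = w.
Proof. induction w as [|a k w IH]; simpl; [reflexivity|]. f_equal. exact IH. Qed.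

Lemma map_vmk (X Y : Type) (h : X -> Y) k : forall g, Vector.map h (vmk k g) = vmk k (fun n => h (g n)).
Proof. induction k as [|k IH]; intros g; simpl; [reflexivity|]. now rewrite IH. Qed.

Lemma vmk_ext (X : Type) k : forall g h : nat -> X, (forall n, n < k -> g n = h n) -> vmk k g = vmk k h.
Proof.
  induction k as [|k IH]; intros g h H; simpl; [reflexivity|].
  rewrite (H 0) by lia. f_equal. apply IH. intros n Hn. apply H. lia.
Qed.

(** * Completeness *)

Section Completeness.
Variable L : lang.
Variable enumf : nat -> form L.
Hypothesis enumf_surj : forall p, exists n, enumf n = p.
Variable T : theory L.
Hypothesis T_sentences : axioms_are_sentences T.

Definition extend (G : list (form L)) : theory L := fun q => T q \/ In q G.

Lemma tprv_mono (T1 T2 : theory L) p :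
  (forall q, T1 q -> T2 q) -> tprv T1 p -> tprv T2 p.
Proof. intros H [G [HG Hp]]. exists G. split; auto. Qed.

Lemma extend_split p G D : (forall q, In q D -> extend (p :: G) q) ->
  exists D', (forall q, In q D' -> extend G q) /\ incl D (p :: D').
Proof.
  induction D as [|q D IH]; intros H.
  - exists []. split; [intros q []|intros q []].
  - destruct IH as [D' [H1 H2]]; [intros; apply H; now right|].
    destruct (H q (or_introl eq_refl)) as [HT|[<-|HG]].
    + exists (q :: D'). split.
      * intros x [<-|Hx]; [now left|auto].
      * intros x [<-|Hx]; simpl; [tauto|]. destruct (H2 x Hx); tauto.
    + exists D'. split; [trivial|]. intros x [<-|Hx]; simpl; [tauto|]. exact (H2 x Hx).
    + exists (q :: D'). split.
      * intros x [<-|Hx]; [now right|auto].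
      * intros x [<-|Hx]; simpl; [tauto|]. destruct (H2 x Hx); tauto.
Qed.

Lemma extend_deduction p q G : tprv (extend (p :: G)) q -> tprv (extend G) (imp p q).
Proof.
  intros [D [HD Hq]]. destruct (extend_split _ HD) as [D' [H1 H2]].
  exists D'. split; [trivial|]. apply ImpI. now apply prv_weaken with D.
Qed.

(** Free variables serve as Henkin constants, so the language never grows; this works because the
    axioms of [T] are sentences and [k] bounds the finitely many other formulas. A contradiction
    from the witness becomes, after renaming, the eigenvariable premise of [ExE]. *)
Lemma henkin_consistent a G k :
  (forall q, In q (ex a :: G) -> fbound k q) ->
  consistent (extend (ex a :: G)) -> consistent (extend (inst (var k) a :: ex a :: G)).
Proof.
  intros Hk Hc [D [HD Hf]]. destruct (extend_split _ HD) as [D' [H1 H2]].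
  apply Hc. exists (ex a :: D'). split.
  { intros q [<-|Hq]; [right; now left|auto]. }
  apply prv_weaken with (G' := inst (var k) a :: D') in Hf; [|exact H2].
  (* On formulas that do not mention [k] this renaming is [shift], and it turns [inst (var k) a]
     back into [a] with [var 0] as the eigenvariable. *)
  set (s := fun n => if n =? k then @var L 0 else var (S n)).
  apply prv_subst with (s := s) in Hf. simpl in Hf.
  replace (fsubst s (inst (var k) a)) with a in Hf.
  - replace (map (fsubst s) D') with (map (@shift L) D') in Hf.
    + apply ExE with a; [apply Ctx; now left|].
      apply prv_weaken with (a :: map (@shift L) D'); [exact Hf|].
      intros x [<-|Hx]; simpl; auto.
    + apply map_ext_in. intros q Hq.
      assert (Hb : fbound k q).
      { destruct (H1 q Hq) as [HT|HG].
        - apply fbound_mono with 0; [lia|]. now apply T_sentences.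
        - auto. }
      apply fsubst_bound with k; [|trivial].
      intros n Hn. unfold s. destruct (Nat.eqb_spec n k); [lia|reflexivity].
  - rewrite inst_scons, fsubst_fsubst. rewrite <- (fsubst_var a) at 1.
    apply fsubst_bound with (S k).
    + intros [|n] Hn; simpl; unfold s.
      * now rewrite Nat.eqb_refl.
      * destruct (Nat.eqb_spec n k); [lia|reflexivity].
    + apply (Hk (ex a)). now left.
Qed.

Lemma list_bound (G : list (form L)) : exists k, forall q, In q G -> fbound k q.
Proof.
  induction G as [|p G [k Hk]]; [now exists 0|].
  destruct (fbound_exists p) as [k' Hk']. exists (k + k'). intros q [<-|Hq].
  - apply fbound_mono with k'; [lia|trivial].
  - apply fbound_mono with k; [lia|auto].
Qed.

Definition fresh (G : list (form L)) : nat :=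
  epsilon (inhabits 0) (fun k => forall q, In q G -> fbound k q).

(** The witness enters at the same stage as its existential formula, so a single pass through the
    enumeration suffices. *)
Definition add_witness (p : form L) (G : list (form L)) : list (form L) :=
  match p with
  | ex a => inst (var (fresh (p :: G))) a :: p :: G
  | _ => p :: G
  end.

Variable G0 : list (form L).
Hypothesis G0_consistent : consistent (extend G0).

Fixpoint stage (n : nat) : list (form L) :=
  match n with
  | 0 => G0
  | S m => if excluded_middle_informative (consistent (extend (enumf m :: stage m)))
           then add_witness (enumf m) (stage m) else stage m
  end.

Lemma add_witness_incl p G : incl (p :: G) (add_witness p G).
Proof. destruct p; simpl; intros x; simpl; tauto. Qed.

Lemma stage_consistent n : consistent (extend (stage n)).
Proof.
  induction n as [|n IH]; simpl; [trivial|].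
  destruct (excluded_middle_informative _) as [H|H]; [|trivial].
  destruct (enumf n) as [| | | | | | |a]; simpl; trivial.
  apply henkin_consistent; [|trivial].
  apply (epsilon_spec (inhabits 0) (fun k => forall q, In q (ex a :: stage n) -> fbound k q)).
  apply list_bound.
Qed.

Lemma stage_mono n m : n <= m -> incl (stage n) (stage m).
Proof.
  induction 1 as [|m H IH]; [apply incl_refl|].
  apply incl_tran with (stage m); [trivial|]. simpl.
  destruct (excluded_middle_informative _); [|apply incl_refl].
  intros x Hx. apply add_witness_incl. now right.
Qed.

Definition completion : theory L := fun q => T q \/ exists n, In q (stage n).

Lemma completion_stage D : (forall q, In q D -> completion q) -> exists n, forall q, In q D -> extend (stage n) q.
Proof.
  induction D as [|p D IH]; intros H; [now exists 0|].
  destruct IH as [n Hn]; [intros; apply H; now right|].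
  destruct (H p (or_introl eq_refl)) as [HT|[m Hm]].
  - exists n. intros q [<-|Hq]; [now left|auto].
  - exists (n + m). intros q [<-|Hq].
    + right. apply (@stage_mono m (n + m)); [lia|trivial].
    + destruct (Hn q Hq) as [?|Hs]; [now left|right]. apply (@stage_mono n (n + m)); [lia|trivial].
Qed.

Lemma completion_consistent : consistent completion.
Proof.
  intros [D [HD Hf]]. destruct (completion_stage _ HD) as [n Hn].
  apply (@stage_consistent n). now exists D.
Qed.

Lemma stage_completion n p : tprv (extend (stage n)) p -> tprv completion p.
Proof. apply tprv_mono. intros q [H|H]; [now left|right; now exists n]. Qed.

Lemma completion_decide p : completion p \/ tprv completion (neg p).
Proof.
  destruct (enumf_surj p) as [n <-].
  destruct (classic (consistent (extend (enumf n :: stage n)))) as [H|H].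
  - left. right. exists (S n). simpl. destruct (excluded_middle_informative _); [|contradiction].
    apply add_witness_incl. now left.
  - right. apply NNPP in H. apply extend_deduction in H. now apply stage_completion in H.
Qed.

Lemma tprv_mp (S : theory L) p q : tprv S (imp p q) -> tprv S p -> tprv S q.
Proof.
  intros [D1 [H1 P1]] [D2 [H2 P2]]. exists (D1 ++ D2). split.
  - intros x Hx. apply in_app_iff in Hx as [Hx|Hx]; auto.
  - apply ImpE with p.
    + apply prv_weaken with D1; [trivial|]. apply incl_appl, incl_refl.
    + apply prv_weaken with D2; [trivial|]. apply incl_appr, incl_refl.
Qed.

Lemma completion_closed p : tprv completion p -> completion p.
Proof.
  intros H. destruct (completion_decide p) as [|Hn]; [trivial|].
  destruct completion_consistent. exact (tprv_mp Hn H).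
Qed.

Lemma completion_prv G p : (forall q, In q G -> completion q) -> prv G p -> completion p.
Proof. intros H Hp. apply completion_closed. now exists G. Qed.

Lemma completion_neg p : completion (neg p) <-> ~ completion p.
Proof.
  split.
  - intros H1 H2. apply completion_consistent. exists [neg p; p]. split.
    + intros q [<-|[<-|[]]]; trivial.
    + apply ImpE with p; apply Ctx; simpl; auto.
  - intros H. destruct (completion_decide p) as [|Hn]; [contradiction|]. now apply completion_closed.
Qed.

Lemma completion_witness a : completion (ex a) -> exists k, completion (inst (var k) a).
Proof.
  intros H. destruct (enumf_surj (ex a)) as [n Hn].
  assert (Hc : consistent (extend (ex a :: stage n))).
  { intros [D [HD Hf]]. apply completion_consistent. exists D. split; [|trivial].
    intros q Hq. destruct (HD q Hq) as [?|[<-|?]]; [now left|trivial|right; now exists n]. }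
  exists (fresh (ex a :: stage n)). right. exists (S n). simpl. rewrite Hn.
  destruct (excluded_middle_informative _); [now left|contradiction].
Qed.

Lemma completion_leib p s t : completion (equ s t) -> completion (inst s p) -> completion (inst t p).
Proof.
  intros H1 H2. apply completion_prv with [equ s t; inst s p].
  - intros q [<-|[<-|[]]]; trivial.
  - apply EqLeib with s; apply Ctx; simpl; auto.
Qed.

Lemma completion_refl t : completion (equ t t).
Proof. apply completion_prv with []; [intros q []|]. apply EqRefl. Qed.

(** The template for [EqLeib]: an equation whose left side is the slot [var 0], with [u] shifted out
    of its way. It yields symmetry and transitivity. *)
Lemma inst_equ_shift_r t s u :
  inst t (equ (var 0) (tsubst (fun k => var (S k)) u)) = @equ L t u /\
  inst s (equ (var 0) (tsubst (fun k => var (S k)) u)) = @equ L s u.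
Proof.
  unfold inst. simpl. rewrite !tsubst_tsubst. simpl.
  split; f_equal; apply tsubst_var.
Qed.

Lemma completion_sym s t : completion (equ s t) -> completion (equ t s).
Proof.
  intros H. destruct (inst_equ_shift_r t s s) as [<- E]. apply completion_leib with s; [trivial|].
  rewrite E. apply completion_refl.
Qed.

Lemma completion_trans s t u : completion (equ s t) -> completion (equ t u) -> completion (equ s u).
Proof.
  intros H1 H2. destruct (inst_equ_shift_r s t u) as [<- E].
  apply completion_leib with t; [now apply completion_sym|]. now rewrite E.
Qed.

(** [EqLeib] rewrites one slot at a time, so the two substitutions are interchanged variable by
    variable up to a bound on the free variables of [p]. In the template [q] the variable [j] is the
    slot and all other substituted terms are shifted past it. *)
Lemma completion_fsubst_equ p s t :
  (forall n, completion (equ (s n) (t n))) -> completion (fsubst s p) -> completion (fsubst t p).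
Proof.
  intros H Hs. destruct (fbound_exists p) as [k Hk].
  assert (HH : forall j, completion (fsubst (fun n => if n <? j then t n else s n) p)).
  { induction j as [|j IH]; [exact Hs|].
    set (q := fsubst (fun n => if n =? j then var 0 else
       tsubst (fun m => var (S m)) (if n <? j then t n else s n)) p).
    assert (E : forall u, inst u q = fsubst (fun n => if n =? j then u
                             else if n <? j then t n else s n) p).
    { intros u. unfold q, inst. rewrite fsubst_fsubst. f_equal. extensionality n.
      destruct (Nat.eqb_spec n j); simpl; [trivial|].
      rewrite tsubst_tsubst. simpl. now rewrite tsubst_var. }
    replace (fun n => if n <? S j then t n else s n) with
      (fun n => if n =? j then t j else if n <? j then t n else s n).
    - rewrite <- E. apply completion_leib with (s j); [trivial|]. rewrite E.
      replace (fun n => _) with (fun n => if n <? j then t n else s n); [trivial|].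
      extensionality n. destruct (Nat.eqb_spec n j); [|trivial].
      subst. now rewrite Nat.ltb_irrefl.
    - extensionality n. destruct (Nat.eqb_spec n j), (Nat.ltb_spec n j), (Nat.ltb_spec n (S j));
        subst; trivial; lia. }
  specialize (HH k). erewrite fsubst_bound; [exact HH| |exact Hk].
  intros n Hn. simpl. now apply Nat.ltb_lt in Hn as ->.
Qed.

(** [sat] reads [equ] as equality of the carrier, so provably equal terms must be identified. A
    chosen representative of each class, with the fixed points of [rep] as carrier, replaces a
    quotient. *)
Definition rep (t : term L) : term L := epsilon (inhabits t) (fun u => completion (equ t u)).

Lemma rep_spec t : completion (equ t (rep t)).
Proof.
  unfold rep. apply (epsilon_spec (inhabits t) (fun u => completion (equ t u))).
  exists t. apply completion_refl.
Qed.

Lemma rep_eq s t : completion (equ s t) -> rep s = rep t.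
Proof.
  intros H. unfold rep. replace (fun u => completion (equ s u)) with (fun u => completion (equ t u)).
  - rewrite (proof_irrelevance _ (inhabits s) (inhabits t)). reflexivity.
  - extensionality u. apply propositional_extensionality. split; intros H'.
    + now apply completion_trans with t.
    + apply completion_trans with s; [now apply completion_sym|trivial].
Qed.

Lemma rep_idem t : rep (rep t) = rep t.
Proof. symmetry. apply rep_eq, rep_spec. Qed.

Definition mk_rep (t : term L) : {t | rep t = t} := exist _ (rep t) (rep_idem t).

Definition term_model : structure L :=
  {| carrier := {t | rep t = t};
     fint := fun f v => mk_rep (func f (Vector.map (@proj1_sig _ _) v));
     rint := fun r v => completion (atom r (Vector.map (@proj1_sig _ _) v)) |}.

Lemma carrier_eq (x y : term_model) : proj1_sig x = proj1_sig y -> x = y.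
Proof.
  destruct x as [x Hx], y as [y Hy]. simpl. intros ->. f_equal. apply proof_irrelevance.
Qed.

Lemma completion_atom_equ r (w1 w2 : Vector.t (term L) (ar_r L r)) :
  (forall n, completion (equ (vget (var 0) w1 n) (vget (var 0) w2 n))) ->
  completion (atom r w1) -> completion (atom r w2).
Proof.
  intros H. rewrite <- (vmk_vget (var 0) w1), <- (vmk_vget (var 0) w2).
  pose proof (@completion_fsubst_equ (atom r (vmk _ (@var L))) _ _ H) as H'. simpl in H'.
  now rewrite !map_vmk in H'.
Qed.

(** The generic equation between two copies of [f] on disjoint blocks of variables is instantiated
    twice. With [w1] in both blocks it is reflexivity; changing only the second block to [w2] gives
    the claim. *)
Lemma completion_func_equ f (w1 w2 : Vector.t (term L) (ar_f L f)) :
  (forall n, completion (equ (vget (var 0) w1 n) (vget (var 0) w2 n))) ->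
  completion (equ (func f w1) (func f w2)).
Proof.
  intros H. rewrite <- (vmk_vget (var 0) w1), <- (vmk_vget (var 0) w2).
  set (k := ar_f L f) in *. set (g1 := vget (var 0) w1) in *. set (g2 := vget (var 0) w2) in *.
  pose proof (@completion_fsubst_equ
    (equ (func f (vmk k (@var L))) (func f (vmk k (fun i => var (i + k)))))
    (fun n => if n <? k then g1 n else g1 (n - k))
    (fun n => if n <? k then g1 n else g2 (n - k))) as H'.
  simpl in H'. fold k in H'. rewrite !map_vmk in H'. simpl in H'.
  assert (E1 : forall h, vmk k (fun n => if n <? k then g1 n else h (n - k)) = vmk k g1).
  { intros h. apply vmk_ext. intros n Hn. now apply Nat.ltb_lt in Hn as ->. }
  assert (E2 : forall h, vmk k (fun n => if n + k <? k then g1 (n + k) else h (n + k - k)) = vmk k h).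
  { intros h. apply vmk_ext. intros n Hn. destruct (Nat.ltb_spec (n + k) k); [lia|].
    f_equal. lia. }
  rewrite !E1, !E2 in H'. apply H'; [|apply completion_refl].
  intros n. destruct (n <? k); [apply completion_refl|apply H].
Qed.

Lemma eval_term_model (rho : nat -> term_model) t :
  proj1_sig (eval term_model rho t) = rep (tsubst (fun n => proj1_sig (rho n)) t).
Proof.
  induction t as [n|f v IH] using term_nested_ind; simpl.
  - symmetry. apply (proj2_sig (rho n)).
  - apply rep_eq. rewrite Vector.map_map. apply completion_func_equ.
    rewrite (vector_map_ext_Forall _ _ IH). intros n. apply completion_sym.
    generalize (ar_f L f), v. intros k w. revert n.
    induction w as [|a k w IHw]; intros [|n]; simpl; auto using completion_refl.
    apply rep_spec.
Qed.

(** The construction provides witnesses for existential formulas only; this brings the universal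
    case of the truth lemma to them. *)
Lemma not_all_ex_neg a : completion (neg (all a)) -> completion (ex (neg a)).
Proof.
  intros H. apply completion_prv with [neg (all a)]; [intros q [<-|[]]; trivial|].
  apply RAA. apply ImpE with (all a); [apply Ctx; simpl; auto|].
  apply AllI. apply RAA. simpl.
  apply ImpE with (ex (neg (fsubst (up (fun k => var (S k))) a))); [apply Ctx; simpl; auto|].
  apply ExI with (var 0).
  change (inst (var 0) (neg (fsubst (up (fun k => var (S k))) a))) with
    (neg (inst (var 0) (fsubst (up (fun k => @var L (S k))) a))).
  rewrite inst_fsubst_up. replace (scons _ _) with (@var L).
  - rewrite fsubst_var. apply Ctx; simpl; auto.
  - extensionality n. now destruct n.
Qed.

Lemma scons_proj (rho : nat -> term_model) (d : term_model) :
  (fun n => proj1_sig (scons d rho n)) = scons (proj1_sig d) (fun n => proj1_sig (rho n)).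
Proof. extensionality n. now destruct n. Qed.

Lemma truth_lemma p : forall rho : nat -> term_model,
  sat term_model rho p <-> completion (fsubst (fun n => proj1_sig (rho n)) p).
Proof.
  induction p as [|r v|a b|a IHa b IHb|a IHa b IHb|a IHa b IHb|a IHa|a IHa]; intros rho; simpl.
  - split; [tauto|]. intros H. apply completion_consistent. exists [fal]. split.
    + intros q [<-|[]]; trivial.
    + apply Ctx; now left.
  - rewrite Vector.map_map.
    erewrite Vector.map_ext by (intros; apply eval_term_model).
    split; apply completion_atom_equ; intros n; [apply completion_sym|]; revert n;
      induction v as [|x k v IHv]; intros [|n]; simpl; auto using completion_refl, rep_spec.
  - split.
    + intros H. apply (f_equal (@proj1_sig _ _)) in H. rewrite !eval_term_model in H.
      eapply completion_trans; [apply rep_spec|]. rewrite H. apply completion_sym, rep_spec.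
    + intros H. apply carrier_eq. rewrite !eval_term_model. now apply rep_eq.
  - rewrite IHa, IHb. split.
    + intros H. destruct (classic (completion (fsubst (fun n => proj1_sig (rho n)) a))) as [Ha|Ha].
      * apply completion_prv with [fsubst (fun n => proj1_sig (rho n)) b];
          [intros q [<-|[]]; auto|]. apply ImpI, Ctx; simpl; auto.
      * apply completion_neg in Ha. apply completion_prv with [neg (fsubst (fun n => proj1_sig (rho n)) a)];
          [intros q [<-|[]]; auto|]. apply ImpI, Explosion.
        eapply ImpE; apply Ctx; simpl; [right; left; reflexivity|now left].
    + intros H1 H2. eapply completion_prv with [imp _ _; _]; [intros q [<-|[<-|[]]]; [exact H1|exact H2]|].
      eapply ImpE; apply Ctx; simpl; [left; reflexivity|auto].
  - rewrite IHa, IHb. split.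
    + intros [H1 H2]. eapply completion_prv with [_; _]; [intros q [<-|[<-|[]]]; [exact H1|exact H2]|].
      apply AndI; apply Ctx; simpl; auto.
    + intros H. split; (eapply completion_prv with [_]; [intros q [<-|[]]; eassumption|]).
      * eapply AndE1, Ctx; simpl; auto.
      * eapply AndE2, Ctx; simpl; auto.
  - rewrite IHa, IHb. split.
    + intros [H|H]; (eapply completion_prv with [_]; [intros q [<-|[]]; eassumption|]).
      * apply OrI1, Ctx; simpl; auto.
      * apply OrI2, Ctx; simpl; auto.
    + intros H. apply NNPP. intros Hn. apply not_or_and in Hn as [Ha Hb].
      apply completion_neg in Ha, Hb. apply completion_consistent.
      eexists [disj _ _; neg _; neg _]. split.
      * intros q [<-|[<-|[<-|[]]]]; [exact H|exact Ha|exact Hb].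
      * eapply OrE; [apply Ctx; now left| |]; (eapply ImpE; [|apply Ctx; now left]);
          apply Ctx; simpl; auto.
  - split.
    + intros H. apply NNPP. intros Hn. apply completion_neg, not_all_ex_neg, completion_witness in Hn as [k Hk].
      change (completion (neg (inst (var k) (fsubst (up (fun n => proj1_sig (rho n))) a)))) in Hk.
      apply completion_neg in Hk. apply Hk. apply completion_leib with (rep (var k)).
      * apply completion_sym, rep_spec.
      * specialize (H (mk_rep (var k))). apply IHa in H. rewrite scons_proj in H.
        now rewrite inst_fsubst_up.
    + intros H d. apply IHa. rewrite scons_proj, <- inst_fsubst_up.
      eapply completion_prv with [_]; [intros q [<-|[]]; eassumption|].
      apply AllE, Ctx; now left.
  - split.
    + intros [d H]. apply IHa in H. rewrite scons_proj, <- inst_fsubst_up in H.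
      eapply completion_prv with [_]; [intros q [<-|[]]; eassumption|].
      eapply ExI, Ctx; now left.
    + intros H. apply completion_witness in H as [k Hk]. exists (mk_rep (var k)). apply IHa.
      rewrite scons_proj, <- inst_fsubst_up. apply completion_leib with (var k); [|trivial].
      apply rep_spec.
Qed.

Lemma term_model_sat q : completion q -> sat term_model (fun n => mk_rep (var n)) q.
Proof.
  intros H. apply truth_lemma. apply completion_fsubst_equ with (s := @var L).
  - intros n. apply rep_spec.
  - now rewrite fsubst_var.
Qed.

End Completeness.

Theorem completeness (L : lang) (enumf : nat -> form L) (T : theory L) (p : form L) :
  (forall q, exists n, enumf n = q) -> axioms_are_sentences T ->
  (forall (M : structure L) (rho : nat -> M),
     (forall q, T q -> sat M rho q) -> sat M rho p) ->
  tprv T p.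
Proof.
  intros He HT H. apply NNPP. intros Hn.
  assert (Hc : consistent (extend T [neg p])).
  { intros Hf. apply Hn. apply extend_deduction in Hf. destruct Hf as [G [HG Hf]].
    exists G. split.
    - intros q Hq. destruct (HG q Hq) as [|[]]; trivial.
    - apply RAA. apply ImpE with (neg p); [|apply Ctx; now left].
      apply prv_weaken with G; [trivial|]. intros x Hx; now right. }
  pose proof (term_model_sat He HT Hc) as HM.
  apply (HM (neg p)).
  - right. exists 0. now left.
  - apply H. intros q Hq. apply HM. now left.
Qed.

(** * The pairing function and Goedel's beta function *)

Lemma cpair_double x y : 2 * cpair x y = (x + y) * (x + y + 1) + 2 * y.
Proof.
  unfold cpair.
  assert (H : 2 * ((x + y) * (x + y + 1) / 2) = (x + y) * (x + y + 1)).
  { assert (E : ((x + y) * (x + y + 1)) mod 2 = 0).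
    { generalize (x + y). intros n. apply Nat.Div0.mod_divides.
      induction n as [|n [k Hk]]; [now exists 0|]. exists (k + n + 1). nia. }
    pose proof (Nat.div_mod_eq ((x + y) * (x + y + 1)) 2). lia. }
  lia.
Qed.

(** The pairs with [x + y = s] have codes from s(s+1)/2 to s(s+1)/2 + s. These intervals are
    disjoint for different [s], so a code determines first the sum and then [y]. *)
Lemma cpair_inj x y x' y' : cpair x y = cpair x' y' -> x = x' /\ y = y'.
Proof.
  intros H. pose proof (cpair_double x y). pose proof (cpair_double x' y').
  assert (x + y = x' + y').
  { destruct (Nat.lt_trichotomy (x + y) (x' + y')) as [Hl|[He|Hl]]; [exfalso|trivial|exfalso].
    - assert ((x + y + 1) * (x + y + 2) <= (x' + y') * (x' + y' + 1)) by (apply Nat.mul_le_mono; lia).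
      nia.
    - assert ((x' + y' + 1) * (x' + y' + 2) <= (x + y) * (x + y + 1)) by (apply Nat.mul_le_mono; lia).
      nia. }
  assert (y = y') by (rewrite H, H2 in *; lia). lia.
Qed.

Lemma gcd_1_divide a b : (forall d, Nat.divide d a -> Nat.divide d b -> d = 1) -> Nat.gcd a b = 1.
Proof. intros H. apply H; [apply Nat.gcd_divide_l|apply Nat.gcd_divide_r]. Qed.

Lemma divide_gcd_1 a b d : Nat.gcd a b = 1 -> Nat.divide d a -> Nat.divide d b -> d = 1.
Proof. intros H Ha Hb. apply Nat.divide_1_r. rewrite <- H. now apply Nat.gcd_greatest. Qed.

Lemma coprime_mul a b c : Nat.gcd a c = 1 -> Nat.gcd b c = 1 -> Nat.gcd (a * b) c = 1.
Proof.
  intros Ha Hb. apply gcd_1_divide. intros d H1 H2.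
  apply divide_gcd_1 with b c; trivial. apply Nat.gauss with a; trivial.
  apply gcd_1_divide. intros x Hx1 Hx2. apply divide_gcd_1 with a c; trivial.
  now apply Nat.divide_trans with d.
Qed.

Lemma chinese_remainder (m f : nat -> nat) n :
  (forall i, f i < m i) ->
  (forall i j, i < j -> j < n -> Nat.gcd (m i) (m j) = 1) ->
  exists a, forall i, i < n -> a mod m i = f i.
Proof.
  intros Hf. induction n as [|n IH]; intros Hc; [exists 0; lia|].
  destruct IH as [a Ha]; [intros; apply Hc; lia|].
  assert (HP : exists P, 0 < P /\ (forall i, i < n -> Nat.divide (m i) P) /\ Nat.gcd P (m n) = 1).
  { assert (H : forall k, k <= n -> exists P, 0 < P /\ (forall i, i < k -> Nat.divide (m i) P) /\
                                       Nat.gcd P (m n) = 1).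
    { induction k as [|k IHk]; intros Hk.
      - exists 1. split; [lia|]. split; [lia|reflexivity].
      - destruct IHk as [P [H0 [H1 H2]]]; [lia|]. exists (P * m k). split; [|split].
        + specialize (Hf k). nia.
        + intros i Hi. destruct (Nat.eq_dec i k) as [->|].
          * apply Nat.divide_factor_r.
          * apply Nat.divide_mul_l. apply H1. lia.
        + apply coprime_mul; [trivial|]. apply Hc; lia. }
    now apply H. }
  destruct HP as [P [H0 [H1 H2]]].
  destruct (Nat.gcd_bezout_pos P (m n) H0) as [u [v Huv]]. rewrite H2 in Huv.
  (* Modulo [m n], the summand [(m n - 1) * a] stands for [- a], so [a + c] is congruent to [f n];
     and [u * P] is congruent to 1, so adding [u * c * P] has the effect of adding [c]. Modulo the
     earlier moduli, which divide [P], nothing changes. *)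
  set (c := f n + (m n - 1) * a).
  exists (a + u * c * P). intros i Hi.
  destruct (Nat.eq_dec i n) as [->|Hin].
  - replace (a + u * c * P) with (f n + (a + v * c) * m n).
    + rewrite Nat.Div0.mod_add. now apply Nat.mod_small.
    + replace (u * c * P) with (u * P * c) by ring. rewrite Huv. unfold c.
      specialize (Hf n). destruct (m n) as [|k]; [lia|].
      replace (S k - 1) with k by lia. ring.
  - destruct (H1 i) as [q Hq]; [lia|]. subst P.
    replace (a + u * c * (q * m i)) with (a + (u * c * q) * m i) by ring.
    rewrite Nat.Div0.mod_add. apply Ha. lia.
Qed.

Definition beta (a b i : nat) : nat := a mod S (S i * b).

Lemma divide_fact k n : 0 < k -> k <= n -> Nat.divide k (fact n).
Proof.
  intros Hk. induction 1 as [|n H IH].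
  - destruct k as [|k]; [lia|]. exists (fact k). simpl. ring.
  - apply Nat.divide_trans with (fact n); [trivial|]. exists (S n). simpl. ring.
Qed.

Lemma le_fact n : n <= fact n.
Proof.
  induction n as [|n IH]; [simpl; lia|].
  change (fact (S n)) with (S n * fact n). pose proof (lt_O_fact n). nia.
Qed.

(** With [b] the factorial of a number [N] that bounds [n] and all values, the moduli are pairwise
    coprime. A common divisor of two of them divides [b * (j - i)] and is coprime to [b], so it
    divides [j - i], which itself divides [b]; hence it is 1. *)
Lemma beta_exists (f : nat -> nat) n : exists a b, forall i, i < n -> beta a b i = f i.
Proof.
  assert (HN : exists N, n <= N /\ forall i, i < n -> f i <= N).
  { induction n as [|n [N [H1 H2]]]; [exists 0; split; lia|].
    exists (S N + f n). split; [lia|]. intros i Hi.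
    destruct (Nat.eq_dec i n) as [->|]; [lia|]. specialize (H2 i). lia. }
  destruct HN as [N [HnN HfN]].
  pose (b := fact N). assert (Hb : N <= b) by apply le_fact.
  (* [chinese_remainder] wants residues below the moduli at every index, hence the value 0 from [n]
     on. *)
  destruct (@chinese_remainder (fun i => S (S i * b)) (fun i => if i <? n then f i else 0) n) as [a Ha].
  - intros i. destruct (Nat.ltb_spec i n) as [Hi|]; [|lia]. specialize (HfN i Hi). nia.
  - intros i j Hij Hj. apply gcd_1_divide. intros d H1 H2.
    assert (Hdb : Nat.gcd d b = 1).
    { apply gcd_1_divide. intros x Hx1 Hx2. apply Nat.divide_1_r.
      replace 1 with (S (S i * b) - S i * b) by lia. apply Nat.divide_sub_r.
      - now apply Nat.divide_trans with d.
      - now apply Nat.divide_mul_r. }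
    assert (Hd : Nat.divide d (b * (j - i))).
    { replace (b * (j - i)) with (S (S j * b) - S (S i * b)) by nia.
      now apply Nat.divide_sub_r. }
    apply Nat.gauss in Hd; [|trivial].
    apply divide_gcd_1 with d b; [trivial|apply Nat.divide_refl|].
    apply Nat.divide_trans with (j - i); [trivial|]. apply divide_fact; lia.
  - exists a, b. intros i Hi. specialize (Ha i Hi). simpl in Ha.
    apply Nat.ltb_lt in Hi. rewrite Hi in Ha. exact Ha.
Qed.

(** * Sigma_1 predicates *)

Notation env := (nat -> nat).

Inductive pt : Type :=
| pv : nat -> pt
| pz : pt
| ps : pt -> pt
| pa : pt -> pt -> pt
| pm : pt -> pt -> pt.

(* [dall t a] is the bounded quantifier [forall x <= t, a]. *)
Inductive d0 : Type :=
| deq : pt -> pt -> d0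
| dfal : d0
| dimp : d0 -> d0 -> d0
| dall : pt -> d0 -> d0.

Fixpoint ptv (e : env) (t : pt) : nat :=
  match t with
  | pv n => e n
  | pz => 0
  | ps s => S (ptv e s)
  | pa s u => ptv e s + ptv e u
  | pm s u => ptv e s * ptv e u
  end.

Fixpoint holds (e : env) (d : d0) : Prop :=
  match d with
  | deq s t => ptv e s = ptv e t
  | dfal => False
  | dimp a b => holds e a -> holds e b
  | dall t a => forall x, x <= ptv e t -> holds (scons x e) a
  end.

Fixpoint ptren (f : nat -> nat) (t : pt) : pt :=
  match t with
  | pv n => pv (f n)
  | pz => pz
  | ps s => ps (ptren f s)
  | pa s u => pa (ptren f s) (ptren f u)
  | pm s u => pm (ptren f s) (ptren f u)
  end.

Fixpoint dren (f : nat -> nat) (d : d0) : d0 :=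
  match d with
  | deq s t => deq (ptren f s) (ptren f t)
  | dfal => dfal
  | dimp a b => dimp (dren f a) (dren f b)
  | dall t a => dall (ptren f t) (dren (scons 0 (fun n => S (f n))) a)
  end.

Lemma ptv_ren f t e : ptv e (ptren f t) = ptv (fun n => e (f n)) t.
Proof. induction t; simpl; congruence. Qed.

Lemma holds_ren d : forall f e, holds e (dren f d) <-> holds (fun n => e (f n)) d.
Proof.
  induction d as [s t| |a IHa b IHb|t a IHa]; intros f e; simpl.
  - now rewrite !ptv_ren.
  - tauto.
  - now rewrite IHa, IHb.
  - rewrite ptv_ren.
    assert (E : forall x, (fun n => scons x e (scons 0 (fun n => S (f n)) n)) =
                     scons x (fun n => e (f n))).
    { intros x. extensionality n. now destruct n. }
    split; intros H x Hx; specialize (H x Hx); rewrite IHa, E in *; trivial.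
Qed.

(** Definability is a property of functions and predicates on environments, so that complex
    definitions are assembled by closure lemmas and no formula is written out. The scope of a
    quantifier is a [P : nat -> env -> Prop]; its definability is that of
    [fun e => P (e 0) (fun n => e (S n))], with the bound variable at index 0. *)
Definition Pol (f : env -> nat) : Prop := exists t, forall e, f e = ptv e t.
Definition Del (P : env -> Prop) : Prop := exists d, forall e, P e <-> holds e d.

Lemma Pol_var n : Pol (fun e => e n).
Proof. now exists (pv n). Qed.
Lemma Pol_S f : Pol f -> Pol (fun e => S (f e)).
Proof. intros [t H]. exists (ps t). intros; simpl; congruence. Qed.
Lemma Pol_const c : Pol (fun _ => c).
Proof. induction c; [now exists pz|]. now apply (@Pol_S (fun _ => c)). Qed.
Lemma Pol_add f g : Pol f -> Pol g -> Pol (fun e => f e + g e).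
Proof. intros [t H] [u H']. exists (pa t u). intros; simpl; congruence. Qed.
Lemma Pol_mul f g : Pol f -> Pol g -> Pol (fun e => f e * g e).
Proof. intros [t H] [u H']. exists (pm t u). intros; simpl; congruence. Qed.

Lemma Del_iff P Q : (forall e, P e <-> Q e) -> Del P -> Del Q.
Proof. intros H [d Hd]. exists d. intros e. now rewrite <- H. Qed.
Lemma Del_eq f g : Pol f -> Pol g -> Del (fun e => f e = g e).
Proof. intros [t H] [u H']. exists (deq t u). intros; simpl. now rewrite H, H'. Qed.
Lemma Del_False : Del (fun _ => False).
Proof. exists dfal. simpl. tauto. Qed.
Lemma Del_imp P Q : Del P -> Del Q -> Del (fun e => P e -> Q e).
Proof. intros [d H] [d' H']. exists (dimp d d'). intros; simpl. now rewrite H, H'. Qed.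
Lemma Del_not P : Del P -> Del (fun e => ~ P e).
Proof. intros H. exact (Del_imp H Del_False). Qed.
Lemma Del_or P Q : Del P -> Del Q -> Del (fun e => P e \/ Q e).
Proof.
  intros H H'. apply Del_iff with (fun e => ~ P e -> Q e); [intros; tauto|].
  apply Del_imp; [now apply Del_not|trivial].
Qed.
Lemma Del_and P Q : Del P -> Del Q -> Del (fun e => P e /\ Q e).
Proof.
  intros H H'. apply Del_iff with (fun e => ~ (P e -> ~ Q e)); [intros; tauto|].
  apply Del_not, Del_imp; [trivial|now apply Del_not].
Qed.
Lemma Del_ball f (P : nat -> env -> Prop) : Pol f ->
  Del (fun e => P (e 0) (fun n => e (S n))) -> Del (fun e => forall x, x <= f e -> P x e).
Proof.
  intros [t H] [d Hd]. exists (dall t d). intros e. simpl. rewrite <- H.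
  split; intros HH x Hx; specialize (HH x Hx).
  - rewrite <- Hd. exact HH.
  - rewrite <- Hd in HH. exact HH.
Qed.
Lemma Del_bex f (P : nat -> env -> Prop) : Pol f ->
  Del (fun e => P (e 0) (fun n => e (S n))) -> Del (fun e => exists x, x <= f e /\ P x e).
Proof.
  intros Hf HP. apply Del_iff with (fun e => ~ forall x, x <= f e -> ~ P x e).
  - intros e. split.
    + intros H. apply NNPP. intros Hn. apply H. intros x Hx Hp. apply Hn. now exists x.
    + intros [x [Hx Hp]] H. now apply (H x).
  - apply Del_not, Del_ball; [trivial|]. now apply Del_not.
Qed.
Lemma Del_ren r P : Del P -> Del (fun e => P (fun n => e (r n))).
Proof. intros [d Hd]. exists (dren r d). intros e. now rewrite Hd, holds_ren. Qed.

Definition Sig (P : env -> Prop) : Prop :=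
  exists Q : nat -> env -> Prop,
    Del (fun e => Q (e 0) (fun n => e (S n))) /\ forall e, P e <-> exists w, Q w e.

Lemma Sig_iff P Q : (forall e, P e <-> Q e) -> Sig P -> Sig Q.
Proof. intros H [R [HR HP]]. exists R. split; [trivial|]. intros e. now rewrite <- H. Qed.

Lemma Del_Sig P : Del P -> Sig P.
Proof.
  intros H. exists (fun _ e => P e). split; [now apply (@Del_ren S P)|].
  intros e. split; [intros; now exists 0|now intros [_ ?]].
Qed.

Lemma Sig_ren r P : Sig P -> Sig (fun e => P (fun n => e (r n))).
Proof.
  intros [Q [HQ HP]]. exists (fun w e => Q w (fun n => e (r n))). split.
  - exact (@Del_ren (scons 0 (fun n => S (r n))) _ HQ).
  - intros e. apply HP.
Qed.

(** Two unbounded existential quantifiers contract into one: a single [z] bounds both witnesses,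
    which are then found by bounded quantifiers. *)
Lemma Sig_ex (P : nat -> env -> Prop) :
  Sig (fun e => P (e 0) (fun n => e (S n))) -> Sig (fun e => exists x, P x e).
Proof.
  intros [Q [HQ HP]].
  exists (fun z e => exists x, x <= z /\ exists w, w <= z /\ Q w (scons x e)). split.
  - apply (@Del_bex (fun e => e 0) (fun x e => exists w, w <= e 0 /\ Q w (scons x (fun n => e (S n)))));
      [apply Pol_var|].
    apply (@Del_bex (fun e => e 1) (fun w e => Q w (scons (e 0) (fun n => e (S (S n))))));
      [apply Pol_var|].
    apply (Del_ren (scons 0 (scons 1 (fun n => S (S (S n)))))) in HQ.
    revert HQ. apply Del_iff. intros e. simpl.
    replace (fun n => e (scons 1 (fun n0 => S (S (S n0))) n)) with
      (scons (e 1) (fun n => e (S (S (S n))))); [tauto|].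
    extensionality n. now destruct n.
  - intros e. split.
    + intros [x Hx]. destruct (proj1 (HP (scons x e)) Hx) as [w Hw].
      exists (x + w), x. split; [lia|]. exists w. split; [lia|trivial].
    + intros [z [x [_ [w [_ Hw]]]]]. exists x. apply (HP (scons x e)). now exists w.
Qed.

Lemma Sig_and P Q : Sig P -> Sig Q -> Sig (fun e => P e /\ Q e).
Proof.
  intros [P' [HP' HP]] [Q' [HQ' HQ]].
  apply Sig_iff with (fun e => exists w, exists v, P' w e /\ Q' v e).
  - intros e. rewrite HP, HQ. firstorder.
  - apply Sig_ex. apply (@Sig_ex (fun v e => P' (e 0) (fun n => e (S n)) /\ Q' v (fun n => e (S n)))).
    apply Del_Sig, Del_and.
    + exact (@Del_ren S _ HP').
    + exact (@Del_ren (scons 0 (fun n => S (S n))) _ HQ').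
Qed.

Lemma Sig_or P Q : Sig P -> Sig Q -> Sig (fun e => P e \/ Q e).
Proof.
  intros [P' [HP' HP]] [Q' [HQ' HQ]].
  exists (fun w e => P' w e \/ Q' w e). split; [now apply Del_or|].
  intros e. rewrite HP, HQ. firstorder.
Qed.

(** The collection principle, by which an unbounded witness moves out of a bounded universal
    quantifier. *)
Lemma bounded_choice (R : nat -> nat -> Prop) n :
  (forall x, x <= n -> exists w, R x w) ->
  exists z, forall x, x <= n -> exists w, w <= z /\ R x w.
Proof.
  induction n as [|n IH]; intros H.
  - destruct (H 0) as [w Hw]; [lia|]. exists w. intros x Hx.
    exists w. split; [lia|]. now replace x with 0 by lia.
  - destruct IH as [z Hz]; [intros; apply H; lia|]. destruct (H (S n)) as [w Hw]; [lia|].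
    exists (z + w). intros x Hx. destruct (Nat.eq_dec x (S n)) as [->|].
    + exists w. split; [lia|trivial].
    + destruct (Hz x) as [v [Hv1 Hv2]]; [lia|]. exists v. split; [lia|trivial].
Qed.

Lemma Sig_ball_pol f (P : nat -> env -> Prop) : Pol f ->
  Sig (fun e => P (e 0) (fun n => e (S n))) -> Sig (fun e => forall x, x <= f e -> P x e).
Proof.
  intros Hf [Q [HQ HP]].
  exists (fun z e => forall x, x <= f e -> exists w, w <= z /\ Q w (scons x e)). split.
  - apply (@Del_ball (fun e => f (fun n => e (S n)))
             (fun x e => exists w, w <= e 0 /\ Q w (scons x (fun n => e (S n))))).
    + destruct Hf as [t Ht]. exists (ptren S t). intros e. now rewrite ptv_ren.
    + apply (@Del_bex (fun e => e 1) (fun w e => Q w (scons (e 0) (fun n => e (S (S n))))));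
        [apply Pol_var|].
      apply (Del_ren (scons 0 (scons 1 (fun n => S (S (S n)))))) in HQ.
      revert HQ. apply Del_iff. intros e. simpl.
      replace (fun n => e (scons 1 (fun n0 => S (S (S n0))) n)) with
        (scons (e 1) (fun n => e (S (S (S n))))); [tauto|].
      extensionality n. now destruct n.
  - intros e. split.
    + intros H. apply bounded_choice. intros x Hx. now apply (HP (scons x e)), H.
    + intros [z Hz] x Hx. destruct (Hz x Hx) as [w [_ Hw]]. apply (HP (scons x e)). now exists w.
Qed.

Definition Sigf (f : env -> nat) : Prop := Sig (fun e => e 0 = f (fun n => e (S n))).

Lemma Sigf_iff f g : (forall e, f e = g e) -> Sigf f -> Sigf g.
Proof. intros H. apply Sig_iff. intros e. now rewrite H. Qed.

Lemma Sigf_pol f : Pol f -> Sigf f.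
Proof.
  intros [t H]. apply Del_Sig, Del_eq; [apply Pol_var|].
  exists (ptren S t). intros e. now rewrite ptv_ren.
Qed.

Lemma Sigf_var n : Sigf (fun e => e n).
Proof. apply Sigf_pol, Pol_var. Qed.
Lemma Sigf_const c : Sigf (fun _ => c).
Proof. apply Sigf_pol, Pol_const. Qed.

Lemma Sigf_ren r f : Sigf f -> Sigf (fun e => f (fun n => e (r n))).
Proof. intros H. exact (@Sig_ren (scons 0 (fun n => S (r n))) _ H). Qed.

Lemma Sig_app (P : nat -> env -> Prop) f :
  Sig (fun e => P (e 0) (fun n => e (S n))) -> Sigf f -> Sig (fun e => P (f e) e).
Proof.
  intros HP Hf. apply Sig_iff with (fun e => exists v, v = f e /\ P v e).
  - intros e. split; [now intros [v [-> H]]|intros H; now exists (f e)].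
  - apply Sig_ex. now apply Sig_and.
Qed.

Lemma Sig_eq f g : Sigf f -> Sigf g -> Sig (fun e => f e = g e).
Proof. intros Hf Hg. now apply (@Sig_app (fun v e => v = g e)). Qed.

Lemma Sig_rel1 (R : nat -> Prop) f :
  Sig (fun e => R (e 0)) -> Sigf f -> Sig (fun e => R (f e)).
Proof. intros HR Hf. now apply (@Sig_app (fun v _ => R v)). Qed.

Lemma Sig_rel2 (R : nat -> nat -> Prop) f g :
  Sig (fun e => R (e 0) (e 1)) -> Sigf f -> Sigf g -> Sig (fun e => R (f e) (g e)).
Proof.
  intros HR Hf Hg. apply (@Sig_app (fun v e => R v (g e))); [|trivial].
  apply (@Sig_app (fun v e => R (e 0) v)); [|now apply (Sigf_ren S)].
  exact (Sig_ren (scons 1 (scons 0 (fun n => n))) HR).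
Qed.

Lemma Sigf_fun1 (h : nat -> nat) f :
  Sigf (fun e => h (e 0)) -> Sigf f -> Sigf (fun e => h (f e)).
Proof.
  intros Hh Hf. unfold Sigf. apply (@Sig_rel2 (fun y x => y = h x)).
  - exact Hh.
  - apply Sigf_var.
  - now apply (Sigf_ren S).
Qed.

Lemma Sigf_fun2 (h : nat -> nat -> nat) f g :
  Sigf (fun e => h (e 0) (e 1)) -> Sigf f -> Sigf g -> Sigf (fun e => h (f e) (g e)).
Proof.
  intros Hh Hf Hg. unfold Sigf.
  apply (@Sig_app (fun v e => e 0 = h v (g (fun n => e (S n))))); [|now apply (Sigf_ren S)].
  apply (@Sig_app (fun v e => e 1 = h (e 0) v)); [|now apply (Sigf_ren (fun n => S (S n)))].
  exact (Sig_ren (scons 2 (scons 1 (scons 0 (fun n => n)))) Hh).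
Qed.

Lemma Sigf_S f : Sigf f -> Sigf (fun e => S (f e)).
Proof. apply (@Sigf_fun1 S). apply Sigf_pol, Pol_S, Pol_var. Qed.
Lemma Sigf_add f g : Sigf f -> Sigf g -> Sigf (fun e => f e + g e).
Proof. apply (@Sigf_fun2 Nat.add). apply Sigf_pol, Pol_add; apply Pol_var. Qed.
Lemma Sigf_mul f g : Sigf f -> Sigf g -> Sigf (fun e => f e * g e).
Proof. apply (@Sigf_fun2 Nat.mul). apply Sigf_pol, Pol_mul; apply Pol_var. Qed.

Lemma Sigf_cpair f g : Sigf f -> Sigf g -> Sigf (fun e => cpair (f e) (g e)).
Proof.
  apply (@Sigf_fun2 cpair). unfold Sigf.
  apply Sig_iff with (fun e => 2 * e 0 = (e 1 + e 2) * (e 1 + e 2 + 1) + 2 * e 2).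
  - intros e. rewrite <- cpair_double. lia.
  - apply Del_Sig, Del_eq; repeat first [apply Pol_add|apply Pol_mul|apply Pol_const|apply Pol_var].
Qed.

Lemma Sig_lt f g : Sigf f -> Sigf g -> Sig (fun e => f e < g e).
Proof.
  intros Hf Hg. apply Sig_iff with (fun e => exists x, S (f e + x) = g e).
  - intros e. split; [intros [x Hx]; lia|intros H; exists (g e - f e - 1); lia].
  - apply Sig_ex, Sig_eq; [apply Sigf_S, Sigf_add|]; [now apply (Sigf_ren S)|apply Sigf_var|].
    now apply (Sigf_ren S).
Qed.

Lemma Sigf_mod f g : Sigf f -> Sigf g -> Sigf (fun e => f e mod S (g e)).
Proof.
  apply (@Sigf_fun2 (fun a b => a mod S b)). unfold Sigf.
  apply Sig_iff with (fun e => exists q, e 1 = q * S (e 2) + e 0 /\ e 0 < S (e 2)).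
  - intros e. split.
    + intros [q [H1 H2]]. rewrite H1, Nat.add_comm, Nat.Div0.mod_add. symmetry. now apply Nat.mod_small.
    + intros ->. exists (e 1 / S (e 2)). split.
      * pose proof (Nat.div_mod_eq (e 1) (S (e 2))). lia.
      * apply Nat.mod_upper_bound. lia.
  - apply Sig_ex. apply Sig_and; [apply Sig_eq|apply Sig_lt];
      repeat first [apply Sigf_add|apply Sigf_mul|apply Sigf_S|apply Sigf_var].
Qed.

Lemma Sigf_beta f g h : Sigf f -> Sigf g -> Sigf h -> Sigf (fun e => beta (f e) (g e) (h e)).
Proof.
  intros Hf Hg Hh. unfold beta. apply (@Sigf_mod f (fun e => S (h e) * g e)); [trivial|].
  apply Sigf_mul; [now apply Sigf_S|trivial].
Qed.

Lemma Sig_ball f (P : nat -> env -> Prop) : Sigf f ->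
  Sig (fun e => P (e 0) (fun n => e (S n))) -> Sig (fun e => forall x, x < f e -> P x e).
Proof.
  intros Hf HP.
  apply (@Sig_app (fun v e => forall x, x < v -> P x e)); [|trivial].
  (* The primitive bounded quantifier includes its bound, so the bound itself is excused by a
     disjunct. *)
  apply Sig_iff with (fun e => forall x, x <= e 0 -> x = e 0 \/ P x (fun n => e (S n))).
  - intros e. split.
    + intros H x Hx. destruct (H x); [lia|lia|trivial].
    + intros H x Hx. destruct (Nat.eq_dec x (e 0)); [now left|right]. apply H. lia.
  - apply (@Sig_ball_pol (fun e => e 0) (fun x e => x = e 0 \/ P x (fun n => e (S n)))); [apply Pol_var|].
    apply Sig_or; [apply Sig_eq; apply Sigf_var|].
    exact (Sig_ren (scons 0 (fun n => S (S n))) HP).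
Qed.

Lemma Sig_const (A : Prop) : Sig (fun _ => A).
Proof.
  destruct (classic A) as [H|H].
  - apply Sig_iff with (fun _ => 0 = 0); [tauto|]. apply Sig_eq; apply Sigf_const.
  - apply Sig_iff with (fun _ => 0 = 1); [intros; split; [discriminate|tauto]|].
    apply Sig_eq; apply Sigf_const.
Qed.

(** * Recursively enumerable sets are the Sigma_1 sets *)

Section PrfInd.
Variable P : prf -> Prop.
Hypothesis HZero : P PZero.
Hypothesis HSucc : P PSucc.
Hypothesis HProj : forall i, P (PProj i).
Hypothesis HComp : forall f gs, P f -> Forall P gs -> P (PComp f gs).
Hypothesis HPrim : forall f g, P f -> P g -> P (PPrim f g).
Hypothesis HMu : forall f, P f -> P (PMu f).

Fixpoint prf_nested_ind (c : prf) : P c :=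
  match c with
  | PZero => HZero
  | PSucc => HSucc
  | PProj i => HProj i
  | PComp f gs => HComp (prf_nested_ind f)
      ((fix go l : Forall P l :=
          match l with
          | [] => Forall_nil P
          | g :: l' => Forall_cons g (prf_nested_ind g) (go l')
          end) gs)
  | PPrim f g => HPrim (prf_nested_ind f) (prf_nested_ind g)
  | PMu f => HMu (prf_nested_ind f)
  end.
End PrfInd.

Lemma peval_det c : forall args y y', peval c args y -> peval c args y' -> y = y'.
Proof.
  induction c as [| |i|f gs IHf IHgs|f g IHf IHg|f IHf] using prf_nested_ind; intros args y y' H H'.
  - inversion H; inversion H'; congruence.
  - inversion H; inversion H'; congruence.
  - inversion H; inversion H'; congruence.
  - inversion H as [| | |? ? ? ys ? F1 E1| | |]; subst.
    inversion H' as [| | |? ? ? ys' ? F2 E2| | |]; subst.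
    assert (ys = ys') as <-; [|eauto].
    clear - IHgs F1 F2. revert ys' F2. induction F1 as [|g v gs ys Hv F1 IH]; intros ys' F2.
    + inversion F2; reflexivity.
    + inversion F2 as [|? v' ? ys2 Hv' F2']; subst.
      inversion IHgs as [|? ? Hg Hgs]; subst. f_equal; eauto.
  - destruct args as [|n args]; [inversion H|].
    revert y y' H H'. induction n as [|n IHn]; intros y y' H H'.
    + inversion H; inversion H'; subst; eauto.
    + inversion H as [| | | | |? ? ? ? r ? G1 G2|]; subst.
      inversion H' as [| | | | |? ? ? ? r' ? G1' G2'|]; subst.
      rewrite (IHn _ _ G1 G1') in *. eauto.
  - inversion H as [| | | | | |? ? ? G1 G2]; subst.
    inversion H' as [| | | | | |? ? ? G1' G2']; subst.
    destruct (Nat.lt_trichotomy y y') as [Hl|[He|Hl]]; [exfalso|trivial|exfalso].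
    + destruct (G2' y Hl) as [k Hk]. discriminate (IHf _ _ _ G1 Hk).
    + destruct (G2 y' Hl) as [k Hk]. discriminate (IHf _ _ _ G1' Hk).
Qed.

(** The whole history of a primitive recursion is coded by [beta], which turns the recursion into
    two existential quantifiers and a bounded universal one. *)
Lemma peval_prim_beta f g n args y :
  peval (PPrim f g) (n :: args) y <->
  exists a b, peval f args (beta a b 0) /\ y = beta a b n /\
    forall i, i < n -> peval g (i :: beta a b i :: args) (beta a b (S i)).
Proof.
  split.
  - intros H.
    assert (Hs : exists s : nat -> nat, peval f args (s 0) /\ s n = y /\
               forall i, i < n -> peval g (i :: s i :: args) (s (S i))).
    { revert y H. induction n as [|n IH]; intros y H; inversion H as [| | | | |? ? ? ? r ? G1 G2|]; subst.
      - exists (fun _ => y). repeat split; [trivial|lia].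
      - destruct (IH r G1) as [s [H1 [H2 H3]]].
        exists (fun i => if i <=? n then s i else y). split; [exact H1|split].
        + destruct (Nat.leb_spec (S n) n); [lia|trivial].
        + intros i Hi. destruct (Nat.leb_spec i n); [|lia].
          destruct (Nat.leb_spec (S i) n).
          * apply H3. lia.
          * replace i with n by lia. now rewrite H2. }
    destruct Hs as [s [H1 [H2 H3]]]. destruct (beta_exists s (S n)) as [a [b Hab]].
    exists a, b. rewrite !Hab by lia. repeat split; [trivial|congruence|].
    intros i Hi. rewrite !Hab by lia. auto.
  - intros [a [b [H1 [-> H3]]]]. induction n as [|n IH].
    + now constructor.
    + apply ev_primS with (beta a b n); [|apply H3; lia].
      apply IH. intros; apply H3; lia.
Qed.

Definition lift_args (r : nat -> nat) (fs : list (env -> nat)) : list (env -> nat) :=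
  map (fun f e => f (fun n => e (r n))) fs.

Lemma map_lift_args r fs e :
  map (fun f => f e) (lift_args r fs) = map (fun f : env -> nat => f (fun n => e (r n))) fs.
Proof. unfold lift_args. now rewrite map_map. Qed.

Lemma Sigf_lift_args r fs : Forall Sigf fs -> Forall Sigf (lift_args r fs).
Proof.
  unfold lift_args. induction 1; simpl; constructor; trivial. now apply Sigf_ren.
Qed.

(** Arguments and value are arbitrary functions of the environment with Sigma_1 graph, not
    variables: the induction feeds intermediate results, bound by new quantifiers, to the
    subprograms. *)
Lemma Sig_peval c : forall fs h, Forall Sigf fs -> Sigf h ->
  Sig (fun e => peval c (map (fun f => f e) fs) (h e)).
Proof.
  induction c as [| |i|f gs IHf IHgs|f g IHf IHg|f IHf] using prf_nested_ind; intros fs h Hfs Hh.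
  - apply Sig_iff with (fun e => h e = 0); [|apply Sig_eq; [trivial|apply Sigf_const]].
    intros e. split; [intros ->; constructor|now inversion 1].
  - destruct Hfs as [|f0 fs Hf0 Hfs].
    + apply Sig_iff with (fun e => False); [|apply Sig_const].
      intros e. split; [tauto|inversion 1].
    + apply Sig_iff with (fun e => h e = S (f0 e)); [|apply Sig_eq; [trivial|now apply Sigf_S]].
      intros e. simpl. split; [intros ->; constructor|now inversion 1].
  - apply Sig_iff with (fun e => h e = nth i fs (fun _ => 0) e).
    + intros e. assert (E : nth i fs (fun _ => 0) e = nth i (map (fun f => f e) fs) 0).
      { symmetry. exact (map_nth (fun f : env -> nat => f e) fs (fun _ => 0) i). }
      rewrite E. split; [intros ->; constructor|now inversion 1].
    + apply Sig_eq; [trivial|]. clear - Hfs. revert i.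
      induction Hfs; intros [|i]; simpl; trivial; apply Sigf_const.
  (* The results of the components treated so far are kept in [acc] as functions of the environment;
     the inner induction on [gs] then adds one existential quantifier per component and appends its
     variable to [acc]. *)
  - enough (HH : forall acc, Forall Sigf acc -> Sig (fun e => exists ys,
        Forall2 (fun g v => peval g (map (fun f => f e) fs) v) gs ys /\
        peval f (map (fun f => f e) acc ++ ys) (h e))).
    { apply Sig_iff with (2 := HH [] (Forall_nil _)). intros e. simpl. split.
      - intros [ys [H1 H2]]. now apply ev_comp with ys.
      - inversion 1 as [| | |? ? ? ys ? F1 E1| | |]; subst. now exists ys. }
    revert fs h Hfs Hh. induction IHgs as [|g gs Hg _ IH]; intros fs h Hfs Hh acc Hacc.
    + apply Sig_iff with (2 := IHf acc h Hacc Hh). intros e. split.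
      * intros H. exists []. rewrite app_nil_r. now split.
      * intros [ys [H1 H2]]. inversion H1; subst. now rewrite app_nil_r in H2.
    + apply Sig_iff with (fun e => exists y, peval g (map (fun f => f e) fs) y /\
        exists ys, Forall2 (fun g v => peval g (map (fun f => f e) fs) v) gs ys /\
          peval f (map (fun f => f e) acc ++ y :: ys) (h e)).
      * intros e. split.
        -- intros [y [H1 [ys [H2 H3]]]]. exists (y :: ys). split; [now constructor|trivial].
        -- intros [ys [H1 H2]]. inversion H1 as [|? y ? ys' G1 G2]; subst. exists y. split; [trivial|].
           now exists ys'.
      * apply Sig_ex, Sig_and.
        -- apply Sig_iff with (2 := Hg (lift_args S fs) (fun e => e 0) (Sigf_lift_args S Hfs) (Sigf_var 0)).
           intros e. now rewrite map_lift_args.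
        -- assert (Ha : Forall Sigf (lift_args S acc ++ [fun e => e 0])).
           { apply Forall_app. split; [now apply Sigf_lift_args|]. repeat constructor. apply Sigf_var. }
           apply Sig_iff with (2 := IH (lift_args S fs) (fun e => h (fun n => e (S n)))
             (Sigf_lift_args S Hfs) (Sigf_ren S Hh) _ Ha).
           intros e. rewrite map_app, !map_lift_args. simpl.
           split; intros [ys [H1 H2]]; exists ys; rewrite <- app_assoc in *; now split.
  - destruct Hfs as [|f0 fs Hf0 Hfs].
    + apply Sig_iff with (fun e => False); [|apply Sig_const].
      intros e. split; [tauto|inversion 1].
    + simpl. apply Sig_iff with (fun e => exists a b, peval f (map (fun f => f e) fs) (beta a b 0) /\
        h e = beta a b (f0 e) /\
        forall i, i < f0 e -> peval g (i :: beta a b i :: map (fun f => f e) fs) (beta a b (S i))).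
      * intros e. symmetry. apply peval_prim_beta.
      * apply Sig_ex.
        apply (@Sig_ex (fun b e => peval f (map (fun f => f (fun n => e (S n))) fs) (beta (e 0) b 0) /\
          h (fun n => e (S n)) = beta (e 0) b (f0 (fun n => e (S n))) /\
          forall i, i < f0 (fun n => e (S n)) ->
            peval g (i :: beta (e 0) b i :: map (fun f => f (fun n => e (S n))) fs) (beta (e 0) b (S i)))).
        apply Sig_and; [|apply Sig_and].
        -- eapply Sig_iff; [|apply (IHf (lift_args (fun n => S (S n)) fs) (fun e => beta (e 1) (e 0) 0))].
           ++ intros e. cbn beta. now rewrite map_lift_args.
           ++ now apply Sigf_lift_args.
           ++ apply Sigf_beta; first [apply Sigf_var|apply Sigf_const].
        -- apply Sig_eq; [now apply (Sigf_ren (fun n => S (S n)))|].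
           apply Sigf_beta; [apply Sigf_var|apply Sigf_var|now apply (Sigf_ren (fun n => S (S n)))].
        -- apply Sig_ball; [now apply (Sigf_ren (fun n => S (S n)))|].
           eapply Sig_iff; [|apply (IHg ((fun e => e 0) :: (fun e => beta (e 2) (e 1) (e 0)) ::
               lift_args (fun n => S (S (S n))) fs) (fun e => beta (e 2) (e 1) (S (e 0))))].
           ++ intros e. cbn beta. rewrite !map_cons, map_lift_args. reflexivity.
           ++ repeat apply Forall_cons; [apply Sigf_var|apply Sigf_beta; apply Sigf_var|].
              now apply Sigf_lift_args.
           ++ apply Sigf_beta; [apply Sigf_var|apply Sigf_var|apply Sigf_S, Sigf_var].
  - apply Sig_iff with (fun e => peval f (h e :: map (fun f => f e) fs) 0 /\
      forall m, m < h e -> exists k, peval f (m :: map (fun f => f e) fs) (S k)).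
    + intros e. split; [intros [H1 H2]; now constructor|now inversion 1].
    + apply Sig_and.
      * apply (IHf (h :: fs) (fun _ => 0)); [now constructor|apply Sigf_const].
      * apply Sig_ball; [trivial|].
        apply (@Sig_ex (fun k e => peval f (e 0 :: map (fun f => f (fun n => e (S n))) fs) (S k))).
        eapply Sig_iff; [|apply (IHf ((fun e => e 1) :: lift_args (fun n => S (S n)) fs) (fun e => S (e 0)))].
        -- intros e. cbn beta. rewrite !map_cons, map_lift_args. reflexivity.
        -- apply Forall_cons; [apply Sigf_var|now apply Sigf_lift_args].
        -- apply Sigf_S, Sigf_var.
Qed.

Lemma re_set_Sig X : re_set X -> Sig (fun e => X (e 0)).
Proof.
  intros [c Hc]. apply Sig_iff with (fun e => exists v, peval c [e 0] v).
  - intros e. symmetry. apply Hc.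
  - apply Sig_ex. apply (@Sig_peval c [fun e => e 1] (fun e => e 0)); [|apply Sigf_var].
    repeat constructor. apply Sigf_var.
Qed.

Lemma recursive_set_Sig X : recursive_set X ->
  Sig (fun e => X (e 0)) /\ Sig (fun e => ~ X (e 0)).
Proof.
  intros [c Hc].
  assert (H : forall b, Sig (fun e => peval c [e 0] b)).
  { intros b. apply (@Sig_peval c [fun e => e 0] (fun _ => b)); [|apply Sigf_const].
    repeat constructor. apply Sigf_var. }
  split; [apply Sig_iff with (2 := H 1)|apply Sig_iff with (2 := H 0)]; intros e;
    destruct (Hc (e 0)) as [H1 H0]; (split; [|auto]).
  - intros He. apply NNPP. intros Hn. discriminate (peval_det He (H0 Hn)).
  - intros He Hn. discriminate (peval_det He (H1 Hn)).
Qed.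

(** * Compiling bounded formulas and unbounded search into recursive functions *)

Definition Rec (k : nat) (F : list nat -> nat) : Prop :=
  exists c, forall args, length args = k -> peval c args (F args).

Definition computes1 (g : nat -> nat) := exists c, forall x, peval c [x] (g x).
Definition computes2 (g : nat -> nat -> nat) := exists c, forall x y, peval c [x; y] (g x y).

Lemma Rec_comp1 k g F : computes1 g -> Rec k F -> Rec k (fun l => g (F l)).
Proof.
  intros [c Hc] [d Hd]. exists (PComp c [d]). intros args Hl.
  apply ev_comp with [F args]; [|trivial]. repeat constructor. auto.
Qed.

Lemma Rec_comp2 k g F G : computes2 g -> Rec k F -> Rec k G -> Rec k (fun l => g (F l) (G l)).
Proof.
  intros [c Hc] [d Hd] [d' Hd']. exists (PComp c [d; d']). intros args Hl.
  apply ev_comp with [F args; G args]; [|trivial]. repeat constructor; auto.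
Qed.

Lemma computes1_S : computes1 S.
Proof. exists PSucc. intros x. constructor. Qed.

Lemma computes2_prim c d g : (forall y, peval c [y] (g 0 y)) ->
  (forall n y, peval d [n; g n y; y] (g (S n) y)) -> computes2 g.
Proof.
  intros Hc Hd. exists (PPrim c d). intros x y. induction x as [|x IH].
  - now constructor.
  - now apply ev_primS with (g x y).
Qed.

Lemma computes2_add : computes2 Nat.add.
Proof.
  apply computes2_prim with (PProj 0) (PComp PSucc [PProj 1]).
  - intros y. exact (ev_proj 0 [y]).
  - intros n y. apply ev_comp with [n + y].
    + repeat constructor.
    + constructor.
Qed.

Lemma computes2_mul : computes2 Nat.mul.
Proof.
  destruct computes2_add as [c Hc].
  apply computes2_prim with PZero (PComp c [PProj 2; PProj 1]).
  - intros y. constructor.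
  - intros n y. apply ev_comp with [y; n * y]; [|apply Hc].
    repeat constructor.
Qed.

(** Recursion runs on the first argument, so truncated subtraction appears with its arguments
    exchanged. The inner [PPrim PZero (PProj 0)] is the predecessor function. *)
Lemma computes2_subr : computes2 (fun x y => y - x).
Proof.
  apply computes2_prim with (PProj 0) (PComp (PPrim PZero (PProj 0)) [PProj 1]).
  - intros y. rewrite Nat.sub_0_r. exact (ev_proj 0 [y]).
  - intros n y. apply ev_comp with [y - n].
    + repeat constructor.
    + replace (y - S n) with (pred (y - n)) by lia.
      induction (y - n) as [|m IH]; [repeat constructor|].
      apply ev_primS with (pred m); [exact IH|]. exact (ev_proj 0 [m; pred m]).
Qed.

(** With 0 read as truth this is the truth function of implication. *)
Lemma computes2_cond : computes2 (fun x y => match x with 0 => y | S _ => 0 end).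
Proof.
  apply computes2_prim with (PProj 0) PZero.
  - intros y. exact (ev_proj 0 [y]).
  - intros n y. constructor.
Qed.

Lemma Rec_const k n : Rec k (fun _ => n).
Proof.
  induction n as [|n IH].
  - exists PZero. intros. constructor.
  - exact (Rec_comp1 computes1_S IH).
Qed.

Lemma Rec_ptv t k : Rec k (fun l => ptv (fun n => nth n l 0) t).
Proof.
  induction t as [n| |t IH|t IHt u IHu|t IHt u IHu]; simpl.
  - exists (PProj n). intros. constructor.
  - apply Rec_const.
  - exact (Rec_comp1 computes1_S IH).
  - exact (Rec_comp2 computes2_add IHt IHu).
  - exact (Rec_comp2 computes2_mul IHt IHu).
Qed.

(** With 0 read as truth, the sum plays the part of the bounded universal quantifier. *)
Fixpoint sum_to (F : nat -> nat) (n : nat) : nat :=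
  match n with 0 => F 0 | S m => sum_to F m + F (S m) end.

Lemma sum_to_0 F n : sum_to F n = 0 <-> forall x, x <= n -> F x = 0.
Proof.
  induction n as [|n IH]; simpl.
  - split; [intros H x Hx; now replace x with 0 by lia|auto].
  - split.
    + intros H x Hx. destruct (Nat.eq_dec x (S n)) as [->|]; [lia|]. apply IH; lia.
    + intros H. rewrite (H (S n)) by lia. rewrite (proj2 IH); [trivial|]. auto.
Qed.

Lemma peval_projs args pre :
  Forall2 (fun g v => peval g (pre ++ args) v) (map PProj (seq (length pre) (length args))) args.
Proof.
  revert pre. induction args as [|a args IH]; intros pre; simpl; constructor.
  - replace a with (nth (length pre) (pre ++ a :: args) 0) at 2; [constructor|].
    rewrite app_nth2 by lia. now rewrite Nat.sub_diag.
  - specialize (IH (pre ++ [a])). rewrite <- app_assoc, length_app, Nat.add_1_r in IH. exact IH.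
Qed.

Lemma Rec_sum k T F : Rec k T -> Rec (S k) F -> Rec k (fun l => sum_to (fun x => F (x :: l)) (T l)).
Proof.
  intros [ct Ht] [cf Hf]. destruct computes2_add as [ca Ha].
  pose (c0 := PComp cf (PZero :: map PProj (seq 0 k))).
  (* A recursion step receives the counter, the partial sum and then the list, so the sum is
     projection 1 and the list starts at projection 2. *)
  pose (c1 := PComp ca [PProj 1; PComp cf (PComp PSucc [PProj 0] :: map PProj (seq 2 k))]).
  exists (PComp (PPrim c0 c1) (ct :: map PProj (seq 0 k))). intros args Hl.
  apply ev_comp with (T args :: args).
  - constructor; [auto|]. rewrite <- Hl. exact (peval_projs args []).
  - induction (T args) as [|n IH]; simpl.
    + constructor. apply ev_comp with (0 :: args); [|apply Hf; simpl; lia].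
      constructor; [constructor|]. rewrite <- Hl. exact (peval_projs args []).
    + apply ev_primS with (1 := IH). set (r := sum_to _ n).
      apply ev_comp with [r; F (S n :: args)]; [|apply Ha].
      constructor; [exact (ev_proj 1 (n :: r :: args))|]. constructor; [|constructor].
      apply ev_comp with (S n :: args); [|apply Hf; simpl; lia].
      constructor.
      * apply ev_comp with [n]; [|constructor]. repeat constructor.
      * rewrite <- Hl. exact (peval_projs args [n; r]).
Qed.

Lemma Rec_holds d : forall k, exists F, Rec k F /\
  forall l, F l = 0 <-> holds (fun n => nth n l 0) d.
Proof.
  induction d as [s t| |a IHa b IHb|t a IHa]; intros k.
  - exists (fun l => (ptv (fun n => nth n l 0) s - ptv (fun n => nth n l 0) t) +
               (ptv (fun n => nth n l 0) t - ptv (fun n => nth n l 0) s)). split.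
    + apply (Rec_comp2 computes2_add); apply (Rec_comp2 computes2_subr); apply Rec_ptv.
    + intros l. simpl. lia.
  - exists (fun _ => 1). split; [apply Rec_const|]. intros l. simpl. split; [discriminate|tauto].
  - destruct (IHa k) as [F [HF1 HF2]], (IHb k) as [G [HG1 HG2]].
    exists (fun l => match F l with 0 => G l | S _ => 0 end). split.
    + exact (Rec_comp2 computes2_cond HF1 HG1).
    + intros l. simpl. rewrite <- HF2, <- HG2. destruct (F l); [tauto|].
      split; [discriminate|trivial].
  - destruct (IHa (S k)) as [F [HF1 HF2]].
    exists (fun l => sum_to (fun x => F (x :: l)) (ptv (fun n => nth n l 0) t)). split.
    + apply Rec_sum; [apply Rec_ptv|trivial].
    + intros l. rewrite sum_to_0. simpl.
      assert (E : forall x, (fun n => nth n (x :: l) 0) = scons x (fun n => nth n l 0)).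
      { intros x. extensionality n. now destruct n. }
      split; intros H x Hx; specialize (H x Hx).
      * rewrite HF2, E in H. exact H.
      * now rewrite HF2, E.
Qed.

(** Kleene's normal form: membership is the existence of a zero of a total recursive function, which
    is what [PMu] can look for. *)
Lemma Sig_search X : Sig (fun e => X (e 0)) ->
  exists F, Rec 2 F /\ forall n, X n <-> exists w, F [w; n] = 0.
Proof.
  intros [Q [[d Hd] HX]]. destruct (Rec_holds d 2) as [F [H1 H2]].
  exists F. split; [trivial|]. intros n. rewrite (HX (fun m => nth m [n] 0) : X n <-> _).
  assert (E : forall w, Q w (fun m => nth m [n] 0) <-> F [w; n] = 0).
  { intros w. rewrite H2, <- Hd. reflexivity. }
  split; intros [w Hw]; exists w; now apply E.
Qed.

Lemma least_witness (P : nat -> Prop) :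
  (exists n, P n) -> exists n, P n /\ forall m, m < n -> ~ P m.
Proof.
  intros [n Hn]. induction n as [n IH] using lt_wf_ind.
  destruct (classic (exists m, m < n /\ P m)) as [[m [H1 H2]]|H].
  - now apply IH with m.
  - exists n. split; [trivial|]. intros m Hm Hp. apply H. now exists m.
Qed.

Lemma peval_mu c F n : (forall args, length args = 2 -> peval c args (F args)) ->
  (exists w, F [w; n] = 0) -> exists w, F [w; n] = 0 /\ peval (PMu c) [n] w.
Proof.
  intros Hc Hw. destruct (least_witness _ Hw) as [w [H1 H2]].
  exists w. split; [trivial|]. constructor.
  - rewrite <- H1. now apply Hc.
  - intros m Hm. exists (pred (F [m; n])). specialize (H2 m Hm).
    replace (S (pred (F [m; n]))) with (F [m; n]) by lia. now apply Hc.
Qed.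

Lemma Sig_re_set X : Sig (fun e => X (e 0)) -> re_set X.
Proof.
  intros H. destruct (Sig_search _ H) as [F [[c Hc] HX]]. exists (PMu c). intros n. rewrite HX. split.
  - intros Hw. destruct (peval_mu _ n Hc Hw) as [w [_ Hw']]. now exists w.
  - intros [w Hw]. exists w. inversion Hw as [| | | | | |? ? ? G1 G2]; subst.
    apply (peval_det (Hc [w; n] eq_refl) G1).
Qed.

Lemma Sig_recursive_set X :
  Sig (fun e => X (e 0)) -> Sig (fun e => ~ X (e 0)) -> recursive_set X.
Proof.
  intros H H'. destruct (Sig_search _ H) as [F [HF HX]].
  destruct (@Sig_search (fun n => ~ X n) H') as [G [HG HX']].
  (* Post's theorem. The search stops at the first [w] where the product of [F] and [G] vanishes;
     some [w] exists since [n] is in [X] or not. As only the correct one of the two can vanish, the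
     answer is [1 - F], computed by [c']. *)
  destruct (Rec_comp2 computes2_mul HF HG) as [c Hc].
  destruct (Rec_comp2 computes2_subr HF (Rec_const 2 1)) as [c' Hc'].
  exists (PComp c' [PMu c; PProj 0]). intros n.
  assert (Hw : exists w, F [w; n] * G [w; n] = 0).
  { destruct (classic (X n)) as [Hn|Hn].
    - apply HX in Hn as [w Hw]. exists w. now rewrite Hw.
    - apply HX' in Hn as [w Hw]. exists w. rewrite Hw. lia. }
  destruct (@peval_mu _ (fun l => F l * G l) n Hc Hw) as [w [H1 H2]].
  assert (Hev : peval (PComp c' [PMu c; PProj 0]) [n] (1 - F [w; n])).
  { apply ev_comp with [w; n]; [|now apply Hc'].
    constructor; [trivial|repeat constructor]. }
  apply Nat.mul_eq_0 in H1. split; intros Hn.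
  - assert (E : 1 - F [w; n] = 1); [|now rewrite E in Hev]. destruct H1 as [->|H1]; [trivial|].
    exfalso. refine (proj2 (HX' n) _ Hn). now exists w.
  - assert (E : 1 - F [w; n] = 0); [|now rewrite E in Hev].
    destruct (F [w; n]) eqn:EF; [|lia].
    exfalso. apply Hn, HX. now exists w.
Qed.

(** * Least models of Horn programs are Sigma_1 *)

Inductive pat : Type :=
| PV : nat -> pat
| PN : nat -> pat
| PS : pat -> pat
| PP : pat -> pat -> pat.

Fixpoint pval (e : env) (p : pat) : nat :=
  match p with
  | PV i => e i
  | PN n => n
  | PS q => S (pval e q)
  | PP q r => cpair (pval e q) (pval e r)
  end.

Fixpoint pvars (p : pat) : nat :=
  match p with
  | PV i => S i
  | PN n => 0
  | PS q => pvars q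
  | PP q r => pvars q + pvars r
  end.

Lemma pval_agree e e' p : (forall i, i < pvars p -> e i = e' i) -> pval e p = pval e' p.
Proof.
  induction p as [i|n|q IH|q IHq r IHr]; simpl; intros H; auto.
  rewrite IHq, IHr; [trivial| |]; intros; apply H; lia.
Qed.

Lemma Sigf_pval f g p : Sigf f -> Sigf g -> Sigf (fun e => pval (beta (f e) (g e)) p).
Proof.
  intros Hf Hg. induction p as [i|n|q IH|q IHq r IHr]; simpl.
  - apply Sigf_beta; [trivial|trivial|apply Sigf_const].
  - apply Sigf_const.
  - now apply Sigf_S.
  - now apply Sigf_cpair.
Qed.

Notation clause := (pat * list pat)%type.

Section Horn.
Variable prog : list clause.
Variable Base : nat -> Prop.

Inductive derivable : nat -> Prop :=
| derivable_base c : Base c -> derivable c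
| derivable_clause r e : In r prog ->
    (forall q, In q (snd r) -> derivable (pval e q)) -> derivable (pval e (fst r)).

Definition fires (X : nat -> Prop) (c : nat) (r : clause) (e : env) : Prop :=
  c = pval e (fst r) /\ forall q, In q (snd r) -> X (pval e q).

Definition step (X : nat -> Prop) (c : nat) : Prop :=
  Base c \/ exists r, In r prog /\ exists e, fires X c r e.

Definition derivation (n : nat) (s : nat -> nat) : Prop :=
  forall i, i < n -> step (fun v => exists j, j < i /\ v = s j) (s i).

Lemma step_mono (X Y : nat -> Prop) c : (forall v, X v -> Y v) -> step X c -> step Y c.
Proof.
  intros H [Hb|[r [Hr [e [He1 He2]]]]]; [now left|right].
  exists r. split; [trivial|]. exists e. split; auto.
Qed.

Lemma derivation_app n1 s1 n2 s2 : derivation n1 s1 -> derivation n2 s2 ->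
  derivation (n1 + n2) (fun i => if i <? n1 then s1 i else s2 (i - n1)).
Proof.
  intros H1 H2 i Hi. destruct (Nat.ltb_spec i n1) as [Hlt|Hge].
  - apply step_mono with (2 := H1 i Hlt). intros v [j [Hj ->]]. exists j. split; [trivial|].
    destruct (Nat.ltb_spec j n1); [trivial|lia].
  - assert (Hi' : i - n1 < n2) by lia. apply step_mono with (2 := H2 _ Hi').
    intros v [j [Hj ->]]. exists (n1 + j). split; [lia|].
    destruct (Nat.ltb_spec (n1 + j) n1); [lia|]. f_equal. lia.
Qed.

Lemma derivable_derivation c : derivable c ->
  exists n s, derivation n s /\ exists j, j < n /\ c = s j.
Proof.
  induction 1 as [c Hc|r e Hr Hp IH].
  - exists 1, (fun _ => c). split.
    + intros i Hi. now left.
    + exists 0. split; [lia|trivial].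
  - assert (HH : exists n s, derivation n s /\ forall q, In q (snd r) -> exists j, j < n /\ pval e q = s j).
    { clear Hp. induction (snd r) as [|q l IHl].
      - exists 0, (fun _ => 0). split; [intros i Hi; lia|intros q []].
      - destruct IHl as [n1 [s1 [D1 E1]]]; [intros; apply IH; now right|].
        destruct (IH q (or_introl eq_refl)) as [n2 [s2 [D2 [j2 [Hj2 E2]]]]].
        exists (n1 + n2), (fun i => if i <? n1 then s1 i else s2 (i - n1)).
        split; [now apply derivation_app|]. intros q' [<-|Hq'].
        + exists (n1 + j2). split; [lia|]. destruct (Nat.ltb_spec (n1 + j2) n1); [lia|].
          rewrite E2. f_equal. lia.
        + destruct (E1 q' Hq') as [j [Hj E]]. exists j. split; [lia|].
          destruct (Nat.ltb_spec j n1); [trivial|lia]. }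
    destruct HH as [n [s [D E]]].
    exists (S n), (fun i => if i <? n then s i else pval e (fst r)). split.
    + intros i Hi. destruct (Nat.ltb_spec i n) as [Hlt|Hge].
      * apply step_mono with (2 := D i Hlt). intros v [j [Hj ->]]. exists j. split; [trivial|].
        destruct (Nat.ltb_spec j n); [trivial|lia].
      * right. exists r. split; [trivial|]. exists e. split; [trivial|].
        intros q Hq. destruct (E q Hq) as [j [Hj Ej]]. exists j. split; [lia|].
        destruct (Nat.ltb_spec j n); [trivial|lia].
    + exists n. split; [lia|]. now rewrite Nat.ltb_irrefl.
Qed.

Lemma derivation_derivable n s : derivation n s -> forall i, i < n -> derivable (s i).
Proof.
  intros D i. induction i as [i IH] using lt_wf_ind. intros Hi.
  destruct (D i Hi) as [Hb|[r [Hr [e [He1 He2]]]]]; [now constructor|].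
  rewrite He1. apply derivable_clause; [trivial|].
  intros q Hq. destruct (He2 q Hq) as [j [Hj ->]]. apply IH; lia.
Qed.

Lemma derivable_beta c : derivable c <->
  exists a b n, derivation (S n) (beta a b) /\ c = beta a b n.
Proof.
  split.
  - intros H. destruct (derivable_derivation H) as [n [s [D [j [Hj ->]]]]].
    destruct (beta_exists s n) as [a [b Hab]]. exists a, b, j. split.
    + intros i Hi. rewrite Hab by lia. assert (Hin : i < n) by lia.
      apply step_mono with (2 := D i Hin). intros v [k [Hk ->]]. exists k. split; [trivial|].
      rewrite Hab by lia. trivial.
    + rewrite Hab by lia. trivial.
  - intros [a [b [n [D ->]]]]. apply derivation_derivable with (1 := D). lia.
Qed.

(** A clause mentions finitely many variables, so an assignment matters only up to a bound and can
    be replaced by a pair of numbers via [beta]. *)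
Lemma fires_beta X c r :
  (exists e, fires X c r e) <-> exists a b, fires X c r (beta a b).
Proof.
  split; [|intros [a [b H]]; now exists (beta a b)].
  intros [e [H1 H2]].
  assert (HN : exists N, pvars (fst r) <= N /\ forall q, In q (snd r) -> pvars q <= N).
  { clear H2. induction (snd r) as [|q l [N [HN1 HN2]]].
    - exists (pvars (fst r)). split; [lia|intros q []].
    - exists (N + pvars q). split; [lia|]. intros q' [<-|Hq']; [lia|]. specialize (HN2 q' Hq'). lia. }
  destruct HN as [N [HN1 HN2]]. destruct (beta_exists e N) as [a [b Hab]].
  assert (E : forall p, pvars p <= N -> pval (beta a b) p = pval e p).
  { intros p Hp. apply pval_agree. intros; apply Hab; lia. }
  exists a, b. split.
  - now rewrite E.
  - intros q Hq. rewrite E by auto. auto.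
Qed.

Hypothesis Base_Sig : Sig (fun e => Base (e 0)).

(** [X] depends on the environment because it will be the set of earlier entries of a coded
    derivation, whose code and position are themselves quantified variables. *)
Lemma Sig_step (X : nat -> env -> Prop) f :
  Sig (fun e => X (e 0) (fun n => e (S n))) -> Sigf f ->
  Sig (fun e => step (fun v => X v e) (f e)).
Proof.
  intros HX Hf. apply Sig_or; [now apply Sig_rel1|].
  induction prog as [|r l IH].
  - apply Sig_iff with (fun _ => False); [|apply Sig_const]. intros e. split; [tauto|now intros [r [[] _]]].
  - apply Sig_iff with (fun e => (exists a b, fires (fun v => X v e) (f e) r (beta a b)) \/
                          exists r', In r' l /\ exists e', fires (fun v => X v e) (f e) r' e').
    + intros e. rewrite <- fires_beta. split.
      * intros [H|[r' [Hr' H]]]; [exists r|exists r']; simpl; auto.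
      * intros [r' [[<-|Hr'] H]]; [now left|right; now exists r'].
    + apply Sig_or; [|trivial]. apply Sig_ex.
      apply (@Sig_ex (fun b e => fires (fun v => X v (fun n => e (S n))) (f (fun n => e (S n))) r (beta (e 0) b))).
      apply Sig_and.
      * apply Sig_eq; [now apply (Sigf_ren (fun n => S (S n)))|apply Sigf_pval; apply Sigf_var].
      * induction (snd r) as [|q qs IHq].
        -- apply Sig_iff with (fun _ => True); [|apply Sig_const]. intros e. split; [intros _ q []|trivial].
        -- apply Sig_iff with (fun e => X (pval (beta (e 1) (e 0)) q) (fun n => e (S (S n))) /\
             forall q, In q qs -> X (pval (beta (e 1) (e 0)) q) (fun n => e (S (S n)))).
           ++ intros e. split.
              ** intros [H1 H2] q' [<-|Hq']; auto.
              ** intros H. split; [|intros]; apply H; simpl; auto.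
           ++ apply Sig_and; [|trivial].
              apply (@Sig_app (fun v e => X v (fun n => e (S (S n))))); [|apply Sigf_pval; apply Sigf_var].
              exact (Sig_ren (scons 0 (fun n => S (S (S n)))) HX).
Qed.

Lemma Sig_derivable : Sig (fun e => derivable (e 0)).
Proof.
  apply Sig_iff with (fun e => exists a b n, derivation (S n) (beta a b) /\ e 0 = beta a b n).
  - intros e. symmetry. apply derivable_beta.
  - apply Sig_ex.
    apply (@Sig_ex (fun b e => exists n, derivation (S n) (beta (e 0) b) /\ e 1 = beta (e 0) b n)).
    apply (@Sig_ex (fun n e => derivation (S n) (beta (e 1) (e 0)) /\ e 2 = beta (e 1) (e 0) n)).
    apply Sig_and; [|apply Sig_eq; [apply Sigf_var|apply Sigf_beta; apply Sigf_var]].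
    apply Sig_ball; [apply Sigf_S, Sigf_var|].
    apply (@Sig_step (fun v e => exists j, j < e 0 /\ v = beta (e 3) (e 2) j)
             (fun e => beta (e 3) (e 2) (e 0))); [|apply Sigf_beta; apply Sigf_var].
    apply (@Sig_ex (fun j e => j < e 1 /\ e 0 = beta (e 4) (e 3) j)).
    apply Sig_and; [apply Sig_lt; apply Sigf_var|].
    apply Sig_eq; [apply Sigf_var|apply Sigf_beta; apply Sigf_var].
Qed.

End Horn.

(** * Provability as a Horn program *)

Arguments cpair : simpl never.

(** The projections serve only to state what derivable codes mean; they never enter a Sigma_1
    definition, so defining them by choice is harmless. *)
Definition pi1 (c : nat) : nat := epsilon (inhabits 0) (fun x => exists y, c = cpair x y).
Definition pi2 (c : nat) : nat := epsilon (inhabits 0) (fun y => exists x, c = cpair x y).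

Lemma pi1_cpair x y : pi1 (cpair x y) = x.
Proof.
  unfold pi1. destruct (epsilon_spec (inhabits 0) (fun x' => exists y', cpair x y = cpair x' y')) as [y' H].
  - now exists x, y.
  - apply cpair_inj in H as [H _]. congruence.
Qed.

Lemma pi2_cpair x y : pi2 (cpair x y) = y.
Proof.
  unfold pi2. destruct (epsilon_spec (inhabits 0) (fun y' => exists x', cpair x y = cpair x' y')) as [x' H].
  - now exists y, x.
  - apply cpair_inj in H as [_ H]. congruence.
Qed.

(** * Injectivity of the coding, codes of substitutions *)

Section Codes.
Variable L : lang.
Variable ef : funcs L -> nat.
Variable er : rels L -> nat.
Hypothesis ef_inj : forall f g, ef f = ef g -> f = g.
Hypothesis er_inj : forall r s, er r = er s -> r = s.

Lemma code_term_func f (v : Vector.t (term L) (ar_f L f)) :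
  code_term ef (func f v) = cpair 1 (cpair (ef f) (code_vec ef v)).
Proof.
  reflexivity.
Qed.

Lemma code_vec_inj_Forall k (v : Vector.t (term L) k) :
  Vector.Forall (fun t => forall u, code_term ef t = code_term ef u -> t = u) v ->
  forall w, code_vec ef v = code_vec ef w -> v = w.
Proof.
  induction v as [|t k v IH]; intros H w Hw.
  - now rewrite (Vector.nil_spec w).
  - apply Vector.Forall_cons_iff in H as [H1 H2].
    revert Hw. apply (Vector.caseS' w). intros u w' Hw.
    simpl in Hw. injection Hw as Hw. apply cpair_inj in Hw as [E1 E2].
    f_equal; auto.
Qed.

Lemma code_term_inj (t : term L) : forall u, code_term ef t = code_term ef u -> t = u.
Proof.
  induction t as [n|f v IH] using term_nested_ind; intros [m|g w] H;
    rewrite ?code_term_func in H; apply cpair_inj in H as [E H]; try discriminate E.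
  - now subst.
  - apply cpair_inj in H as [E1 E2]. apply ef_inj in E1. subst g.
    f_equal. now apply code_vec_inj_Forall.
Qed.

Lemma code_vec_inj k (v w : Vector.t (term L) k) : code_vec ef v = code_vec ef w -> v = w.
Proof.
  apply code_vec_inj_Forall. apply Vector.Forall_forall. intros t _. apply code_term_inj.
Qed.

Lemma code_form_inj (p : form L) : forall q, code_form ef er p = code_form ef er q -> p = q.
Proof.
  induction p as [|r v|a b|a IHa b IHb|a IHa b IHb|a IHa b IHb|a IHa|a IHa];
    intros [|r' v'|a' b'|a' b'|a' b'|a' b'|a'|a'] H; simpl in H;
    apply cpair_inj in H as [E H]; try discriminate E; trivial;
    try (apply cpair_inj in H as [E1 E2]; f_equal; auto using code_term_inj; fail).
  - apply cpair_inj in H as [E1 E2]. apply er_inj in E1. subst r'. f_equal. now apply code_vec_inj.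
  - f_equal; auto.
  - f_equal; auto.
Qed.

Fixpoint code_ctx (G : list (form L)) : nat :=
  match G with
  | [] => 0
  | p :: G' => S (cpair (code_form ef er p) (code_ctx G'))
  end.

Lemma code_ctx_inj G : forall G', code_ctx G = code_ctx G' -> G = G'.
Proof.
  induction G as [|p G IH]; intros [|p' G'] H; try discriminate H; trivial.
  simpl in H. injection H as H. apply cpair_inj in H as [E1 E2].
  apply code_form_inj in E1. f_equal; auto.
Qed.

(** A substitution is an infinite object. Only three kinds occur in the deduction rules and under
    their quantifiers: the shift, the instantiation of variable 0, and lifts of these. Each has a
    finite code. *)
Inductive codes_subst : (nat -> term L) -> nat -> Prop :=
| codes_shift : codes_subst (fun k => var (S k)) (cpair 0 0)
| codes_inst t : codes_subst (fun n => match n with 0 => t | S m => var m end)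
                             (cpair 1 (code_term ef t))
| codes_up s c : codes_subst s c -> codes_subst (up s) (cpair 2 c).

Lemma codes_subst_inv s tag c : codes_subst s (cpair tag c) ->
  match tag with
  | 0 => s = fun k => var (S k)
  | 1 => exists t, c = code_term ef t /\ s = fun n => match n with 0 => t | S m => var m end
  | 2 => exists s', codes_subst s' c /\ s = up s'
  | _ => False
  end.
Proof.
  inversion 1 as [E1 E2|t E1 E2|s' c' H' E1 E2]; apply cpair_inj in E2 as [<- E2]; subst.
  - reflexivity.
  - now exists t.
  - now exists s'.
Qed.

End Codes.

Notation J1 t a := (PP (PN t) a).
Notation J2 t a b := (PP (PN t) (PP a b)).
Notation J3 t a b c := (PP (PN t) (PP a (PP b c))).

(* Judgements are tagged: 0, 1 function and relation symbols with their arity,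
   2 axioms; 3-6 well-formed terms, argument lists (with their length), formulas
   and contexts; 7-10 application of a substitution to a variable, term, argument
   list and formula; 11 shift of a context; 12 membership in a context; 13 contexts
   of axioms; 14 provability from a context; 15 theorems. *)
Definition cl_term_var : clause := (J1 3 (J1 0 (PV 0)), []).
Definition cl_term_func : clause :=
  (J1 3 (J2 1 (PV 0) (PV 1)), [J2 0 (PV 0) (PV 2); J2 4 (PV 2) (PV 1)]).
Definition cl_vec_nil : clause := (J2 4 (PN 0) (PN 0), []).
Definition cl_vec_cons : clause :=
  (J2 4 (PS (PV 0)) (PS (PP (PV 1) (PV 2))), [J1 3 (PV 1); J2 4 (PV 0) (PV 2)]).
Definition cl_form_fal : clause := (J1 5 (J1 0 (PN 0)), []).
Definition cl_form_atom : clause :=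
  (J1 5 (J2 1 (PV 0) (PV 1)), [J2 1 (PV 0) (PV 2); J2 4 (PV 2) (PV 1)]).
Definition cl_form_equ : clause := (J1 5 (J2 2 (PV 0) (PV 1)), [J1 3 (PV 0); J1 3 (PV 1)]).
Definition cl_form_bin (i : nat) : clause :=
  (J1 5 (J2 i (PV 0) (PV 1)), [J1 5 (PV 0); J1 5 (PV 1)]).
Definition cl_form_quant (i : nat) : clause := (J1 5 (J1 i (PV 0)), [J1 5 (PV 0)]).
Definition cl_ctx_nil : clause := (J1 6 (PN 0), []).
Definition cl_ctx_cons : clause := (J1 6 (PS (PP (PV 0) (PV 1))), [J1 5 (PV 0); J1 6 (PV 1)]).

Definition p_shift : pat := J1 0 (PN 0).
Definition p_inst (t : pat) : pat := J1 1 t.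

Definition cl_shift_var : clause := (J3 7 p_shift (PV 0) (J1 0 (PS (PV 0))), []).
Definition cl_inst_0 : clause := (J3 7 (p_inst (PV 0)) (PN 0) (PV 0), []).
Definition cl_inst_S : clause := (J3 7 (p_inst (PV 0)) (PS (PV 1)) (J1 0 (PV 1)), []).
Definition cl_up_0 : clause := (J3 7 (J1 2 (PV 0)) (PN 0) (J1 0 (PN 0)), []).
Definition cl_up_S : clause :=
  (J3 7 (J1 2 (PV 0)) (PS (PV 1)) (PV 3), [J3 7 (PV 0) (PV 1) (PV 2); J3 8 p_shift (PV 2) (PV 3)]).
Definition cl_sub_var : clause := (J3 8 (PV 0) (J1 0 (PV 1)) (PV 2), [J3 7 (PV 0) (PV 1) (PV 2)]).
Definition cl_sub_func : clause :=
  (J3 8 (PV 0) (J2 1 (PV 1) (PV 2)) (J2 1 (PV 1) (PV 3)), [J3 9 (PV 0) (PV 2) (PV 3)]).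
Definition cl_sub_nil : clause := (J3 9 (PV 0) (PN 0) (PN 0), []).
Definition cl_sub_cons : clause :=
  (J3 9 (PV 0) (PS (PP (PV 1) (PV 2))) (PS (PP (PV 3) (PV 4))),
   [J3 8 (PV 0) (PV 1) (PV 3); J3 9 (PV 0) (PV 2) (PV 4)]).
Definition cl_sub_fal : clause := (J3 10 (PV 0) (J1 0 (PN 0)) (J1 0 (PN 0)), []).
Definition cl_sub_atom : clause :=
  (J3 10 (PV 0) (J2 1 (PV 1) (PV 2)) (J2 1 (PV 1) (PV 3)), [J3 9 (PV 0) (PV 2) (PV 3)]).
Definition cl_sub_equ : clause :=
  (J3 10 (PV 0) (J2 2 (PV 1) (PV 2)) (J2 2 (PV 3) (PV 4)),
   [J3 8 (PV 0) (PV 1) (PV 3); J3 8 (PV 0) (PV 2) (PV 4)]).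
Definition cl_sub_bin (i : nat) : clause :=
  (J3 10 (PV 0) (J2 i (PV 1) (PV 2)) (J2 i (PV 3) (PV 4)),
   [J3 10 (PV 0) (PV 1) (PV 3); J3 10 (PV 0) (PV 2) (PV 4)]).
Definition cl_sub_quant (i : nat) : clause :=
  (J3 10 (PV 0) (J1 i (PV 1)) (J1 i (PV 2)), [J3 10 (J1 2 (PV 0)) (PV 1) (PV 2)]).
Definition cl_shift_nil : clause := (J2 11 (PN 0) (PN 0), []).
Definition cl_shift_cons : clause :=
  (J2 11 (PS (PP (PV 0) (PV 1))) (PS (PP (PV 2) (PV 3))),
   [J3 10 p_shift (PV 0) (PV 2); J2 11 (PV 1) (PV 3)]).
Definition cl_in_here : clause := (J2 12 (PV 0) (PS (PP (PV 0) (PV 1))), []).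
Definition cl_in_next : clause := (J2 12 (PV 0) (PS (PP (PV 2) (PV 1))), [J2 12 (PV 0) (PV 1)]).
Definition cl_ax_nil : clause := (J1 13 (PN 0), []).
Definition cl_ax_cons : clause := (J1 13 (PS (PP (PV 0) (PV 1))), [J1 2 (PV 0); J1 13 (PV 1)]).

(** In the deduction clauses, well-formedness premises (tags 3, 5 and 6) stand where the remaining
    premises would not force a number to be the code of a term, formula or context. Thus every
    derivable judgement with tag 14 can be decoded into a derivation. *)
Definition cl_Ctx : clause := (J2 14 (PV 0) (PV 1), [J1 6 (PV 0); J2 12 (PV 1) (PV 0)]).
Definition cl_ImpI : clause :=
  (J2 14 (PV 0) (J2 3 (PV 1) (PV 2)), [J2 14 (PS (PP (PV 1) (PV 0))) (PV 2)]).
Definition cl_ImpE : clause :=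
  (J2 14 (PV 0) (PV 2), [J2 14 (PV 0) (J2 3 (PV 1) (PV 2)); J2 14 (PV 0) (PV 1)]).
Definition cl_AndI : clause :=
  (J2 14 (PV 0) (J2 4 (PV 1) (PV 2)), [J2 14 (PV 0) (PV 1); J2 14 (PV 0) (PV 2)]).
Definition cl_AndE1 : clause := (J2 14 (PV 0) (PV 1), [J2 14 (PV 0) (J2 4 (PV 1) (PV 2))]).
Definition cl_AndE2 : clause := (J2 14 (PV 0) (PV 2), [J2 14 (PV 0) (J2 4 (PV 1) (PV 2))]).
Definition cl_OrI1 : clause :=
  (J2 14 (PV 0) (J2 5 (PV 1) (PV 2)), [J2 14 (PV 0) (PV 1); J1 5 (PV 2)]).
Definition cl_OrI2 : clause :=
  (J2 14 (PV 0) (J2 5 (PV 1) (PV 2)), [J2 14 (PV 0) (PV 2); J1 5 (PV 1)]).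
Definition cl_OrE : clause :=
  (J2 14 (PV 0) (PV 3), [J2 14 (PV 0) (J2 5 (PV 1) (PV 2));
     J2 14 (PS (PP (PV 1) (PV 0))) (PV 3); J2 14 (PS (PP (PV 2) (PV 0))) (PV 3)]).
Definition cl_AllI : clause :=
  (J2 14 (PV 0) (J1 6 (PV 1)), [J1 6 (PV 0); J2 11 (PV 0) (PV 2); J2 14 (PV 2) (PV 1)]).
Definition cl_AllE : clause :=
  (J2 14 (PV 0) (PV 3),
   [J2 14 (PV 0) (J1 6 (PV 1)); J1 3 (PV 2); J3 10 (p_inst (PV 2)) (PV 1) (PV 3)]).
Definition cl_ExI : clause :=
  (J2 14 (PV 0) (J1 7 (PV 1)), [J1 5 (PV 1); J1 3 (PV 2);
     J3 10 (p_inst (PV 2)) (PV 1) (PV 3); J2 14 (PV 0) (PV 3)]).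
Definition cl_ExE : clause :=
  (J2 14 (PV 0) (PV 2), [J2 14 (PV 0) (J1 7 (PV 1)); J1 5 (PV 2); J2 11 (PV 0) (PV 3);
     J3 10 p_shift (PV 2) (PV 4); J2 14 (PS (PP (PV 1) (PV 3))) (PV 4)]).
Definition cl_Explosion : clause :=
  (J2 14 (PV 0) (PV 1), [J2 14 (PV 0) (J1 0 (PN 0)); J1 5 (PV 1)]).
Definition cl_RAA : clause :=
  (J2 14 (PV 0) (PV 1), [J2 14 (PS (PP (J2 3 (PV 1) (J1 0 (PN 0))) (PV 0))) (J1 0 (PN 0))]).
Definition cl_EqRefl : clause :=
  (J2 14 (PV 0) (J2 2 (PV 1) (PV 1)), [J1 6 (PV 0); J1 3 (PV 1)]).
Definition cl_EqLeib : clause :=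
  (J2 14 (PV 0) (PV 5), [J2 14 (PV 0) (J2 2 (PV 1) (PV 2)); J1 5 (PV 3);
     J3 10 (p_inst (PV 1)) (PV 3) (PV 4); J2 14 (PV 0) (PV 4);
     J3 10 (p_inst (PV 2)) (PV 3) (PV 5)]).
Definition cl_thm : clause := (J1 15 (PV 0), [J2 14 (PV 1) (PV 0); J1 13 (PV 1)]).

Definition prv_prog : list clause :=
  [ cl_term_var; cl_term_func; cl_vec_nil; cl_vec_cons; cl_form_fal; cl_form_atom; cl_form_equ;
    cl_form_bin 3; cl_form_bin 4; cl_form_bin 5; cl_form_quant 6; cl_form_quant 7;
    cl_ctx_nil; cl_ctx_cons; cl_shift_var; cl_inst_0; cl_inst_S; cl_up_0; cl_up_S;
    cl_sub_var; cl_sub_func; cl_sub_nil; cl_sub_cons; cl_sub_fal; cl_sub_atom; cl_sub_equ;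
    cl_sub_bin 3; cl_sub_bin 4; cl_sub_bin 5; cl_sub_quant 6; cl_sub_quant 7;
    cl_shift_nil; cl_shift_cons; cl_in_here; cl_in_next; cl_ax_nil; cl_ax_cons;
    cl_Ctx; cl_ImpI; cl_ImpE; cl_AndI; cl_AndE1; cl_AndE2; cl_OrI1; cl_OrI2; cl_OrE;
    cl_AllI; cl_AllE; cl_ExI; cl_ExE; cl_Explosion; cl_RAA; cl_EqRefl; cl_EqLeib; cl_thm ].

(** * Correctness of the provability program *)

Section ProvabilityProgram.
Variable L : lang.
Variable ef : funcs L -> nat.
Variable er : rels L -> nat.
Hypothesis ef_inj : forall f g, ef f = ef g -> f = g.
Hypothesis er_inj : forall r s, er r = er s -> r = s.
Variable Ax : theory L.

Definition symbols (tag : nat) (X : nat -> Prop) (c : nat) : Prop := exists m, c = cpair tag m /\ X m.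

Definition prv_base (c : nat) : Prop :=
  symbols 0 (fun n => exists f, n = cpair (ef f) (ar_f L f)) c \/
  symbols 1 (fun n => exists r, n = cpair (er r) (ar_r L r)) c \/
  symbols 2 (fun n => exists p, Ax p /\ n = code_form ef er p) c.

(** The invariant of the program. Judgements 7 to 12 are stated conditionally, for inputs that
    happen to be codes, because their clauses also fire on meaningless numbers: [cl_in_here], for
    instance, accepts any tail. *)
Definition judgement_spec (tag x : nat) : Prop :=
  match tag with
  | 0 => exists f, x = cpair (ef f) (ar_f L f)
  | 1 => exists r, x = cpair (er r) (ar_r L r)
  | 2 => exists p, Ax p /\ x = code_form ef er p
  | 3 => exists t, x = code_term ef t
  | 4 => exists v : Vector.t (term L) (pi1 x), pi2 x = code_vec ef v
  | 5 => exists p, x = code_form ef er p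
  | 6 => exists G, x = code_ctx ef er G
  | 7 => forall s, codes_subst ef s (pi1 x) -> pi2 (pi2 x) = code_term ef (s (pi1 (pi2 x)))
  | 8 => forall s t, codes_subst ef s (pi1 x) -> pi1 (pi2 x) = code_term ef t ->
           pi2 (pi2 x) = code_term ef (tsubst s t)
  | 9 => forall s k (v : Vector.t (term L) k), codes_subst ef s (pi1 x) ->
           pi1 (pi2 x) = code_vec ef v -> pi2 (pi2 x) = code_vec ef (Vector.map (tsubst s) v)
  | 10 => forall s p, codes_subst ef s (pi1 x) -> pi1 (pi2 x) = code_form ef er p ->
           pi2 (pi2 x) = code_form ef er (fsubst s p)
  | 11 => forall G, pi1 x = code_ctx ef er G -> pi2 x = code_ctx ef er (map (@shift L) G)
  | 12 => forall G, pi2 x = code_ctx ef er G -> exists p, pi1 x = code_form ef er p /\ In p G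
  | 13 => exists G, x = code_ctx ef er G /\ forall q, In q G -> Ax q
  | 14 => exists G p, pi1 x = code_ctx ef er G /\ pi2 x = code_form ef er p /\ prv G p
  | 15 => exists p, x = code_form ef er p /\ tprv Ax p
  | _ => True
  end.

Definition judgement (c : nat) : Prop := judgement_spec (pi1 c) (pi2 c).

Lemma judgement_cpair t x : judgement (cpair t x) = judgement_spec t x.
Proof. unfold judgement. now rewrite pi1_cpair, pi2_cpair. Qed.

Definition respects (X : nat -> Prop) (r : clause) : Prop :=
  forall e, Forall (fun q => X (pval e q)) (snd r) -> X (pval e (fst r)).

Ltac open_clause :=
  let H := fresh "H" in
  intros e H; simpl in H |- *;
  repeat (apply Forall_cons_iff in H; let h := fresh "P" in destruct H as [h H]; simpl in h); clear H;
  repeat match goal with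
  | P : judgement (cpair _ _) |- _ => rewrite judgement_cpair in P
  end;
  rewrite ?judgement_cpair; cbn [judgement_spec] in *;
  repeat match goal with
  | P : context [pi1 (cpair _ _)] |- _ => rewrite pi1_cpair in P
  | P : context [pi2 (cpair _ _)] |- _ => rewrite pi2_cpair in P
  | |- context [pi1 (cpair _ _)] => rewrite pi1_cpair
  | |- context [pi2 (cpair _ _)] => rewrite pi2_cpair
  end;
  (* No clause uses a variable beyond [PV 5], so these generalizations remove the environment
     altogether. *)
  generalize dependent (e 0); generalize dependent (e 1); generalize dependent (e 2);
  generalize dependent (e 3); generalize dependent (e 4); generalize dependent (e 5);
  clear e; intros.

Lemma code_form_cases (p : form L) tag x : cpair tag x = code_form ef er p ->
  match tag with
  | 0 => p = fal
  | 1 => exists r v, p = atom r v /\ x = cpair (er r) (code_vec ef v)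
  | 2 => exists a b, p = equ a b /\ x = cpair (code_term ef a) (code_term ef b)
  | 3 => exists a b, p = imp a b /\ x = cpair (code_form ef er a) (code_form ef er b)
  | 4 => exists a b, p = conj a b /\ x = cpair (code_form ef er a) (code_form ef er b)
  | 5 => exists a b, p = disj a b /\ x = cpair (code_form ef er a) (code_form ef er b)
  | 6 => exists a, p = all a /\ x = code_form ef er a
  | 7 => exists a, p = ex a /\ x = code_form ef er a
  | _ => False
  end.
Proof.
  destruct p; simpl; intros H; apply cpair_inj in H as [-> ->]; eauto.
Qed.

Lemma code_ctx_cons (G : list (form L)) x : S x = code_ctx ef er G ->
  exists p G', G = p :: G' /\ x = cpair (code_form ef er p) (code_ctx ef er G').
Proof. destruct G as [|p G]; simpl; intros H; [discriminate|]. injection H as ->. eauto. Qed.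

Lemma code_term_cases (t : term L) tag x : cpair tag x = code_term ef t ->
  match tag with
  | 0 => t = var x
  | 1 => exists f v, t = func f v /\ x = cpair (ef f) (code_vec ef v)
  | _ => False
  end.
Proof.
  destruct t as [n|f v]; rewrite ?code_term_func; intros H; apply cpair_inj in H as [-> ->]; eauto.
Qed.

(* Decomposes every object whose code has a known constructor, and instantiates the
   specifications of the substitution judgements. *)
Ltac decode :=
  repeat (match goal with
  | H : exists _, _ |- _ => destruct H
  | H : _ /\ _ |- _ => destruct H
  | H : cpair _ _ = cpair _ _ |- _ => apply cpair_inj in H
  | H : S _ = S _ |- _ => injection H as H
  | H : code_form ef er _ = code_form ef er _ |- _ => apply (code_form_inj ef er ef_inj er_inj) in H
  | H : code_term ef _ = code_term ef _ |- _ => apply (code_term_inj ef ef_inj) in H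
  | H : code_ctx ef er _ = code_ctx ef er _ |- _ => apply (code_ctx_inj ef er ef_inj er_inj) in H
  | H : ef _ = ef _ |- _ => apply ef_inj in H
  | H : er _ = er _ |- _ => apply er_inj in H
  | H : code_form _ _ _ = cpair _ _ |- _ => symmetry in H
  | H : cpair _ _ = code_form _ _ _ |- _ => apply code_form_cases in H; cbn iota in H
  | H : cpair _ _ = code_term _ _ |- _ => apply code_term_cases in H; cbn iota in H
  | H : S _ = code_ctx _ _ _ |- _ => apply code_ctx_cons in H
  | H : codes_subst ef _ (cpair _ _) |- _ => apply codes_subst_inv in H; cbn iota in H
  | H : ?x = code_ctx ef er _ |- _ => is_var x; subst x
  | H : ?x = code_form ef er _ |- _ => is_var x; subst x
  | H : ?x = code_term ef _ |- _ => is_var x; subst x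
  | H : forall s p, codes_subst ef s (cpair 0 0) -> code_form ef er _ = code_form ef er p -> _ |- _ =>
      specialize (H _ _ (codes_shift L ef) eq_refl)
  | H : forall s p, codes_subst ef s (cpair 1 (code_term ef ?t)) ->
          code_form ef er _ = code_form ef er p -> _ |- _ =>
      specialize (H _ _ (codes_inst ef t) eq_refl)
  | H : forall G, code_ctx ef er _ = code_ctx ef er G -> _ |- _ => specialize (H _ eq_refl)
  end; try subst).

Ltac fold_code :=
  repeat match goal with
  | |- context [cpair 0 0 = code_form _ _ _] =>
      change (cpair 0 0) with (code_form ef er (@fal L))
  | |- context [cpair 2 (cpair (code_term ef ?a) (code_term ef ?b))] =>
      change (cpair 2 (cpair (code_term ef a) (code_term ef b))) with (code_form ef er (equ a b))
  | |- context [cpair 3 (cpair (code_form ef er ?a) (code_form ef er ?b))] =>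
      change (cpair 3 (cpair (code_form ef er a) (code_form ef er b))) with (code_form ef er (imp a b))
  | |- context [cpair 4 (cpair (code_form ef er ?a) (code_form ef er ?b))] =>
      change (cpair 4 (cpair (code_form ef er a) (code_form ef er b))) with (code_form ef er (conj a b))
  | |- context [cpair 5 (cpair (code_form ef er ?a) (code_form ef er ?b))] =>
      change (cpair 5 (cpair (code_form ef er a) (code_form ef er b))) with (code_form ef er (disj a b))
  | |- context [cpair 6 (code_form ef er ?a)] =>
      change (cpair 6 (code_form ef er a)) with (code_form ef er (all a))
  | |- context [cpair 7 (code_form ef er ?a)] =>
      change (cpair 7 (code_form ef er a)) with (code_form ef er (ex a))
  end.

Ltac close_prv := fold_code; do 2 eexists; split; [reflexivity|split; [reflexivity|]].

(** Once the codes are decoded, each deduction clause is literally its constructor of [prv] and is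
    closed by [econstructor]. The cases left to treat one by one concern syntax, substitution, lists
    and the final passage to theorems. *)
Lemma prv_prog_sound : Forall (respects judgement) prv_prog.
Proof.
  unfold prv_prog. repeat apply Forall_cons; try apply Forall_nil; open_clause; decode;
    try (fold_code; eexists; reflexivity);
    try (close_prv; econstructor; eassumption).
  - exists (var n). reflexivity.
  - exists (func x x0). now rewrite code_term_func.
  - exists (Vector.nil _). reflexivity.
  - exists (Vector.cons _ x0 _ x). reflexivity.
  - exists (atom x x0). reflexivity.
  - exists []. reflexivity.
  - exists (x :: x0). reflexivity.
  - rewrite (P _ H1) in P0. exact (P0 _ _ (codes_shift L ef) eq_refl).
  - now apply P.
  - simpl tsubst. rewrite code_term_func. now rewrite (P _ _ _ H1 eq_refl).
  - destruct v; [reflexivity|discriminate].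
  - destruct v as [|t k v]; [discriminate|]. injection H1 as H1. apply cpair_inj in H1 as [-> ->].
    simpl. now rewrite (P _ _ H0 eq_refl), (P0 _ _ _ H0 eq_refl).
  - simpl. now rewrite (P _ _ _ H1 eq_refl).
  - simpl. now rewrite (P _ _ H0 eq_refl), (P0 _ _ H0 eq_refl).
  - simpl. now rewrite (P _ _ H0 eq_refl), (P0 _ _ H0 eq_refl).
  - simpl. now rewrite (P _ _ H0 eq_refl), (P0 _ _ H0 eq_refl).
  - simpl. now rewrite (P _ _ H0 eq_refl), (P0 _ _ H0 eq_refl).
  - simpl. now rewrite (P _ _ (codes_up H2) eq_refl).
  - simpl. now rewrite (P _ _ (codes_up H2) eq_refl).
  - destruct G; [reflexivity|discriminate].
  - exists x. split; [reflexivity|now left].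
  - exists x1. split; [reflexivity|now right].
  - exists []. split; [reflexivity|intros q []].
  - exists (x :: x0). split; [reflexivity|]. intros q [<-|Hq]; auto.
  - exists x0. split; [reflexivity|]. exists x1. now split.
Qed.

Notation D := (derivable prv_prog prv_base).

Lemma derivable_sound c : D c -> judgement c.
Proof.
  induction 1 as [c [[m [-> H]]|[[m [-> H]]|[m [-> H]]]]|r e Hr Hp IH].
  - now rewrite judgement_cpair.
  - now rewrite judgement_cpair.
  - now rewrite judgement_cpair.
  - pose proof prv_prog_sound as Hs. rewrite Forall_forall in Hs.
    apply (Hs r Hr). now apply Forall_forall.
Qed.

Lemma derivable_respects r e : In r prv_prog ->
  Forall (fun q => D (pval e q)) (snd r) -> D (pval e (fst r)).
Proof. intros Hr H. apply derivable_clause; [trivial|]. now apply Forall_forall. Qed.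

Ltac in_prog := unfold prv_prog; repeat (first [left; reflexivity | right]).

(* [rule cl l] applies the clause [cl], the values of its variables being listed in [l]. *)
Ltac rule cl l :=
  refine (@derivable_respects cl (fun i => nth i l 0) ltac:(in_prog) _);
  repeat apply Forall_cons; try apply Forall_nil; simpl.

Lemma derivable_vec k (v : Vector.t (term L) k) :
  Vector.Forall (fun t => D (cpair 3 (code_term ef t))) v -> D (cpair 4 (cpair k (code_vec ef v))).
Proof.
  induction 1 as [|k t v Ht Hv IH].
  - rule cl_vec_nil (@nil nat).
  - rule cl_vec_cons [k; code_term ef t; code_vec ef v]; trivial.
Qed.

Lemma derivable_term t : D (cpair 3 (code_term ef t)).
Proof.
  induction t as [n|f v IH] using term_nested_ind.
  - rule cl_term_var [n].
  - rewrite code_term_func. rule cl_term_func [ef f; code_vec ef v; ar_f L f].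
    + apply derivable_base. left. exists (cpair (ef f) (ar_f L f)). eauto.
    + now apply derivable_vec.
Qed.

Lemma derivable_form p : D (cpair 5 (code_form ef er p)).
Proof.
  induction p as [|r v|a b|a IHa b IHb|a IHa b IHb|a IHa b IHb|a IHa|a IHa]; simpl.
  - rule cl_form_fal (@nil nat).
  - rule cl_form_atom [er r; code_vec ef v; ar_r L r].
    + apply derivable_base. right; left. exists (cpair (er r) (ar_r L r)). eauto.
    + apply derivable_vec. apply Vector.Forall_forall. intros; apply derivable_term.
  - rule cl_form_equ [code_term ef a; code_term ef b]; apply derivable_term.
  - rule (cl_form_bin 3) [code_form ef er a; code_form ef er b]; trivial.
  - rule (cl_form_bin 4) [code_form ef er a; code_form ef er b]; trivial.
  - rule (cl_form_bin 5) [code_form ef er a; code_form ef er b]; trivial.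
  - rule (cl_form_quant 6) [code_form ef er a]; trivial.
  - rule (cl_form_quant 7) [code_form ef er a]; trivial.
Qed.

Lemma derivable_ctx G : D (cpair 6 (code_ctx ef er G)).
Proof.
  induction G as [|p G IH]; simpl.
  - rule cl_ctx_nil (@nil nat).
  - rule cl_ctx_cons [code_form ef er p; code_ctx ef er G]; [apply derivable_form|trivial].
Qed.

Lemma derivable_tsubst_vec s c k (v : Vector.t (term L) k) :
  Vector.Forall (fun t => D (cpair 8 (cpair c (cpair (code_term ef t) (code_term ef (tsubst s t)))))) v ->
  D (cpair 9 (cpair c (cpair (code_vec ef v) (code_vec ef (Vector.map (tsubst s) v))))).
Proof.
  induction 1 as [|k t v Ht Hv IH]; simpl.
  - rule cl_sub_nil [c].
  - rule cl_sub_cons [c; code_term ef t; code_vec ef v; code_term ef (tsubst s t);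
                      code_vec ef (Vector.map (tsubst s) v)]; trivial.
Qed.

Lemma derivable_tsubst s c :
  (forall n, D (cpair 7 (cpair c (cpair n (code_term ef (s n)))))) ->
  forall t, D (cpair 8 (cpair c (cpair (code_term ef t) (code_term ef (tsubst s t))))).
Proof.
  intros H. induction t as [n|f v IH] using term_nested_ind.
  - rule cl_sub_var [c; n; code_term ef (s n)]. apply H.
  - simpl tsubst. rewrite !code_term_func.
    rule cl_sub_func [c; ef f; code_vec ef v; code_vec ef (Vector.map (tsubst s) v)].
    now apply derivable_tsubst_vec.
Qed.

Lemma derivable_subst_var s c : codes_subst ef s c ->
  forall n, D (cpair 7 (cpair c (cpair n (code_term ef (s n))))).
Proof.
  induction 1 as [|t|s c H IH]; intros n.
  - rule cl_shift_var [n].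
  - destruct n as [|n].
    + rule cl_inst_0 [code_term ef t].
    + rule cl_inst_S [code_term ef t; n].
  - destruct n as [|n].
    + rule cl_up_0 [c].
    + rule cl_up_S [c; n; code_term ef (s n); code_term ef (up s (S n))]; [apply IH|].
      apply (@derivable_tsubst (fun k => var (S k))). intros m. rule cl_shift_var [m].
Qed.

Lemma derivable_fsubst p : forall s c, codes_subst ef s c ->
  D (cpair 10 (cpair c (cpair (code_form ef er p) (code_form ef er (fsubst s p))))).
Proof.
  induction p as [|r v|a b|a IHa b IHb|a IHa b IHb|a IHa b IHb|a IHa|a IHa]; intros s c Hs; simpl.
  - rule cl_sub_fal [c].
  - rule cl_sub_atom [c; er r; code_vec ef v; code_vec ef (Vector.map (tsubst s) v)].
    apply derivable_tsubst_vec. apply Vector.Forall_forall. intros t _.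
    now apply derivable_tsubst, derivable_subst_var.
  - rule cl_sub_equ [c; code_term ef a; code_term ef b; code_term ef (tsubst s a); code_term ef (tsubst s b)];
      now apply derivable_tsubst, derivable_subst_var.
  - rule (cl_sub_bin 3) [c; code_form ef er a; code_form ef er b;
      code_form ef er (fsubst s a); code_form ef er (fsubst s b)]; auto.
  - rule (cl_sub_bin 4) [c; code_form ef er a; code_form ef er b;
      code_form ef er (fsubst s a); code_form ef er (fsubst s b)]; auto.
  - rule (cl_sub_bin 5) [c; code_form ef er a; code_form ef er b;
      code_form ef er (fsubst s a); code_form ef er (fsubst s b)]; auto.
  - rule (cl_sub_quant 6) [c; code_form ef er a; code_form ef er (fsubst (up s) a)].
    apply IHa. now constructor.
  - rule (cl_sub_quant 7) [c; code_form ef er a; code_form ef er (fsubst (up s) a)].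
    apply IHa. now constructor.
Qed.

Lemma derivable_shift G :
  D (cpair 11 (cpair (code_ctx ef er G) (code_ctx ef er (map (@shift L) G)))).
Proof.
  induction G as [|p G IH]; simpl.
  - rule cl_shift_nil (@nil nat).
  - rule cl_shift_cons [code_form ef er p; code_ctx ef er G; code_form ef er (shift p);
                        code_ctx ef er (map (@shift L) G)]; [|trivial].
    apply derivable_fsubst. constructor.
Qed.

Lemma derivable_in p G : In p G -> D (cpair 12 (cpair (code_form ef er p) (code_ctx ef er G))).
Proof.
  induction G as [|q G IH]; [intros []|]; intros [->|H]; simpl.
  - rule cl_in_here [code_form ef er p; code_ctx ef er G].
  - rule cl_in_next [code_form ef er p; code_ctx ef er G; code_form ef er q]. auto.
Qed.

Lemma derivable_axioms G : (forall q, In q G -> Ax q) -> D (cpair 13 (code_ctx ef er G)).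
Proof.
  induction G as [|p G IH]; intros H; simpl.
  - rule cl_ax_nil (@nil nat).
  - rule cl_ax_cons [code_form ef er p; code_ctx ef er G].
    + apply derivable_base. right; right. exists (code_form ef er p). split; [trivial|].
      exists p. split; [apply H; now left|trivial].
    + apply IH. intros; apply H; now right.
Qed.

Lemma derivable_prv G p : prv G p -> D (cpair 14 (cpair (code_ctx ef er G) (code_form ef er p))).
Proof.
  pose (F := code_form ef er). pose (C := code_ctx ef er).
  induction 1; simpl in *.
  - rule cl_Ctx [C G; F p]; [apply derivable_ctx|now apply derivable_in].
  - rule cl_ImpI [C G; F p; F q]. trivial.
  - rule cl_ImpE [C G; F p; F q]; trivial.
  - rule cl_AndI [C G; F p; F q]; trivial.
  - rule cl_AndE1 [C G; F p; F q]; trivial.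
  - rule cl_AndE2 [C G; F p; F q]; trivial.
  - rule cl_OrI1 [C G; F p; F q]; [trivial|apply derivable_form].
  - rule cl_OrI2 [C G; F p; F q]; [trivial|apply derivable_form].
  - rule cl_OrE [C G; F p; F q; F r]; trivial.
  - rule cl_AllI [C G; F p; C (map (@shift L) G)];
      [apply derivable_ctx|apply derivable_shift|trivial].
  - rule cl_AllE [C G; F p; code_term ef t; F (inst t p)];
      [trivial|apply derivable_term|apply derivable_fsubst; constructor].
  - rule cl_ExI [C G; F p; code_term ef t; F (inst t p)];
      [apply derivable_form|apply derivable_term|apply derivable_fsubst; constructor|trivial].
  - rule cl_ExE [C G; F p; F q; C (map (@shift L) G); F (shift q)];
      [trivial|apply derivable_form|apply derivable_shift|apply derivable_fsubst; constructor|trivial].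
  - rule cl_Explosion [C G; F p]; [trivial|apply derivable_form].
  - rule cl_RAA [C G; F p]. trivial.
  - rule cl_EqRefl [C G; code_term ef t]; [apply derivable_ctx|apply derivable_term].
  - rule cl_EqLeib [C G; code_term ef s; code_term ef t; F p; F (inst s p); F (inst t p)];
      [trivial|apply derivable_form|apply derivable_fsubst; constructor|trivial
      |apply derivable_fsubst; constructor].
Qed.

Lemma derivable_theorem p : D (cpair 15 (code_form ef er p)) <-> tprv Ax p.
Proof.
  split.
  - intros H. apply derivable_sound in H. rewrite judgement_cpair in H.
    destruct H as [q [E Hq]]. apply (code_form_inj ef er ef_inj er_inj) in E. now subst.
  - intros [G [HG Hp]]. rule cl_thm [code_form ef er p; code_ctx ef er G].
    + now apply derivable_prv.
    + now apply derivable_axioms.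
Qed.

End ProvabilityProgram.

Lemma Sig_symbols tag X : Sig (fun e => X (e 0)) -> Sig (fun e => symbols tag X (e 0)).
Proof.
  intros H. apply (@Sig_ex (fun m e => e 0 = cpair tag m /\ X m)). apply Sig_and.
  - apply Sig_eq; [apply Sigf_var|apply Sigf_cpair; [apply Sigf_const|apply Sigf_var]].
  - exact H.
Qed.

(** The symbol tables and the axioms supply the Sigma_1 base facts of the program; theorems are then
    read off at tag 15. *)
Lemma Sig_theorems (L : lang) (ef : funcs L -> nat) (er : rels L -> nat) (Ax : theory L) :
  rec_presentation L ef er ->
  recursive_set (fun n => exists p, Ax p /\ n = code_form ef er p) ->
  exists Th : nat -> Prop, Sig (fun e => Th (e 0)) /\
    forall p, Th (code_form ef er p) <-> tprv Ax p.
Proof.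
  intros [Hf [Hr [Rf Rr]]] Ra.
  exists (fun n => derivable prv_prog (prv_base ef er Ax) (cpair 15 n)). split.
  - apply (@Sig_rel1 (derivable prv_prog (prv_base ef er Ax)) (fun e => cpair 15 (e 0)));
      [|apply Sigf_cpair; [apply Sigf_const|apply Sigf_var]].
    apply Sig_derivable. apply Sig_or; [|apply Sig_or]; apply Sig_symbols.
    + exact (proj1 (recursive_set_Sig Rf)).
    + exact (proj1 (recursive_set_Sig Rr)).
    + exact (proj1 (recursive_set_Sig Ra)).
  - intros p. now apply derivable_theorem.
Qed.

(** * [U_AB A B] is r.e. and satisfies G1 *)

Lemma Sigf_iter (h : nat -> nat) (c : nat) f :
  Sigf (fun e => h (e 0)) -> Sigf f -> Sigf (fun e => Nat.iter (f e) h c).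
Proof.
  intros Hh. apply (@Sigf_fun1 (fun n => Nat.iter n h c)). unfold Sigf.
  apply Sig_iff with (fun e => exists a b, beta a b 0 = c /\ e 0 = beta a b (e 1) /\
    forall i, i < e 1 -> beta a b (S i) = h (beta a b i)).
  - intros e. split.
    + intros [a [b [H1 [H2 H3]]]]. rewrite H2. clear H2.
      induction (e 1) as [|n IH]; [trivial|]. simpl. rewrite H3 by lia. f_equal.
      apply IH. intros; apply H3; lia.
    + intros H. destruct (beta_exists (fun i => Nat.iter i h c) (S (e 1))) as [a [b Hab]].
      exists a, b. rewrite !Hab by lia. repeat split; [trivial|].
      intros i Hi. now rewrite !Hab by lia.
  - apply Sig_ex.
    apply (@Sig_ex (fun b e => beta (e 0) b 0 = c /\ e 1 = beta (e 0) b (e 2) /\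
      forall i, i < e 2 -> beta (e 0) b (S i) = h (beta (e 0) b i))).
    apply Sig_and; [|apply Sig_and].
    + apply Sig_eq; [|apply Sigf_const].
      apply Sigf_beta; [apply Sigf_var|apply Sigf_var|apply Sigf_const].
    + apply Sig_eq; [apply Sigf_var|apply Sigf_beta; apply Sigf_var].
    + apply Sig_ball; [apply Sigf_var|]. apply Sig_eq.
      * apply Sigf_beta; [apply Sigf_var|apply Sigf_var|apply Sigf_S, Sigf_var].
      * apply Sigf_fun1; [trivial|]. apply Sigf_beta; apply Sigf_var.
Qed.

Ltac sigf := repeat first [apply Sigf_cpair|apply Sigf_const|apply Sigf_S|apply Sigf_var].

Lemma numU_closed n : tbound 0 (numU n).
Proof. induction n as [|n IH]; simpl; auto. Qed.

Section TranslatedNumerals.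
Variable L : lang.
Variable I : interp LU L.
Hypothesis I_wf : interp_wf I.
Variable ef : funcs L -> nat.
Variable er : rels L -> nat.

(** The offset acts on source variables only, and a numeral has none. Without it, the translation of
    numerals is the iteration of one operation on formulas. *)
Lemma tr_term_numU n : forall off,
  tr_term I off 0 (numU n) = tr_term I 0 0 (numU n).
Proof.
  induction n as [|n IH]; intros off; [reflexivity|].
  cbn [numU Nat.iter]. simpl. fold (numU n). now rewrite (IH (off + 1)), (IH 1).
Qed.

Lemma tr_term_numU_bound n : fbound 1 (tr_term I 0 0 (numU n)).
Proof.
  destruct I_wf as [Hd [Hr Hf]].
  induction n as [|n IH].
  - simpl. repeat split.
    eapply fbound_fsubst; [|apply (Hf fU_zero)]. intros k Hk. simpl. lia.
  - cbn [numU Nat.iter]. simpl. fold (numU n). rewrite tr_term_numU. repeat split.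
    + apply fbound_mono with 1; [lia|trivial].
    + eapply fbound_fsubst; [|exact Hd]. intros; simpl; lia.
    + eapply fbound_fsubst; [|apply (Hf fU_succ)]. intros k Hk.
      destruct (k <? 1) eqn:E; simpl; [apply Nat.ltb_lt in E|]; lia.
Qed.

(** [complete] decides sentences only, so this is what makes it applicable to the translated
    atoms. *)
Lemma tr_PU_sentence n : sentence (tr I (PU (numU n))).
Proof.
  destruct I_wf as [Hd [Hr Hf]]. unfold sentence. simpl. rewrite tr_term_numU. repeat split.
  - apply tr_term_numU_bound.
  - eapply fbound_fsubst; [|exact Hd]. intros; simpl; lia.
  - apply (Hr tt).
Qed.

Lemma Sigf_tr_PU : Sigf (fun e => code_form ef er (tr I (PU (numU (e 0))))).
Proof.
  pose (ct := code_form ef er (ttrue L)).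
  pose (K := code_form ef er (conj (doms I 1)
         (fsubst (fun j => if j <? 1 then var j else var (0 + 1)) (ifun I fU_succ)))).
  pose (K' := code_form ef er (conj (doms I 1) (irel I tt))).
  (* On codes, [h K] wraps one successor around a translated numeral: an [ex] (tag 7) over a [conj]
     (tag 4) of the argument list, which is [x] closed by [ttrue], and the fixed rest [K]. The atom
     has the same shape with [K']. *)
  pose (h K x := cpair 7 (cpair 4 (cpair (cpair 4 (cpair x ct)) K))).
  pose (c0 := code_form ef er (tr_term I 0 0 (numU 0))).
  assert (E : forall n, code_form ef er (tr_term I 0 0 (numU n)) = Nat.iter n (h K) c0).
  { induction n as [|n IH]; [reflexivity|]. rewrite Nat.iter_succ, <- IH.
    cbn [numU Nat.iter]. simpl. fold (numU n). rewrite (tr_term_numU n 1). reflexivity. }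
  apply Sigf_iff with (fun e => h K' (Nat.iter (e 0) (h K) c0)).
  - intros e. rewrite <- E. simpl. rewrite (tr_term_numU (e 0) 1). reflexivity.
  - apply (@Sigf_fun1 (h K')); [unfold h; sigf|].
    apply Sigf_iter; [unfold h; sigf|apply Sigf_var].
Qed.

End TranslatedNumerals.

Lemma tprv_ax (L : lang) (T : theory L) p : T p -> tprv T p.
Proof.
  intros H. exists [p]. split; [|apply Ctx; now left]. intros q [<-|[]]. trivial.
Qed.

Lemma PU_sentence n : sentence (PU (numU n)).
Proof. unfold sentence, PU. simpl. constructor; [apply numU_closed|constructor]. Qed.

Lemma U_AB_sentences A B : axioms_are_sentences (U_AB A B).
Proof.
  intros p [m n H|n H|n H]; unfold sentence, neg; simpl fbound.
  - repeat split; apply numU_closed.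
  - apply PU_sentence.
  - split; [apply PU_sentence|trivial].
Qed.

Theorem U_AB_G1 (A B : nat -> Prop) : rec_inseparable A B -> G1 (U_AB A B).
Proof.
  intros [_ [_ [_ Hins]]] L T [_ [ef [er [Hpres [Ax [_ [Hrec Heq]]]]]]] Hcons [I [Hwf HI]] Hcompl.
  destruct (Sig_theorems _ Hpres Hrec) as [Th [HTh HTh']].
  assert (HU : forall p, U_AB A B p -> tprv T (tr I p)).
  { intros p Hp. apply HI; [now apply (@U_AB_sentences A B)|now apply tprv_ax]. }
  assert (Hc : forall p, tprv T (neg p) -> tprv T p -> False).
  { intros p H1 H2. apply Hcons. exact (tprv_mp H1 H2). }
  apply Hins. exists (fun n => tprv T (tr I (PU (numU n)))). split; [|split].
  - apply Sig_recursive_set.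
    + apply Sig_iff with (fun e => Th (code_form ef er (tr I (PU (numU (e 0)))))).
      * intros e. now rewrite HTh', Heq.
      * apply Sig_rel1; [trivial|apply Sigf_tr_PU].
    (* Completeness and consistency turn unprovability of the translated atom into provability of
       its negation, which is again Sigma_1. *)
    + apply Sig_iff with (fun e => Th (code_form ef er (neg (tr I (PU (numU (e 0))))))).
      * intros e. rewrite HTh', <- Heq. split.
        -- intros H1 H2. exact (Hc _ H1 H2).
        -- intros H. destruct (Hcompl _ (tr_PU_sentence Hwf (e 0))); [contradiction|trivial].
      * apply Sig_rel1; [trivial|].
        apply (@Sigf_fun1 (fun x => cpair 3 (cpair x (cpair 0 0)))); [sigf|apply Sigf_tr_PU].
  - intros n Hn. apply HU. now constructor.
  - intros n H Hn. apply (Hc (tr I (PU (numU n)))); [|trivial].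
    apply (HU (neg (PU (numU n)))). now constructor.
Qed.

Definition efU (f : fU) : nat := match f with fU_zero => 0 | fU_succ => 1 end.
Definition erU (_ : unit) : nat := 0.

Lemma finite_recursive_set (l : list nat) : recursive_set (fun n => In n l).
Proof.
  apply Sig_recursive_set; induction l as [|a l IH]; simpl.
  - apply Sig_const.
  - apply Sig_or; [|trivial]. apply Sig_eq; [apply Sigf_const|apply Sigf_var].
  - apply Sig_const.
  - apply Sig_iff with (fun e => (a < e 0 \/ e 0 < a) /\ ~ In (e 0) l).
    + intros e. split.
      * intros [H1 H2] [H|H]; [lia|tauto].
      * intros H. split; [|tauto]. destruct (Nat.lt_trichotomy a (e 0)) as [?|[?|?]]; tauto.
    + apply Sig_and; [|trivial]. apply Sig_or; apply Sig_lt; sigf.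
Qed.

Lemma recursive_set_iff (X Y : nat -> Prop) :
  (forall n, X n <-> Y n) -> recursive_set X -> recursive_set Y.
Proof. intros H [c Hc]. exists c. intros n. rewrite <- H. apply Hc. Qed.

Lemma LU_presentation : rec_presentation LU efU erU.
Proof.
  split; [|split; [|split]].
  - intros [|] [|]; simpl; congruence.
  - intros [] []; trivial.
  - apply recursive_set_iff with (fun n => In n [cpair 0 0; cpair 1 1]); [|apply finite_recursive_set].
    intros n. simpl. split.
    + intros [<-|[<-|[]]]; [now exists fU_zero|now exists fU_succ].
    + intros [[|] ->]; simpl; auto.
  - apply recursive_set_iff with (fun n => In n [cpair 0 1]); [|apply finite_recursive_set].
    intros n. simpl. split.
    + intros [<-|[]]. now exists tt.
    + intros [[] ->]; auto.
Qed.

Lemma Sigf_code_numU f : Sigf f -> Sigf (fun e => @code_term LU efU (numU (f e))).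
Proof.
  intros Hf. pose (h x := cpair 1 (cpair 1 (S (cpair x 0)))).
  apply Sigf_iff with (fun e => Nat.iter (f e) h (@code_term LU efU (numU 0))).
  - intros e. induction (f e) as [|n IH]; [reflexivity|].
    rewrite Nat.iter_succ, IH. reflexivity.
  - apply Sigf_iter; [unfold h; sigf|trivial].
Qed.

Theorem U_AB_re (A B : nat -> Prop) : re_set A -> re_set B -> re_theory (U_AB A B).
Proof.
  intros HA HB. split; [apply U_AB_sentences|].
  exists efU, erU. split; [apply LU_presentation|]. apply Sig_re_set.
  pose (F := @code_form LU efU erU).
  apply Sig_iff with (fun e =>
    (exists m n, (m < n \/ n < m) /\ e 0 = F (neg (equ (numU m) (numU n)))) \/
    (exists n, A n /\ e 0 = F (PU (numU n))) \/
    (exists n, B n /\ e 0 = F (neg (PU (numU n))))).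
  - intros e. split.
    + intros [[m [n [H ->]]]|[[n [H ->]]|[n [H ->]]]];
        (eexists; split; [|reflexivity]); constructor; trivial; lia.
    + intros [p [[m n H|n H|n H] ->]].
      * left. exists m, n. split; [lia|reflexivity].
      * right; left. now exists n.
      * right; right. now exists n.
  - assert (HP : Sigf (fun e => F (PU (numU (e 0))))).
    { apply (@Sigf_fun1 (fun x => cpair 1 (cpair 0 (S (cpair x 0))))); [sigf|].
      apply Sigf_code_numU, Sigf_var. }
    apply Sig_or; [|apply Sig_or].
    + apply Sig_ex.
      apply (@Sig_ex (fun n e => (e 0 < n \/ n < e 0) /\ e 1 = F (neg (equ (numU (e 0)) (numU n))))).
      apply Sig_and; [apply Sig_or; apply Sig_lt; sigf|]. apply Sig_eq; [sigf|].
      change (Sigf (fun e => cpair 3 (cpair (cpair 2 (cpair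
        (@code_term LU efU (numU (e 1))) (@code_term LU efU (numU (e 0))))) (cpair 0 0)))).
      sigf; apply Sigf_code_numU, Sigf_var.
    + apply Sig_ex, Sig_and; [now apply re_set_Sig|]. apply Sig_eq; [sigf|exact HP].
    + apply Sig_ex, Sig_and; [now apply re_set_Sig|]. apply Sig_eq; [sigf|].
      change (Sigf (fun e => cpair 3 (cpair (F (PU (numU (e 0)))) (cpair 0 0)))).
      sigf; apply Sigf_code_numU, Sigf_var.
Qed.

(** * Models of [R_ax] and the Rosser formula *)

Definition efR (f : fR) : nat :=
  match f with fR_zero => 0 | fR_succ => 1 | fR_plus => 2 | fR_times => 3 end.

Lemma numR_closed n : tbound 0 (numR n).
Proof. induction n as [|n IH]; simpl; auto. Qed.

Lemma numR_bound k n : tbound k (numR n).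
Proof. apply tbound_mono with 0; [lia|apply numR_closed]. Qed.

Lemma disj_upto_bound n : fbound 1 (disj_upto n).
Proof.
  induction n as [|n IH]; simpl; repeat split; auto; try lia; apply (numR_bound 1 (S n)).
Qed.

Lemma R_ax_sentences : axioms_are_sentences R_ax.
Proof.
  intros p [m n|m n|m n H|n|n]; unfold sentence, leR; simpl;
    repeat split; auto using numR_closed, disj_upto_bound;
    repeat apply Vector.Forall_cons; try apply Vector.Forall_nil; simpl; auto using numR_bound.
Qed.

Lemma R_complete p :
  (forall (M : structure LR) (rho : nat -> M), (forall q, R_ax q -> sat M rho q) -> sat M rho p) ->
  tprv R_ax p.
Proof.
  (* The enumeration of formulas inverts the injective coding by choice; numbers that are not codes
     give arbitrary formulas. *)
  apply (@completeness LR (fun n => epsilon (inhabits fal) (fun q => @code_form LR efR erU q = n))).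
  - intros q. exists (@code_form LR efR erU q).
    apply (@code_form_inj LR efR erU).
    + intros [| | |] [| | |]; simpl; congruence.
    + intros [] []; trivial.
    + apply (epsilon_spec (inhabits fal) (fun q' => @code_form LR efR erU q' = @code_form LR efR erU q)).
      now exists q.
  - apply R_ax_sentences.
Qed.

Fixpoint ptR (t : pt) : term LR :=
  match t with
  | pv n => var n
  | pz => numR 0
  | ps s => @func LR fR_succ (Vector.cons _ (ptR s) 0 (Vector.nil _))
  | pa s u => plusR (ptR s) (ptR u)
  | pm s u => timesR (ptR s) (ptR u)
  end.

Fixpoint dR (d : d0) : form LR :=
  match d with
  | deq s t => equ (ptR s) (ptR t)
  | dfal => fal
  | dimp a b => imp (dR a) (dR b)
  | dall t a => all (imp (leR (var 0) (tsubst (fun k => var (S k)) (ptR t))) (dR a))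
  end.

Section ModelsOfR.
Variable M : structure LR.
Variable rho0 : nat -> M.
Hypothesis M_R : forall q, R_ax q -> sat M rho0 q.

Definition succM (x : M) : M := fint M fR_succ (Vector.cons _ x 0 (Vector.nil _)).
Definition num (n : nat) : M := Nat.iter n succM (fint M fR_zero (Vector.nil _)).
Definition leM (x y : M) : Prop := rint M tt (Vector.cons _ x 1 (Vector.cons _ y 0 (Vector.nil _))).

Lemma eval_numR rho n : eval M rho (numR n) = num n.
Proof. induction n as [|n IH]; [reflexivity|]. simpl. now rewrite IH. Qed.

Lemma num_plus m n :
  fint M fR_plus (Vector.cons _ (num m) 1 (Vector.cons _ (num n) 0 (Vector.nil _))) = num (m + n).
Proof. pose proof (M_R (R1 m n)) as H. simpl in H. now rewrite !eval_numR in H. Qed.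

Lemma num_times m n :
  fint M fR_times (Vector.cons _ (num m) 1 (Vector.cons _ (num n) 0 (Vector.nil _))) = num (m * n).
Proof. pose proof (M_R (R2 m n)) as H. simpl in H. now rewrite !eval_numR in H. Qed.

Lemma num_inj m n : num m = num n -> m = n.
Proof.
  intros E. destruct (Nat.eq_dec m n) as [|Hn]; [trivial|exfalso].
  pose proof (M_R (R3 Hn)) as H. simpl in H. rewrite !eval_numR in H. auto.
Qed.

Lemma le_num_standard x n : leM x (num n) -> exists m, m <= n /\ x = num m.
Proof.
  intros Hx. pose proof (M_R (R4 n) x) as H. simpl in H. rewrite eval_numR in H.
  specialize (H Hx). clear Hx. revert H. induction n as [|n IH]; simpl.
  - intros ->. now exists 0.
  - intros [H|H].
    + destruct (IH H) as [m [Hm ->]]. exists m. split; [lia|trivial].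
    + exists (S n). split; [trivial|]. rewrite H, eval_numR. reflexivity.
Qed.

Lemma le_num_total x n : leM x (num n) \/ leM (num n) x.
Proof. pose proof (M_R (R5 n) x) as H. simpl in H. now rewrite !eval_numR in H. Qed.

Lemma le_num m n : leM (num m) (num n) <-> m <= n.
Proof.
  split.
  - intros H. destruct (le_num_standard _ _ H) as [k [Hk E]]. apply num_inj in E. lia.
  - intros Hmn. destruct (le_num_total (num m) n) as [|H]; [trivial|].
    destruct (le_num_standard _ _ H) as [k [Hk E]]. apply num_inj in E.
    assert (m = n) as -> by lia. trivial.
Qed.

Lemma eval_ptR e t : eval M (fun n => num (e n)) (ptR t) = num (ptv e t).
Proof.
  induction t as [n| |t IH|t IHt u IHu|t IHt u IHu]; simpl; trivial.
  - now rewrite IH.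
  - now rewrite IHt, IHu, num_plus.
  - now rewrite IHt, IHu, num_times.
Qed.

Lemma scons_num x (e : env) : scons (num x) (fun n => num (e n)) = fun n => num (scons x e n).
Proof. extensionality n. now destruct n. Qed.

(** Absoluteness of bounded formulas: by [R4] a quantifier bounded by a numeral ranges over numerals
    only, even if [M] has nonstandard elements. *)
Lemma sat_dR d : forall e, sat M (fun n => num (e n)) (dR d) <-> holds e d.
Proof.
  induction d as [s t| |a IHa b IHb|t a IHa]; intros e; simpl.
  - rewrite !eval_ptR. split; [apply num_inj|congruence].
  - tauto.
  - now rewrite IHa, IHb.
  - assert (E : forall x, eval M (scons x (fun n => num (e n))) (tsubst (fun k => var (S k)) (ptR t))
                     = num (ptv e t)).
    { intros x. rewrite eval_tsubst. apply eval_ptR. }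
    split.
    + intros H x Hx. apply IHa. rewrite <- scons_num. apply H. rewrite E. now apply le_num.
    + intros H x Hx. rewrite E in Hx. destruct (le_num_standard _ _ Hx) as [m [Hm ->]].
      rewrite scons_num. apply IHa. now apply H.
Qed.

End ModelsOfR.

Section Rosser.
Variables dA dB : d0.

(** Variable 0 is the witness and [i] the de Bruijn index of the input, 1 or 2 according to the
    quantifiers passed in [rosser]. All further variables become 0, in accordance with the
    environment [scons w (scons n (fun _ => 0))]. *)
Definition witness_form (i : nat) (d : d0) : form LR :=
  fsubst (fun n => match n with 0 => var 0 | 1 => var i | _ => numR 0 end) (dR d).

Definition rosser : form LR :=
  ex (conj (witness_form 1 dA) (all (imp (leR (var 0) (var 1)) (neg (witness_form 2 dB))))).

Lemma witness_form_bound i d : 0 < i -> fbound (S i) (witness_form i d).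
Proof.
  intros Hi. destruct (fbound_exists (dR d)) as [k Hk].
  eapply fbound_fsubst; [|exact Hk]. intros [|[|n]] _; simpl; trivial; lia.
Qed.

Lemma rosser_bound : fbound 1 rosser.
Proof.
  simpl. repeat split; try (apply witness_form_bound; lia).
  repeat apply Vector.Forall_cons; simpl; try lia. apply Vector.Forall_nil.
Qed.

Variable M : structure LR.
Variable rho0 : nat -> M.
Hypothesis M_R : forall q, R_ax q -> sat M rho0 q.

Lemma sat_witness_form rho i d w n :
  rho 0 = num M w -> rho i = num M n ->
  sat M rho (witness_form i d) <-> holds (scons w (scons n (fun _ => 0))) d.
Proof.
  intros Hw Hn. unfold witness_form. rewrite sat_fsubst.
  rewrite <- (sat_dR _ _ M_R). replace (fun k => eval M rho _) with
    (fun k => num M (scons w (scons n (fun _ => 0)) k)); [reflexivity|].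
  extensionality k. destruct k as [|[|k]]; simpl; auto.
Qed.

(** The witness is standard, so by [R4] every [v] below it is a numeral, and no numeral is a witness
    for [B]. *)
Lemma rosser_holds n w rho :
  holds (scons w (scons n (fun _ => 0))) dA ->
  (forall v, ~ holds (scons v (scons n (fun _ => 0))) dB) ->
  rho 0 = num M n -> sat M rho rosser.
Proof.
  intros HA HB Hr. exists (num M w). split.
  - now apply (@sat_witness_form _ _ _ w n).
  - intros v Hv. simpl in Hv. destruct (le_num_standard _ _ M_R _ _ Hv) as [m [_ ->]].
    intros H. apply (@sat_witness_form _ _ _ m n) in H; trivial. now apply (HB m).
Qed.

(** The alleged witness [w] may be nonstandard, but [R5] compares it with the numeral of [v]. If [w]
    is below, it is standard and would put [n] in [A]; otherwise [v] itself violates the bounded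
    clause. *)
Lemma rosser_fails n v rho :
  holds (scons v (scons n (fun _ => 0))) dB ->
  (forall w, ~ holds (scons w (scons n (fun _ => 0))) dA) ->
  rho 0 = num M n -> ~ sat M rho rosser.
Proof.
  intros HB HA Hr [w [Hw Hall]]. destruct (le_num_total _ _ M_R w v) as [H|H].
  - destruct (le_num_standard _ _ M_R _ _ H) as [m [_ ->]].
    apply (@sat_witness_form _ _ _ m n) in Hw; trivial. now apply (HA m).
  - apply (Hall (num M v)); [exact H|]. now apply (@sat_witness_form _ _ _ v n).
Qed.

End Rosser.

(** * [U_AB A B] is interpretable in [R_ax] *)

Definition interpUR (psi : form LR) : interp LU LR :=
  @Build_interp LU LR (ttrue LR) (fun _ => psi)
    (fun f : fU => match f with
       | fU_zero => equ (var 0) (numR 0)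
       | fU_succ => equ (var 1) (@func LR fR_succ (Vector.cons _ (var 0) 0 (Vector.nil _)))
       end).

Section ReductU.
Variable psi : form LR.
Hypothesis psi_bound : fbound 1 psi.
Variable M : structure LR.

(** The internal model of the interpretation: by [sat_tr], truth of a translation in [M] is truth of
    the original here. *)
Definition reductU : structure LU :=
  @Build_structure LU M
    (fun f : fU => match f return Vector.t M (arU f) -> M with
       | fU_zero => fun _ => num M 0
       | fU_succ => fun v => succM M (Vector.hd v)
       end)
    (fun _ v => sat M (fun _ => Vector.hd v) psi).

Lemma sat_tr_term t : forall off y (rho sigma : nat -> M),
  (forall n, rho (n + off) = sigma n) ->
  sat M rho (tr_term (interpUR psi) off y t) <-> eval reductU sigma t = rho y.
Proof.
  induction t as [n|[|] v IH] using term_nested_ind; intros off y rho sigma H.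
  - simpl. now rewrite H.
  - rewrite (Vector.nil_spec v) at 1. simpl. rewrite Nat.add_0_r. split; [intros (_ & _ & E)|]; auto.
  - revert IH. apply (Vector.caseS' v). intros t w. rewrite (Vector.nil_spec w). intros IH.
    apply Vector.Forall_cons_iff in IH as [IH _].
    simpl. rewrite !Nat.add_1_r. simpl.
    assert (E : forall d, sat M (scons d rho) (tr_term (interpUR psi) (S off) 0 t) <->
                     eval reductU sigma t = d).
    { intros d. apply (IH (S off) 0 (scons d rho) sigma).
      intros n. rewrite Nat.add_succ_r. apply H. }
    split.
    + intros [d [[H1 _] [_ H2]]]. apply E in H1. subst. symmetry. exact H2.
    + intros H1. exists (eval reductU sigma t). rewrite E. repeat split; auto.
Qed.

Lemma sat_tr p : forall rho : nat -> M, sat M rho (tr (interpUR psi) p) <-> sat reductU rho p.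
Proof.
  induction p as [|[] v|a b|a IHa b IHb|a IHa b IHb|a IHa b IHb|a IHa|a IHa]; intros rho.
  - reflexivity.
  - apply (Vector.caseS' v). intros t w. rewrite (Vector.nil_spec w). simpl.
    assert (E : forall d, sat M (scons d rho) (tr_term (interpUR psi) 1 0 t) <-> eval reductU rho t = d).
    { intros d. apply (@sat_tr_term t 1 0 (scons d rho) rho). intros n. now rewrite Nat.add_1_r. }
    assert (E' : forall d, sat M (scons d rho) psi <-> sat M (fun _ => d) psi).
    { intros d. apply sat_bound with 1; [|exact psi_bound]. intros n Hn. now replace n with 0 by lia. }
    split.
    + intros [d [[H1 _] [_ H2]]]. apply E in H1. apply E' in H2. now subst.
    + intros H. exists (eval reductU rho t). rewrite E, E'. repeat split; auto.
  - assert (E : forall t d, sat M (scons d rho) (tr_term (interpUR psi) 1 0 t) <-> eval reductU rho t = d).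
    { intros t d. apply (@sat_tr_term t 1 0 (scons d rho) rho). intros n. now rewrite Nat.add_1_r. }
    simpl. split.
    + intros [d [_ [H1 H2]]]. apply E in H1, H2. congruence.
    + intros H. exists (eval reductU rho a). rewrite !E. repeat split; auto.
  - simpl. now rewrite IHa, IHb.
  - simpl. now rewrite IHa, IHb.
  - simpl. now rewrite IHa, IHb.
  - simpl. split; intros H d; [apply IHa, H; auto|intros _; apply IHa, H].
  - simpl. split; intros [d H]; exists d; [apply IHa, H|split; [auto|now apply IHa]].
Qed.

Lemma eval_numU (rho : nat -> M) n : eval reductU rho (numU n) = num M n.
Proof. induction n as [|n IH]; [reflexivity|]. simpl. now rewrite IH. Qed.

End ReductU.

Theorem U_AB_interpretable_R (A B : nat -> Prop) :
  re_set A -> re_set B -> (forall n, A n -> B n -> False) -> interpretable (U_AB A B) R_ax.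
Proof.
  intros HA HB Hdis.
  assert (HD : forall X, re_set X -> exists d, forall n,
            X n <-> exists w, holds (scons w (scons n (fun _ => 0))) d).
  { intros X HX. apply re_set_Sig in HX as [Q [[d Hd] HQ]]. exists d. intros n.
    rewrite (HQ (scons n (fun _ => 0)) : X n <-> _).
    split; intros [w Hw]; exists w; apply (Hd (scons w (scons n (fun _ => 0)))); exact Hw. }
  destruct (HD A HA) as [dA EA], (HD B HB) as [dB EB].
  pose proof (rosser_bound dA dB) as Hb.
  exists (interpUR (rosser dA dB)). split.
  - split; [simpl; auto|split]; [intros []; exact Hb|].
    intros [|]; simpl; repeat split; auto; lia.
  (* It is enough that every model of [R_ax] has a reduct satisfying the axioms of [U_AB A B];
     soundness in the reduct passes from axioms to all theorems. *)
  - intros p _ Hp. apply R_complete. intros M rho M_R. apply (sat_tr _ Hb).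
    apply (@tprv_sound LU (reductU (rosser dA dB) M) (U_AB A B) p rho Hp).
    intros q [m n Hmn|n Hn|n Hn]; simpl.
    + rewrite !eval_numU. intros E. now apply (num_inj _ _ M_R) in E.
    + rewrite eval_numU. destruct (proj1 (EA n) Hn) as [w Hw].
      apply (@rosser_holds dA dB M rho M_R n w); [trivial| |reflexivity].
      intros v Hv. apply (Hdis n Hn). apply EB. now exists v.
    + rewrite eval_numU. destruct (proj1 (EB n) Hn) as [v Hv].
      apply (@rosser_fails dA dB M rho M_R n v); [trivial| |reflexivity].
      intros w Hw. apply (Hdis n); [|trivial]. apply EA. now exists w.
Qed.

(** * No formula orders an infinite set in a coloured successor structure *)

Definition succ_structure (P : nat -> Prop) : structure LU :=
  @Build_structure LU nat
    (fun f : fU => match f return Vector.t nat (arU f) -> nat with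
       | fU_zero => fun _ => 0
       | fU_succ => fun v => S (Vector.hd v)
       end)
    (fun _ v => P (Vector.hd v)).

(** The pigeonhole argument: among the finitely many patterns of [m] colours, those occurring only
    finitely often in [Z] are left behind by [D], and the others recur without end. The induction
    splits [Z] by the last colour, and [Z] must therefore vary. *)
Lemma recurrent_patterns (m : nat) (Q : nat -> nat -> Prop) : forall Z : nat -> Prop,
  exists D, forall x, D < x -> Z x -> forall E, exists y, E < y /\ Z y /\
    forall i, i < m -> (Q i x <-> Q i y).
Proof.
  induction m as [|m IH]; intros Z.
  - destruct (classic (exists D, forall x, D < x -> ~ Z x)) as [[D HD]|H].
    + exists D. intros x Hx Hz. destruct (HD x Hx Hz).
    + exists 0. intros x _ _ E. apply NNPP. intros Hn. apply H. exists E. intros y Hy Hz.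
      apply Hn. exists y. split; [trivial|split; [trivial|lia]].
  - destruct (IH (fun x => Z x /\ Q m x)) as [D1 H1].
    destruct (IH (fun x => Z x /\ ~ Q m x)) as [D2 H2].
    exists (D1 + D2). intros x Hx Hz E. destruct (classic (Q m x)) as [Hq|Hq].
    + destruct (H1 x ltac:(lia) (Logic.conj Hz Hq) E) as [y [Hy [[Hzy Hqy] Ha]]].
      exists y. split; [trivial|split; [trivial|]]. intros i Hi.
      destruct (Nat.eq_dec i m) as [->|]; [tauto|]. apply Ha; lia.
    + destruct (H2 x ltac:(lia) (Logic.conj Hz Hq) E) as [y [Hy [[Hzy Hqy] Ha]]].
      exists y. split; [trivial|split; [trivial|]]. intros i Hi.
      destruct (Nat.eq_dec i m) as [->|]; [tauto|]. apply Ha; lia.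
Qed.

Section Locality.
Variable P : nat -> Prop.
Notation M := (succ_structure P).

(** The equation [u + y = v + x] says that [u] and [v] have the same signed offset from [x] and [y].
    The additive form avoids truncated subtraction near 0. *)
Definition same_window (r x y : nat) : Prop :=
  forall u v, u + y = v + x -> u <= x + r -> x <= u + r -> (P u <-> P v).

(* [k] pebbles in the same position up to moving the blocks of pebbles at mutual
   distance at most [r] that lie beyond [D], where the colours within distance [r] agree. *)
Definition similar (k r D : nat) (rho sigma : nat -> nat) : Prop :=
  (forall i, i < k -> (rho i <= D \/ sigma i <= D -> rho i = sigma i) /\
               same_window r (rho i) (sigma i)) /\
  (forall i j d, i < k -> j < k -> d <= r -> (rho i + d = rho j <-> sigma i + d = sigma j)).

Lemma same_window_sym r x y : same_window r x y -> same_window r y x.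
Proof. intros H u v E1 E2 E3. symmetry. apply H; lia. Qed.

Lemma similar_sym k r D rho sigma : similar k r D rho sigma -> similar k r D sigma rho.
Proof.
  intros [H1 H2]. split.
  - intros i Hi. destruct (H1 i Hi) as [Ha Hb]. split; [|now apply same_window_sym].
    intros H. symmetry. apply Ha. tauto.
  - intros i j d Hi Hj Hd. symmetry. now apply H2.
Qed.

Lemma similar_mono k r r' D D' rho sigma :
  r <= r' -> D <= D' -> similar k r' D' rho sigma -> similar k r D rho sigma.
Proof.
  intros Hr HD [H1 H2]. split.
  - intros i Hi. destruct (H1 i Hi) as [Ha Hb]. split.
    + intros [H|H]; apply Ha; lia.
    + intros u v E1 E2 E3. apply Hb; lia.
  - intros i j d Hi Hj Hd. apply H2; lia.
Qed.

Lemma bounded_values (sigma : nat -> nat) k : exists E, forall i, i < k -> sigma i <= E.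
Proof.
  induction k as [|k [E HE]]; [exists 0; lia|]. exists (E + sigma k). intros i Hi.
  destruct (Nat.eq_dec i k) as [->|]; [lia|]. specialize (HE i). lia.
Qed.

Lemma window_recurrence r : exists D0, forall x, D0 < x -> r < x ->
  forall E, exists y, E < y /\ same_window r x y.
Proof.
  (* A window has [2 * r + 1] positions, indexed by [d] as [x + d - r]; the subtraction is exact
     because [r < x], and for [y] because it is sought beyond [E + r]. *)
  destruct (@recurrent_patterns (2 * r + 1) (fun d x => P (x + d - r)) (fun _ => True)) as [D0 HD].
  exists D0. intros x Hx Hr E. destruct (HD x Hx I (E + r)) as [y [Hy [_ Ha]]].
  exists y. split; [lia|]. intros u v E1 E2 E3.
  specialize (Ha (u + r - x) ltac:(lia)).
  replace (x + (u + r - x) - r) with u in Ha by lia.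
  replace (y + (u + r - x) - r) with v in Ha by lia. trivial.
Qed.

Lemma similar_scons k r D rho sigma x y :
  similar k r D rho sigma ->
  (x <= D \/ y <= D -> x = y) -> same_window r x y ->
  (forall j d, j < k -> d <= r -> (x + d = rho j <-> y + d = sigma j)) ->
  (forall j d, j < k -> d <= r -> (rho j + d = x <-> sigma j + d = y)) ->
  similar (S k) r D (scons x rho) (scons y sigma).
Proof.
  intros [H1 H2] Hxy Hw Hr Hl. split.
  - intros [|i] Hi; simpl; [now split|]. apply H1. lia.
  - intros [|i] [|j] d Hi Hj Hd; simpl.
    + lia.
    + apply Hr; lia.
    + apply Hl; lia.
    + apply H2; lia.
Qed.

(** One move of the back-and-forth game. A new pebble within [r] of an old one keeps its position
    relative to it, which is why the radius must double: the window of the new pebble, and the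
    pebbles within [r] of it, lie within [2 * r] of the old one. *)
Lemma similar_extend r D : exists r' D', forall k rho sigma, similar k r' D' rho sigma ->
  forall x, exists y, similar (S k) r D (scons x rho) (scons y sigma).
Proof.
  destruct (window_recurrence r) as [D0 HD0].
  (* Beyond [D1], windows do not reach 0 and their patterns recur. The margin of [3 * r] keeps all
     pebbles near a pinned position pinned as well. *)
  pose (D1 := D + r + D0). exists (2 * r), (D1 + 3 * r). intros k rho sigma Hs x.
  assert (Hs1 : similar k r D1 rho sigma) by (revert Hs; apply similar_mono; lia).
  enough (exists y, similar (S k) r D1 (scons x rho) (scons y sigma)) as [y Hy].
  { exists y. revert Hy. apply similar_mono; lia. }
  (* A small pebble is answered by itself: old pebbles within [r] of it are at most [D1 + 2 * r] and
     thus agree on both sides. *)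
  destruct (le_lt_dec x (D1 + r)) as [Hsmall|Hlarge].
  - exists x. destruct Hs as [H1 H2]. apply similar_scons; trivial.
    + intros u v E1 E2 E3. now replace v with u by lia.
    + intros j d Hj Hd. destruct (H1 j Hj) as [Ha _]. lia.
    + intros j d Hj Hd. destruct (H1 j Hj) as [Ha _]. lia.
  - destruct (classic (exists i, i < k /\ x <= rho i + r /\ rho i <= x + r)) as [[i [Hi [Hi1 Hi2]]]|Hfar].
    + destruct Hs as [H1 H2]. destruct (H1 i Hi) as [Ha Hb].
      exists (x + sigma i - rho i).
      (* Either [sigma i] is small, hence pinned to [rho i], or it exceeds [D1 + 3 * r], which is
         more than the distance [r] that may have to be subtracted. *)
      assert (Hle : rho i <= x + sigma i).
      { destruct (le_lt_dec (sigma i) (D1 + 3 * r)); lia. }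
      assert (Hxy : x + sigma i - rho i + rho i = x + sigma i) by lia.
      revert Hxy. generalize (x + sigma i - rho i). intros y Hxy.
      apply similar_scons; trivial.
      * lia.
      * intros u v E1 E2 E3. apply Hb; lia.
      * intros j d Hj Hd.
        destruct (le_lt_dec (rho i) (x + d)) as [Hc|Hc].
        -- specialize (H2 i j (x + d - rho i) Hi Hj ltac:(lia)). lia.
        -- specialize (H2 j i (rho i - (x + d)) Hj Hi ltac:(lia)). lia.
      * intros j d Hj Hd.
        destruct (le_lt_dec (rho i + d) x) as [Hc|Hc].
        -- specialize (H2 i j (x - (rho i + d)) Hi Hj ltac:(lia)). lia.
        -- specialize (H2 j i (rho i + d - x) Hj Hi ltac:(lia)). lia.
    (* A pebble far from all others is answered by a recurrence of its window beyond every pebble of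
       [sigma], so that no short distance arises there either. *)
    + destruct (bounded_values sigma k) as [E HE].
      destruct (HD0 x ltac:(lia) ltac:(lia) (D1 + E + r)) as [y [Hy Hw]].
      exists y. apply similar_scons; trivial.
      * lia.
      * intros j d Hj Hd. specialize (HE j Hj). split; [|lia].
        intros Hx. exfalso. apply Hfar. exists j. lia.
      * intros j d Hj Hd. specialize (HE j Hj). split; [|lia].
        intros Hx. exfalso. apply Hfar. exists j. lia.
Qed.

Lemma term_shape (t : term LU) k : tbound k t ->
  (exists c, forall rho, eval M rho t = c) \/
  (exists i c, i < k /\ forall rho, eval M rho t = rho i + c).
Proof.
  induction t as [n|[|] v IH] using term_nested_ind; intros Hb.
  - right. exists n, 0. split; [exact Hb|]. intros; simpl; lia.
  - left. now exists 0.
  - rewrite tbound_func in Hb. revert IH Hb. apply (Vector.caseS' v). intros t w IH Hb.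
    apply Vector.Forall_cons_iff in IH as [IH _]. apply Vector.Forall_cons_iff in Hb as [Hb _].
    destruct (IH Hb) as [[c Hc]|[i [c [Hi Hc]]]].
    + left. exists (S c). intros rho. simpl. now rewrite Hc.
    + right. exists i, (S c). split; [trivial|]. intros rho. simpl. rewrite Hc. lia.
Qed.

(** Radius and threshold depend on the formula alone. Terms are constants or a variable plus a
    constant: an atom [P] of [x + c] needs radius [c], an equation of two variables the distance
    between their constants, and an equation with a constant [c] the threshold [c]. Each quantifier
    is paid for by [similar_extend]. *)
Lemma locality p : forall k, fbound k p -> exists r D, forall rho sigma,
  similar k r D rho sigma -> (sat M rho p <-> sat M sigma p).
Proof.
  assert (Hbin : forall k a b,
    (exists r D, forall rho sigma, similar k r D rho sigma -> (sat M rho a <-> sat M sigma a)) ->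
    (exists r D, forall rho sigma, similar k r D rho sigma -> (sat M rho b <-> sat M sigma b)) ->
    exists r D, forall rho sigma, similar k r D rho sigma ->
      (sat M rho a <-> sat M sigma a) /\ (sat M rho b <-> sat M sigma b)).
  { intros k a b [r1 [D1 H1]] [r2 [D2 H2]]. exists (r1 + r2), (D1 + D2). intros rho sigma Hs.
    split; [apply H1|apply H2]; revert Hs; apply similar_mono; lia. }
  induction p as [|[] v|a b|a IHa b IHb|a IHa b IHb|a IHa b IHb|a IHa|a IHa]; intros k Hb.
  - exists 0, 0. simpl. tauto.
  - revert Hb. apply (Vector.caseS' v). intros t w Hb. simpl in Hb.
    apply Vector.Forall_cons_iff in Hb as [Hb _].
    destruct (term_shape t _ Hb) as [[c Hc]|[i [c [Hi Hc]]]].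
    + exists 0, 0. intros rho sigma _. simpl. now rewrite !Hc.
    + exists c, 0. intros rho sigma [H1 _]. simpl. rewrite !Hc. apply (H1 i Hi); lia.
  - destruct Hb as [Ha Hb]. simpl.
    destruct (term_shape a _ Ha) as [[c Hc]|[i [c [Hi Hc]]]],
             (term_shape b _ Hb) as [[c' Hc']|[i' [c' [Hi' Hc']]]].
    + exists 0, 0. intros rho sigma _. now rewrite Hc, Hc', Hc, Hc'.
    + exists 0, c. intros rho sigma [H1 _]. rewrite Hc, Hc', Hc, Hc'. destruct (H1 i' Hi') as [H _]. lia.
    + exists 0, c'. intros rho sigma [H1 _]. rewrite Hc, Hc', Hc, Hc'. destruct (H1 i Hi) as [H _]. lia.
    + exists (c + c'), 0. intros rho sigma [_ H2]. rewrite Hc, Hc', Hc, Hc'.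
      destruct (le_lt_dec c c') as [Hcc|Hcc].
      * specialize (H2 i' i (c' - c) Hi' Hi ltac:(lia)). lia.
      * specialize (H2 i i' (c - c') Hi Hi' ltac:(lia)). lia.
  - destruct Hb as [Ha Hb]. destruct (Hbin k a b (IHa k Ha) (IHb k Hb)) as [r [D H]].
    exists r, D. intros rho sigma Hs. specialize (H _ _ Hs). simpl. tauto.
  - destruct Hb as [Ha Hb]. destruct (Hbin k a b (IHa k Ha) (IHb k Hb)) as [r [D H]].
    exists r, D. intros rho sigma Hs. specialize (H _ _ Hs). simpl. tauto.
  - destruct Hb as [Ha Hb]. destruct (Hbin k a b (IHa k Ha) (IHb k Hb)) as [r [D H]].
    exists r, D. intros rho sigma Hs. specialize (H _ _ Hs). simpl. tauto.
  - destruct (IHa (S k) Hb) as [r [D H]]. destruct (similar_extend r D) as [r' [D' Hext]].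
    exists r', D'. intros rho sigma Hs. simpl. split; intros Hall x.
    + destruct (Hext k sigma rho (similar_sym Hs) x) as [y Hy]. now apply (H _ _ Hy).
    + destruct (Hext k rho sigma Hs x) as [y Hy]. now apply (H _ _ Hy).
  - destruct (IHa (S k) Hb) as [r [D H]]. destruct (similar_extend r D) as [r' [D' Hext]].
    exists r', D'. intros rho sigma Hs. simpl. split; intros [x Hx].
    + destruct (Hext k rho sigma Hs x) as [y Hy]. exists y. now apply (H _ _ Hy).
    + destruct (Hext k sigma rho (similar_sym Hs) x) as [y Hy]. exists y. now apply (H _ _ Hy).
Qed.

Lemma injective_unbounded (a : nat -> nat) : (forall i j, a i = a j -> i = j) ->
  forall c, exists E, forall i, E < i -> c < a i.
Proof.
  intros Ha. induction c as [|c [E HE]].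
  - destruct (classic (exists i, a i = 0)) as [[i Hi]|H].
    + exists i. intros j Hj. destruct (Nat.eq_dec (a j) 0) as [E|]; [|lia].
      assert (i = j) by (apply Ha; congruence). lia.
    + exists 0. intros j _. destruct (Nat.eq_dec (a j) 0) as [E|]; [|lia]. destruct H. now exists j.
  - destruct (classic (exists i, a i = S c)) as [[i Hi]|H].
    + exists (E + i). intros j Hj. specialize (HE j ltac:(lia)).
      destruct (Nat.eq_dec (a j) (S c)) as [Ej|]; [|lia].
      assert (i = j) by (apply Ha; congruence). lia.
    + exists E. intros j Hj. specialize (HE j Hj).
      destruct (Nat.eq_dec (a j) (S c)) as [Ej|]; [|lia]. destruct H. now exists j.
Qed.

(** Two elements beyond the threshold, with equal windows and more than [r] apart, form a pair that
    is similar to the reversed pair: no element is pinned, and no short distance tells the orders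
    apart. *)
Theorem no_definable_order (p : form LU) (a : nat -> nat) (e : nat -> nat) :
  fbound 2 p -> (forall i j, a i = a j -> i = j) ->
  exists i j, i < j /\
    (sat M (scons (a i) (scons (a j) e)) p <-> sat M (scons (a j) (scons (a i) e)) p).
Proof.
  intros Hp Ha. destruct (locality p 2 Hp) as [r [D H]].
  destruct (@recurrent_patterns (2 * r + 1) (fun d i => P (a i + d - r)) (fun _ => True)) as [D0 HD0].
  destruct (injective_unbounded a Ha (D + r)) as [E1 HE1].
  pose (i := S (D0 + E1)). assert (Hi : D + r < a i) by (apply HE1; lia).
  destruct (injective_unbounded a Ha (a i + r)) as [E2 HE2].
  (* Recurrence is applied to the indices, so the new element stays in the range of [a]. Asking for
     an index beyond [i + E2] gives both [i < j] and, by injectivity of [a], a value more than [r]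
     above [a i]. *)
  destruct (HD0 i ltac:(lia) I (i + E2)) as [j [Hj [_ Hw]]].
  specialize (HE2 j ltac:(lia)).
  assert (Hwin : same_window r (a i) (a j)).
  { intros u v F1 F2 F3. specialize (Hw (u + r - a i) ltac:(lia)).
    replace (a i + (u + r - a i) - r) with u in Hw by lia.
    replace (a j + (u + r - a i) - r) with v in Hw by lia. trivial. }
  exists i, j. split; [lia|]. apply H. split.
  - intros [|[|n]] Hn; [| |lia]; simpl; (split; [lia|]); [trivial|now apply same_window_sym].
  - intros [|[|n]] [|[|m]] d Hn Hm Hd; simpl; lia.
Qed.

End Locality.

(** * [R_ax] is not interpretable in [U_AB A B] *)

Section TranslatedNumeralsR.
Variable L : lang.
Variable I : interp LR L.

Variable M : structure L.

Definition val (n : nat) (d : M) : Prop := sat M (fun _ => d) (tr_term I 0 0 (numR n)).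
Definition dom (d : M) : Prop := sat M (fun _ => d) (idom I).

Lemma sat_dom_at rho i : sat M rho (dom_at I i) <-> dom (rho i).
Proof. unfold dom_at. now rewrite sat_fsubst. Qed.

(** The substitution into the graph of a function symbol sends every variable beyond the arguments
    to the value variable, so only [rho y] matters. *)
Lemma sat_tr_numR n : forall rho off y, sat M rho (tr_term I off y (numR n)) <-> val n (rho y).
Proof.
  unfold val. induction n as [|n IH]; intros rho off y.
  - simpl. rewrite !sat_fsubst, Nat.add_0_r. simpl. reflexivity.
  - cbn [numR Nat.iter]. simpl. fold (numR n).
    assert (E : forall d,
      sat M (scons d rho) (fsubst (fun j => if j <? 1 then var j else var (y + 1)) (ifun I fR_succ)) <->
      sat M (scons d (fun _ => rho y)) (fsubst (fun j => if j <? 1 then var j else var 1) (ifun I fR_succ))).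
    { intros d. rewrite !sat_fsubst. replace (fun n0 => eval M (scons d rho) _) with
        (fun n0 => eval M (scons d (fun _ => rho y)) (if n0 <? 1 then var n0 else var 1)); [reflexivity|].
      extensionality j. rewrite Nat.add_1_r. destruct (Nat.ltb_spec j 1); simpl; [|reflexivity].
      now replace j with 0 by lia. }
    split; intros [d Hd]; exists d; rewrite !IH, !sat_dom_at, E in *; exact Hd.
Qed.

End TranslatedNumeralsR.

Lemma R_proves_le m n : m <= n -> tprv R_ax (leR (numR m) (numR n)).
Proof.
  intros H. apply R_complete. intros M rho HM. simpl. rewrite !eval_numR.
  now apply (le_num _ _ HM).
Qed.

Lemma R_proves_nle m n : m < n -> tprv R_ax (neg (leR (numR n) (numR m))).
Proof.
  intros H. apply R_complete. intros M rho HM. simpl. rewrite !eval_numR. intros Hle.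
  apply (le_num _ _ HM) in Hle. lia.
Qed.

Lemma leR_sentence m n : sentence (leR (numR m) (numR n)).
Proof. repeat apply Vector.Forall_cons; try apply Vector.Forall_nil; apply numR_closed. Qed.

Theorem R_not_interpretable_U (A B : nat -> Prop) :
  (forall n, A n -> B n -> False) -> ~ interpretable R_ax (U_AB A B).
Proof.
  intros Hdis [I [[_ [Hr _]] HI]].
  pose (M := succ_structure A).
  assert (Hnum : forall rho n, eval M rho (numU n) = n).
  { intros rho. induction n as [|n IH]; [reflexivity|]. simpl. now rewrite IH. }
  assert (HM : forall p rho, sentence p -> tprv R_ax p -> sat M rho (tr I p)).
  { intros p rho Hs Hp. apply (tprv_sound M rho (HI p Hs Hp)).
    intros q [m n H|n H|n H]; simpl; rewrite ?Hnum; eauto. }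
  pose (e := fun _ : nat => 0).
  (* Function symbols are interpreted by mere formulas, so values must be proved to exist. The
     translation of the logical truth that a numeral equals itself says precisely that it has a
     value in the domain. *)
  assert (Hex : forall n, exists d, dom I M d /\ val I M n d).
  { intros n. destruct (HM (equ (numR n) (numR n)) e) as [d [H1 [H2 _]]].
    - split; apply numR_closed.
    - exists []. split; [intros q []|apply EqRefl].
    - exists d. apply sat_dom_at in H1. apply sat_tr_numR in H2. now split. }
  pose (a n := epsilon (inhabits 0) (fun d => dom I M d /\ val I M n d)).
  assert (Ha : forall n, dom I M (a n) /\ val I M n (a n)).
  { intros n. apply (epsilon_spec (inhabits 0) (fun d => dom I M d /\ val I M n d)), Hex. }
  (* Uniqueness of values is likewise obtained by translating a logically valid sentence, which
     holds in [M] because the interpretation preserves all theorems. *)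
  assert (Huniq : forall n x y, dom I M x -> dom I M y -> val I M n x -> val I M n y -> x = y).
  { intros n x y Hx Hy Vx Vy.
    assert (Hu : sat M e (tr I (all (all (imp (equ (var 1) (numR n))
                   (imp (equ (var 0) (numR n)) (equ (var 1) (var 0)))))))).
    { apply HM.
      - simpl. repeat split; try apply numR_bound; simpl; lia.
      - apply R_complete. intros M' rho _ d d'. simpl. rewrite !eval_numR. congruence. }
    apply (proj2 (sat_dom_at I M (scons x e) 0)) in Hx as Dx.
    apply (proj2 (sat_dom_at I M (scons y (scons x e)) 0)) in Hy as Dy.
    destruct (Hu x Dx y Dy) as [z [_ [Hz1 Hz2]]].
    - exists x. split; [now apply sat_dom_at|]. split; [reflexivity|now apply sat_tr_numR].
    - exists y. split; [now apply sat_dom_at|]. split; [reflexivity|now apply sat_tr_numR].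
    - simpl in Hz1, Hz2. congruence. }
  pose (le x y := sat M (scons x (scons y e)) (irel I tt)).
  assert (Hle : forall m n, sat M e (tr I (leR (numR m) (numR n))) <-> le (a m) (a n)).
  { intros m n. split.
    - intros [y [x [[Hx [Hy _]] [[Dy [Dx _]] H]]]].
      apply sat_tr_numR in Hx, Hy. apply sat_dom_at in Dx, Dy. simpl in Hx, Hy, Dx, Dy.
      destruct (Ha m), (Ha n).
      rewrite (Huniq m (a m) x), (Huniq n (a n) y); trivial.
    - intros H. exists (a n), (a m). destruct (Ha m), (Ha n).
      repeat split; try (apply sat_tr_numR; trivial); try (apply sat_dom_at; trivial).
      all: try exact H; exact (fun f => f). }
  (* The values [a n] of the numerals are distinct by [R3]. For [i < j], the theory proves one
     inequality between the numerals and refutes the converse, which contradicts the agreement of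
     both orders on the pair found here. *)
  destruct (@no_definable_order A (irel I tt) a e) as [i [j [Hij E]]].
  - apply (Hr tt).
  - intros i j Eij. destruct (Nat.eq_dec i j) as [|Hn]; [trivial|exfalso].
    apply (HM (neg (equ (numR i) (numR j))) e).
    + repeat split; apply numR_closed.
    + apply tprv_ax. now constructor.
    + exists (a i). destruct (Ha i), (Ha j).
      repeat split; [now apply sat_dom_at|now apply sat_tr_numR|apply sat_tr_numR]. simpl.
      now rewrite Eij.
  - apply (HM (neg (leR (numR j) (numR i))) e).
    + split; [apply leR_sentence|exact Logic.I].
    + now apply R_proves_nle.
    + apply Hle. apply E. apply Hle. apply HM; [apply leR_sentence|]. apply R_proves_le. lia.
Qed.

Theorem mainTheorem6 (A B : nat -> Prop) :
  rec_inseparable A B ->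
  re_theory (U_AB A B) /\ G1 (U_AB A B) /\ strictly_below (U_AB A B) R_ax.
Proof.
  intros H. pose proof H as [HA [HB [Hdis _]]]. repeat split.
  - now apply U_AB_re.
  - now apply U_AB_re.
  - now apply U_AB_G1.
  - now apply U_AB_interpretable_R.
  - now apply R_not_interpretable_U.
Qed.
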